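(* Let $\mathfrak{g}=\mathfrak{g}_0\oplus\mathfrak{g}_1$ be a finite dimensional Lie superalgebra over $\mathbb{C}$. Let $N$ be a nonzero finitely generated graded $\operatorname{gr}U(\mathfrak{g})$-module such that $q=\operatorname{ann}_{S(\mathfrak{g}_0)}N$ is prime and $N$ is torsion free as an $S(\mathfrak{g}_0)/q$-module. Let $\mathcal{V}$ be the closed subset of $\mathfrak{g}_0^*$ defined by $q$. Then $d(N)=d(S(\mathfrak{g}_0)/q)$ and $$e(N)\ge 2^{\ell(\mathcal{V})}e(\mathcal{V}).$$ Furthermore, if $e(N)=2^{\ell(\mathcal{V})}e(\mathcal{V})$, then $C_q$ is split.
   Context: Filtration: $U(\mathfrak{g})$ is filtered by giving $\mathfrak{g}_1$ degree $1$ and $\mathfrak{g}_0$ degree $2$; $U_n$ is the span of products of total degree $\le n$. The associated graded ring $\operatorname{gr}U(\mathfrak{g})$ contains $S(\mathfrak{g}_0)$ as a central subalgebra and is generated over it by $\mathfrak{g}_1$ with relations $uv+vu=[u,v]$ ($u,v\in\mathfrak{g}_1$). Clifford algebra: for a prime $q$ of $S(\mathfrak{g}_0)$, $F_q=\mathrm{Fract}(S(\mathfrak{g}_0)/q)$; the bracket on $\mathfrak{g}_1$, reduced mod $q$, gives a symmetric $F_q$-bilinear form on $\mathfrak{g}_1\otimes F_q$; $k(q)$ is its rank; $C_q$ is the Clifford algebra over $F_q$ (relations $uv+vu=B_q(u,v)$) of the induced nondegenerate form $B_q$ on $(\mathfrak{g}_1\otimes F_q)/\mathrm{rad}$. $C_q$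 is called split if a simple $C_q$-module $L$ has $\dim_{F_q}L=2^{[(k(q)+1)/2]}$, where $[s]$ is the greatest integer $\le s$. Put $\ell(\mathcal{V})=[(k(q)+1)/2]$. Dimension and multiplicity: if $N=\bigoplus_{m\ge0}N(m)$ is a finitely generated graded $S(\mathfrak{g}_0)$-module ($\mathfrak{g}_0$ in degree $1$) and $N_n=\bigoplus_{m\le n}N(m)$, then for $n\gg0$, $\dim N_n=a_d\binom{n}{d}+a_{d-1}\binom{n}{d-1}+\cdots+a_0$ with $a_d\ne0$, and $d(N)=d$, $e(N)=a_d$. For a graded $\operatorname{gr}U(\mathfrak{g})$-module (where $\mathfrak{g}_0$ acts with degree $2$) one regards $N$ as a graded $S(\mathfrak{g}_0)$-module, $\mathfrak{g}_0$ in degree $1$, by putting $N(2m-1)\oplus N(2m)$ in degree $m$, i.e. one uses $\dim N_{2n}$ as the function of $n$. $e(\mathcal{V}):=e(S(\mathfrak{g}_0)/q)$, with the usual grading of $S(\mathfrak{g}_0)$. *)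

(* Defs.v *)
From HB Require Import structures.
From mathcomp Require Import all_boot all_order all_algebra.
(* monalg and mpoly declare clashing notations. *)
From mathcomp Require Import -(notations) monalg.
From mathcomp Require Import ring_quotient fraction.
From mathcomp Require Import boolp classical_sets reals complex mpoly.

Set Implicit Arguments.
Unset Strict Implicit.
Unset Printing Implicit Defensive.

Import Order.TTheory GRing.Theory Num.Theory.

Local Open Scope ring_scope.
Local Open Scope quotient_scope.

Definition restr (A B : pzRingType) (f : {rmorphism A -> B}) (M : lmodType B)
  : Type := M.

Section Restr.
Variables (A B : pzRingType) (f : {rmorphism A -> B}) (M : lmodType B).

HB.instance Definition _ := GRing.Zmodule.on (restr f M).

Definition restr_scale (a : A) (x : restr f M) : restr f M := f a *: (x : M).

Fact restr_scaleA a b x :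
  restr_scale a (restr_scale b x) = restr_scale (a * b) x.
Proof. by rewrite /restr_scale scalerA rmorphM. Qed.

Fact restr_scale1 : left_id 1 restr_scale.
Proof. by move=> x; rewrite /restr_scale rmorph1 scale1r. Qed.

Fact restr_scaleDr : right_distributive restr_scale +%R.
Proof. by move=> a x y; rewrite /restr_scale scalerDr. Qed.

Fact restr_scaleDl x : {morph restr_scale^~ x : a b / a + b >-> a + b}.
Proof. by move=> a b; rewrite /restr_scale rmorphD scalerDl. Qed.

HB.instance Definition _ := GRing.Zmodule_isLmodule.Build A (restr f M)
  restr_scaleA restr_scale1 restr_scaleDr restr_scaleDl.

Lemma restrE (a : A) (x : restr f M) : a *: x = f a *: (x : M).
Proof. by []. Qed.
End Restr.

(* Improper ideals are allowed: the zero ring is a quotient. *)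
Record ideal2 (A : pzRingType) := Ideal2 {
  ideal2_pred :> A -> Prop;
  ideal2_0 : ideal2_pred 0;
  ideal2_B : forall x y, ideal2_pred x -> ideal2_pred y -> ideal2_pred (x - y);
  ideal2_Ml : forall a x, ideal2_pred x -> ideal2_pred (a * x);
  ideal2_Mr : forall a x, ideal2_pred x -> ideal2_pred (x * a) }.

Definition ideal2_mem (A : pzRingType) (I : ideal2 A) : {pred A} :=
  fun x => `[< I x >].

Section Ideal2Quotient.
Variables (A : pzRingType) (I : ideal2 A).

Fact ideal2_zmod_closed : zmod_closed (ideal2_mem I).
Proof.
split=> [|x y]; first exact/asboolP/ideal2_0.
by move=> /asboolP Ix /asboolP Iy; apply/asboolP/ideal2_B.
Qed.

HB.instance Definition _ :=
  GRing.isZmodClosed.Build A (ideal2_mem I) ideal2_zmod_closed.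

Local Notation J := (ideal2_mem I : zmodClosed A).

Definition quot2 : Type := {ideal_quot J}.
HB.instance Definition _ := GRing.Zmodule.on quot2.

Definition qproj (x : A) : quot2 := \pi_{ideal_quot J} x.

Lemma qprojP x y : reflect (qproj x = qproj y) `[< I (x - y) >].
Proof.
apply: (iffP idP) => [h|/eqP].
  by apply/eqP; rewrite piE Quotient.equivE.
by rewrite piE Quotient.equivE.
Qed.

Lemma qproj_eq x y : qproj x = qproj y <-> I (x - y).
Proof. by split=> [/qprojP/asboolP|/asboolP/qprojP]. Qed.

Lemma qproj_surj (u : quot2) : exists x, u = qproj x.
Proof. by exists (repr u); rewrite /qproj reprK. Qed.

Fact qproj_zmod : zmod_morphism qproj.
Proof. by move=> x y; rewrite /qproj raddfB. Qed.

HB.instance Definition _ := GRing.isZmodMorphism.Build A quot2 qproj qproj_zmod.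

End Ideal2Quotient.

(* Locked, since unification otherwise unfolds it. *)
HB.lock Definition quot2_mul (A : pzRingType) (I : ideal2 A) (u v : quot2 I)
  : quot2 I :=
  qproj I (repr (u : {ideal_quot (ideal2_mem I : zmodClosed A)})
           * repr (v : {ideal_quot (ideal2_mem I : zmodClosed A)})).

Section Ideal2QuotientRing.
Variables (A : pzRingType) (I : ideal2 A).

Local Notation J := (ideal2_mem I : zmodClosed A).
Local Notation quot2 := (quot2 I).
Local Notation qproj := (qproj I).
Local Notation quot2_mul := (@quot2_mul A I).

Lemma qprojM x y : quot2_mul (qproj x) (qproj y) = qproj (x * y).
Proof.
have rep z : I (repr (qproj z : {ideal_quot J}) - z).
  by apply/qproj_eq; rewrite {1}/qproj reprK.
rewrite quot2_mul.unlock; apply/qproj_eq; set x' := repr _; set y' := repr _.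
have -> : x' * y' - x * y = (x' - x) * y' - x * - (y' - y).
  by rewrite mulrN opprK mulrBl mulrBr addrA subrK.
apply: ideal2_B; first exact/ideal2_Mr/rep.
by apply: ideal2_Ml; rewrite -sub0r; apply: ideal2_B;
  [exact: ideal2_0 | exact: rep].
Qed.

Fact quot2_mulA : associative quot2_mul.
Proof.
move=> u v w; case: (qproj_surj u) (qproj_surj v) (qproj_surj w).
by move=> x -> [y ->] [z ->]; rewrite !qprojM mulrA.
Qed.
Fact quot2_mul1l : left_id (qproj 1) quot2_mul.
Proof. by move=> u; case: (qproj_surj u) => x ->; rewrite qprojM mul1r. Qed.
Fact quot2_mul1r : right_id (qproj 1) quot2_mul.
Proof. by move=> u; case: (qproj_surj u) => x ->; rewrite qprojM mulr1. Qed.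
Fact quot2_mulDl : left_distributive quot2_mul +%R.
Proof.
move=> u v w; case: (qproj_surj u) (qproj_surj v) (qproj_surj w).
by move=> x -> [y ->] [z ->]; rewrite !(=^~ raddfD, qprojM) mulrDl.
Qed.
Fact quot2_mulDr : right_distributive quot2_mul +%R.
Proof.
move=> u v w; case: (qproj_surj u) (qproj_surj v) (qproj_surj w).
by move=> x -> [y ->] [z ->]; rewrite !(=^~ raddfD, qprojM) mulrDr.
Qed.

HB.instance Definition _ := GRing.Zmodule_isPzRing.Build quot2
  quot2_mulA quot2_mul1l quot2_mul1r quot2_mulDl quot2_mulDr.

Fact qproj_monoid : monoid_morphism qproj.
Proof. by split=> // x y; rewrite -qprojM. Qed.

HB.instance Definition _ :=
  GRing.isMonoidMorphism.Build A quot2 qproj qproj_monoid.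
End Ideal2QuotientRing.

Section Ideal2Gen.
Variables (A : pzRingType) (r : A -> Prop).

Let gen (x : A) : Prop :=
  forall J : ideal2 A, (forall y, r y -> J y) -> J x.

Fact gen_0 : gen 0. Proof. by move=> J _; exact: ideal2_0. Qed.
Fact gen_B x y : gen x -> gen y -> gen (x - y).
Proof. by move=> gx gy J rJ; apply: ideal2_B; [exact: gx|exact: gy]. Qed.
Fact gen_Ml a x : gen x -> gen (a * x).
Proof. by move=> gx J rJ; apply/ideal2_Ml/gx. Qed.
Fact gen_Mr a x : gen x -> gen (x * a).
Proof. by move=> gx J rJ; apply/ideal2_Mr/gx. Qed.

Definition ideal2_gen : ideal2 A := Ideal2 gen_0 gen_B gen_Ml gen_Mr.

Lemma ideal2_gen_sub x : r x -> ideal2_gen x.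
Proof. by move=> rx J; apply. Qed.
End Ideal2Gen.

(* The free associative K-algebra on the set X. *)
Notation free_alg K X := (monalg.malg (monalg.fmonom X) K).

Section FreeAlg.
Variables (K : fieldType) (X : choiceType).

Definition free_gen (x : X) : free_alg K X :=
  monalg.mkmalgU (monalg.fmu x) 1.
Definition free_scal : {rmorphism K -> free_alg K X} :=
  @monalg.mkmalgU (monalg.fmonom X) K monalg.mone.
(* The augmentation, which kills X. *)
Definition free_aug : {rmorphism free_alg K X -> K} :=
  @monalg.mcoeff (monalg.fmonom X) K monalg.mone.

Lemma free_aug_gen x : free_aug (free_gen x) = 0.
Proof.
rewrite /free_aug /free_gen /= monalg.mcoeffU.
case: eqP => // /(congr1 (@monalg.fmonom_val X)).
by rewrite monalg.fmU monalg.fm1.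
Qed.
End FreeAlg.

Structure lieSuperalgebra (K : fieldType) := LieSuperalgebra {
  lie_sort :> vectType K;
  (* lie_part false is the even part, lie_part true is the odd part *)
  lie_part : bool -> {vspace lie_sort};
  lie_br : lie_sort -> lie_sort -> lie_sort;
  lie_part_sum : (lie_part false + lie_part true)%VS = fullv;
  lie_part_cap : (lie_part false :&: lie_part true)%VS = 0%VS;
  lie_br_linearl : forall y, linear (lie_br ^~ y);
  lie_br_linearr : forall x, linear (lie_br x);
  lie_br_part : forall a b x y,
    x \in lie_part a -> y \in lie_part b -> lie_br x y \in lie_part (a (+) b);
  lie_skew : forall a b x y, x \in lie_part a -> y \in lie_part b ->
    lie_br x y = - ((-1) ^+ (a && b) *: lie_br y x);
  lie_jacobi : forall a b x y z, x \in lie_part a -> y \in lie_part b ->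
    lie_br x (lie_br y z)
    = lie_br (lie_br x y) z + (-1) ^+ (a && b) *: lie_br y (lie_br x z) }.

(* Stated over an abstract ring, where rewriting is fast. *)
Section RMorphKill.
Variables (A B : pzRingType) (f : {rmorphism A -> B}).

Fact rmorph_lin_eq0 a x y z :
  f x = 0 -> f y = 0 -> f z = 0 -> f (z - (a * x + y)) = 0.
Proof. by move=> hx hy hz; rewrite !(rmorphB, rmorphD, rmorphM) hx hy hz mulr0 addr0 subr0. Qed.

Fact rmorph_br_eq0 a x y z :
  f x = 0 -> f y = 0 -> f z = 0 -> f (x * y - a * (y * x) - z) = 0.
Proof. by move=> hx hy hz; rewrite !(rmorphB, rmorphM) hx hy hz !mulr0 !subr0. Qed.

Lemma rmorph_lin a x y z : f (z - (a * x + y)) = 0 -> f z = f a * f x + f y.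
Proof. by rewrite !(rmorphB, rmorphD, rmorphM) => /eqP; rewrite subr_eq0 => /eqP. Qed.

Lemma rmorph_br n x y z : f (x * y - (-1) ^+ n * (y * x) - z) = 0 ->
  f x * f y - (-1) ^+ n * (f y * f x) = f z.
Proof.
by rewrite !(rmorphB, rmorphM, rmorph_sign) => /eqP; rewrite subr_eq0 => /eqP.
Qed.
End RMorphKill.

Section Enveloping.
Variables (K : fieldType) (g : lieSuperalgebra K).

Local Notation gen := (@free_gen K g).

Variant env_rel : free_alg K g -> Prop :=
| EnvLin c x y :
    env_rel (gen (c *: x + y) - (free_scal K g c * gen x + gen y))
| EnvBr a b x y of x \in lie_part g a & y \in lie_part g b :
    env_rel (gen x * gen y - (-1) ^+ (a && b) * (gen y * gen x)
             - gen (lie_br x y)).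

Definition env : Type := quot2 (ideal2_gen env_rel).
HB.instance Definition _ := GRing.PzRing.on env.

Definition env_proj : {rmorphism free_alg K g -> env} :=
  @qproj _ (ideal2_gen env_rel).
Definition env_in (x : g) : env := env_proj (gen x).
Definition env_scal : {rmorphism K -> env} := env_proj \o @free_scal K g.

Fact aug_0 : free_aug K g 0 = 0. Proof. exact: rmorph0. Qed.
Fact aug_B x y : free_aug K g x = 0 -> free_aug K g y = 0 ->
  free_aug K g (x - y) = 0.
Proof. by move=> hx hy; rewrite rmorphB hx hy subr0. Qed.
Fact aug_Ml a x : free_aug K g x = 0 -> free_aug K g (a * x) = 0.
Proof. by move=> hx; rewrite rmorphM hx mulr0. Qed.
Fact aug_Mr a x : free_aug K g x = 0 -> free_aug K g (x * a) = 0.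
Proof. by move=> hx; rewrite rmorphM hx mul0r. Qed.

Fact env_neq0 : (1 : env) != 0.
Proof.
have hker t : env_rel t -> free_aug K g t = 0.
  case=> [c x y|a b x y _ _].
    by apply: rmorph_lin_eq0; exact: free_aug_gen.
  by apply: rmorph_br_eq0; exact: free_aug_gen.
apply/eqP => h; suff /eqP: free_aug K g 1 = 0 by rewrite rmorph1 oner_eq0.
have : ideal2_gen env_rel (1 - 0).
  by apply/qproj_eq; rewrite rmorph1 raddf0; exact: h.
rewrite subr0 => /(_ (Ideal2 aug_0 aug_B aug_Ml aug_Mr)); exact.
Qed.

HB.instance Definition _ := GRing.PzSemiRing_isNonZero.Build env env_neq0.
End Enveloping.

Structure filtration (A : nzRingType) := Filtration {
  fil :> nat -> A -> Prop;
  fil_0 : forall n, fil n 0;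
  fil_B : forall n x y, fil n x -> fil n y -> fil n (x - y);
  fil_S : forall n x, fil n x -> fil n.+1 x;
  fil_1 : fil 0 1;
  fil_M : forall m n x y, fil m x -> fil n y -> fil (m + n) (x * y) }.

(* The associated graded ring \bigoplus_n F n / F n.-1 (F (-1) being 0), built *)
(* as the Rees ring { \sum_n a_n X^n | a_n \in F n }, a subring of {poly A},   *)
(* modulo the ideal { \sum_n a_n X^n | a_n \in F n.-1 }.                       *)
Section AssocGraded.
Variables (A : nzRingType) (F : filtration A).

Lemma fil_D n x y : F n x -> F n y -> F n (x + y).
Proof.
by move=> Fx Fy; rewrite -[y]opprK -[- y]sub0r; apply/fil_B/fil_B/Fy/fil_0.
Qed.

Lemma fil_le m n x : (m <= n)%N -> F m x -> F n x.
Proof.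
move=> /subnK <- Fx; elim: (n - m)%N => // k; rewrite addSn; exact: fil_S.
Qed.

Lemma fil_sum n (I : Type) (s : seq I) (P : pred I) (f : I -> A) :
  (forall i, P i -> F n (f i)) -> F n (\sum_(i <- s | P i) f i).
Proof. by move=> h; elim/big_ind: _ => //; [exact: fil_0|exact: fil_D]. Qed.

Definition rees_mem : {pred {poly A}} := fun p => `[< forall n, F n p`_n >].

Fact rees_closed : subring_closed rees_mem.
Proof.
split=> [|p q|p q].
- apply/asboolP => n; rewrite coef1; case: n => [|n] /=; first exact: fil_1.
  exact: fil_0.
- by move=> /asboolP hp /asboolP hq; apply/asboolP => n; rewrite coefB; apply: fil_B.
- move=> /asboolP hp /asboolP hq; apply/asboolP => n; rewrite coefM.
  apply: fil_sum => i _; rewrite -{1}(subnKC (ltn_ord i : (i <= n)%N)).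
  exact: fil_M.
Qed.

HB.instance Definition _ :=
  GRing.isSubringClosed.Build {poly A} rees_mem rees_closed.

Record rees := Rees { rees_val : {poly A}; _ : rees_val \in rees_mem }.
HB.instance Definition _ := [isSub of rees for rees_val].
HB.instance Definition _ := Choice.copy rees (sub_type rees).
HB.instance Definition _ := GRing.SubChoice_isSubPzRing.Build {poly A} rees_mem rees rees_closed.

Definition fil_pred n x : Prop := if n is n'.+1 then F n' x else x = 0.

Lemma fil_pred_0 n : fil_pred n 0.
Proof. by case: n => [|n] //=; exact: fil_0. Qed.
Lemma fil_pred_B n x y : fil_pred n x -> fil_pred n y -> fil_pred n (x - y).
Proof. by case: n => [-> ->|n] /=; [rewrite subr0|exact: fil_B]. Qed.
Lemma fil_pred_D n x y : fil_pred n x -> fil_pred n y -> fil_pred n (x + y).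
Proof. by case: n => [-> ->|n] /=; [rewrite addr0|exact: fil_D]. Qed.
Lemma fil_pred_Ml m n x y : F m x -> fil_pred n y -> fil_pred (m + n) (x * y).
Proof.
case: n => [|n] Fx /=; last by rewrite addnS; exact: fil_M.
by move->; rewrite mulr0; exact: fil_pred_0.
Qed.
Lemma fil_pred_Mr m n x y : F m x -> fil_pred n y -> fil_pred (n + m) (y * x).
Proof.
case: n => [|n] Fx /= => [->|Fy]; first by rewrite mul0r; exact: fil_pred_0.
exact: fil_M.
Qed.

Let gr_ker (p : rees) : Prop := forall n, fil_pred n (val p)`_n.

Fact gr_ker_0 : gr_ker 0.
Proof. by move=> n; rewrite raddf0 coef0; exact: fil_pred_0. Qed.
Fact gr_ker_B p q : gr_ker p -> gr_ker q -> gr_ker (p - q).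
Proof. by move=> hp hq n; rewrite raddfB coefB; exact: fil_pred_B. Qed.
Fact gr_ker_Ml p q : gr_ker q -> gr_ker (p * q).
Proof.
move=> hq n; rewrite rmorphM coefM; have /asboolP hp := valP p.
elim/big_ind: _ => [||i _]; [exact: fil_pred_0|exact: fil_pred_D|].
by rewrite -{1}(subnKC (ltn_ord i : (i <= n)%N)); exact: fil_pred_Ml.
Qed.
Fact gr_ker_Mr p q : gr_ker q -> gr_ker (q * p).
Proof.
move=> hq n; rewrite rmorphM coefM; have /asboolP hp := valP p.
elim/big_ind: _ => [||i _]; [exact: fil_pred_0|exact: fil_pred_D|].
by rewrite -{1}(subnKC (ltn_ord i : (i <= n)%N)); exact: fil_pred_Mr.
Qed.

Definition gr_ideal : ideal2 rees :=
  Ideal2 gr_ker_0 gr_ker_B gr_ker_Ml gr_ker_Mr.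

Definition gr : Type := quot2 gr_ideal.
HB.instance Definition _ := GRing.PzRing.on gr.

Fact symb_mem n x : F n x -> x *: 'X^n \in rees_mem.
Proof.
move=> Fx; apply/asboolP => m; rewrite coefZ coefXn.
by case: eqP => [->|_]; rewrite ?mulr1 ?mulr0 //; exact: fil_0.
Qed.

(* The class of x : F n in F n / F n.-1 *)
Definition symb n x (Fx : F n x) : gr := qproj gr_ideal (Rees (symb_mem Fx)).

Definition gr_part n : gr -> Prop := fun y => exists x (Fx : F n x), y = symb Fx.

Lemma symb_eq n x y (Fx : F n x) (Fy : F n y) :
  symb Fx = symb Fy <-> fil_pred n (x - y).
Proof.
split=> [/qproj_eq/(_ n)|h]; last apply/qproj_eq => m;
  rewrite raddfB /= coefB !coefZ !coefXn.
  by rewrite eqxx !mulr1.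
by case: eqP => [->|_]; rewrite ?mulr1 // !mulr0 subr0; exact: fil_pred_0.
Qed.

Lemma symbD n x y (Fx : F n x) (Fy : F n y) (Fxy : F n (x + y)) :
  symb Fxy = symb Fx + symb Fy.
Proof.
rewrite /symb -raddfD; congr qproj; apply: val_inj.
by rewrite raddfD /= scalerDl.
Qed.

Lemma symbB n x y (Fx : F n x) (Fy : F n y) (Fxy : F n (x - y)) :
  symb Fxy = symb Fx - symb Fy.
Proof.
rewrite /symb -raddfB; congr qproj; apply: val_inj.
by rewrite raddfB /= scalerBl.
Qed.

Lemma symbM m n x y (Fx : F m x) (Fy : F n y) (Fxy : F (m + n) (x * y)) :
  symb Fxy = symb Fx * symb Fy.
Proof.
rewrite /symb -rmorphM; congr qproj; apply: val_inj; rewrite rmorphM /=.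
rewrite -!mul_polyC polyCM exprD -!mulrA; congr (_ * _).
by rewrite !mulrA; congr (_ * _); rewrite commr_polyXn.
Qed.

Lemma symb1 (F1 : F 0 1) : symb F1 = 1.
Proof.
rewrite /symb -(rmorph1 (qproj gr_ideal)); congr qproj; apply: val_inj.
by rewrite rmorph1 /= expr0 scale1r.
Qed.

Lemma symb_central n x (Fx : F n x) :
  (forall m y, F m y -> fil_pred (m + n) (y * x - x * y)) ->
  forall a : gr, GRing.comm a (symb Fx).
Proof.
move=> hx a; have [p ->] := qproj_surj a; rewrite /GRing.comm /symb -!rmorphM.
apply/qproj_eq => k.
rewrite -[val _]/(val p * (x *: 'X^n) - (x *: 'X^n) * val p) coefB -mul_polyC.
rewrite -[x%:P * _ * _]mulrA -(commr_polyXn (val p)) !mulrA !coefMXn.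
case: ltnP => [_|nk]; first by rewrite subr0; exact: fil_pred_0.
rewrite coefMC coefCM -[X in fil_pred X _](subnK nk); apply: hx.
by have /asboolP := valP p.
Qed.

Fact gr_neq0 : (1 : gr) != 0.
Proof.
apply/eqP => h; have : symb (fil_1 F) = symb (fil_0 F 0).
  rewrite symb1 h; have := symbB (fil_1 F) (fil_1 F).
  rewrite subrr => ->; by rewrite subrr.
by move=> /symb_eq /=; rewrite subr0 => /eqP; rewrite oner_eq0.
Qed.

HB.instance Definition _ := GRing.PzSemiRing_isNonZero.Build gr gr_neq0.
End AssocGraded.

Lemma free_scalC (K : fieldType) (X : choiceType) c (x : free_alg K X) :
  free_scal K X c * x = x * free_scal K X c.
Proof.
rewrite /free_scal /= monalg.mul_malgC; apply/monalg.malgP => m.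
rewrite monalg.mcoeffZ monalg.malgM_def monalg.fgmulgU raddf_sum /=.
rewrite {1}[x]monalg.monalgE raddf_sum mulr_sumr /=; apply: eq_bigr => k _.
by rewrite !monalg.mcoeffU monalg.mulm1 mulrnAr mulrC.
Qed.

Section EnvelopingFiltration.
Variables (K : fieldType) (g : lieSuperalgebra K).

Lemma env_scalC c (u : env g) : env_scal g c * u = u * env_scal g c.
Proof.
have [x ->] := qproj_surj u.
by rewrite /env_scal /= -!rmorphM free_scalC.
Qed.

(* u is a product of homogeneous elements of g, even ones counted with weight *)
(* 2 and odd ones with weight 1, of total weight at most n.                   *)
Definition env_prod n (u : env g) : Prop :=
  exists s : seq (bool * g),
    [/\ {in s, forall t, t.2 \in lie_part g t.1},
        (\sum_(t <- s) (if t.1 then 1 else 2) <= n)%N &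
        u = \prod_(t <- s) env_in t.2].

(* The span U_n of these products. *)
Inductive env_span n : env g -> Prop :=
| EnvProd u of env_prod n u : env_span n u
| EnvComb c u v of env_span n u & env_span n v :
    env_span n (env_scal g c * u + v).

Fact env_prod1 n : env_prod n 1.
Proof. by exists [::]; rewrite !big_nil. Qed.

Fact env_prodM m n u v :
  env_prod m u -> env_prod n v -> env_prod (m + n) (u * v).
Proof.
case=> s [hs ls ->] [t [ht lt ->]]; exists (s ++ t).
rewrite !big_cat /= leq_add //; split=> // x.
by rewrite mem_cat => /orP[/hs|/ht].
Qed.

Fact env_fil_0 n : env_span n 0.
Proof.
have h : env_span n 1 by apply/EnvProd/env_prod1.
by have := EnvComb (-1) h h; rewrite rmorphN1 mulN1r addNr.
Qed.
Fact env_fil_B n u v : env_span n u -> env_span n v -> env_span n (u - v).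
Proof. by move=> hu hv; have := EnvComb (-1) hv hu; rewrite rmorphN1 mulN1r addrC. Qed.
Fact env_fil_S n u : env_span n u -> env_span n.+1 u.
Proof.
elim=> {u} [u [s [hs ls ->]]|c u v _ hu _ hv]; last exact: EnvComb.
by apply: EnvProd; exists s; split=> //; apply: leqW.
Qed.
Fact env_fil_1 : env_span 0 1. Proof. exact/EnvProd/env_prod1. Qed.
Fact env_fil_M m n u v :
  env_span m u -> env_span n v -> env_span (m + n) (u * v).
Proof.
elim=> {u} [u hu|c u u' _ hu _ hu'] hv; last first.
  by rewrite mulrDl -mulrA; apply: EnvComb; [apply: hu|apply: hu'].
elim: hv => {v} [v hv|c v v' _ hv _ hv']; first exact/EnvProd/env_prodM.
by rewrite mulrDr mulrA -env_scalC -mulrA; apply: EnvComb.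
Qed.

Definition env_fil : filtration (env g) :=
  Filtration env_fil_0 env_fil_B env_fil_S env_fil_1 env_fil_M.

Definition gr_env : Type := gr env_fil.
HB.instance Definition _ := GRing.NzRing.on gr_env.

Lemma env_fil_in a x : x \in lie_part g a ->
  env_fil (if a then 1 else 2) (env_in x).
Proof.
move=> gx; apply: EnvProd; exists [:: (a, x)]; rewrite !big_seq1; split=> //.
by move=> t; rewrite inE => /eqP ->.
Qed.

Lemma env_fil_even x : x \in lie_part g false -> env_fil 2 (env_in x).
Proof. exact: (@env_fil_in false). Qed.

Lemma env_fil_odd x : x \in lie_part g true -> env_fil 1 (env_in x).
Proof. exact: (@env_fil_in true). Qed.

Lemma env_fil_scal n c : env_fil n (env_scal g c).
Proof.
have := EnvComb c (EnvProd (env_prod1 n)) (env_fil_0 n).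
by rewrite mulr1 addr0.
Qed.

Definition gr_scal_fun (c : K) : gr_env := symb (env_fil_scal 0 c).

Lemma symb_ext n u v (hu : env_fil n u) (hv : env_fil n v) :
  u = v -> symb hu = symb hv.
Proof. by move=> e; apply/symb_eq; rewrite e subrr; apply: fil_pred_0. Qed.

Fact gr_scal_zmod : zmod_morphism gr_scal_fun.
Proof.
move=> c d; rewrite -(symbB _ _ (fil_B (env_fil_scal 0 c) (env_fil_scal 0 d))).
by apply: symb_ext; rewrite rmorphB.
Qed.
Fact gr_scal_monoid : monoid_morphism gr_scal_fun.
Proof.
split=> [|c d].
  by rewrite -(symb1 (fil_1 env_fil)); apply: symb_ext; rewrite rmorph1.
rewrite -(symbM _ _ (fil_M (env_fil_scal 0 c) (env_fil_scal 0 d))).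
by apply: symb_ext; rewrite rmorphM.
Qed.
HB.instance Definition _ :=
  GRing.isZmodMorphism.Build K gr_env gr_scal_fun gr_scal_zmod.
HB.instance Definition _ :=
  GRing.isMonoidMorphism.Build K gr_env gr_scal_fun gr_scal_monoid.

Definition gr_scal : {rmorphism K -> gr_env} := gr_scal_fun.
End EnvelopingFiltration.

Section CommutatorIdentities.
Variable A : pzRingType.
Implicit Types a c u v x y : A.

Fact comm_lin a c u v : c * a = a * c ->
  a * (c * u + v) - (c * u + v) * a = c * (a * u - u * a) + (a * v - v * a).
Proof.
move=> ca; rewrite mulrDr mulrDl mulrBr !mulrA ca opprD !addrA.
by congr (_ - _); rewrite addrAC.
Qed.

Fact comm_prod a y z u : a * y - y * a = z ->
  a * (y * u) - y * u * a = z * u + y * (a * u - u * a).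
Proof. by move=> <-; rewrite mulrBl mulrBr !mulrA addrA subrK. Qed.
End CommutatorIdentities.

Section EnvelopingRelations.
Variables (K : fieldType) (g : lieSuperalgebra K).

Lemma env_proj_rel t : env_rel t -> env_proj g t = 0.
Proof.
move=> ht; rewrite -(raddf0 (env_proj g)); apply/qproj_eq.
by rewrite subr0; apply: ideal2_gen_sub.
Qed.

Lemma env_in_linear c (x y : g) :
  env_in (c *: x + y) = env_scal g c * env_in x + env_in y.
Proof. exact/(rmorph_lin (f := env_proj g))/env_proj_rel/EnvLin. Qed.

Lemma env_in_br a b (x y : g) : x \in lie_part g a -> y \in lie_part g b ->
  env_in x * env_in y - (-1) ^+ (a && b) * (env_in y * env_in x)
  = env_in (lie_br x y).
Proof.
move=> gx gy; apply: (rmorph_br (f := env_proj g)).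
exact/env_proj_rel/EnvBr.
Qed.

Let ad (x : g) (u : env g) : env g := env_in x * u - u * env_in x.

Fact env_span_ad n x u : x \in lie_part g false -> env_span n u ->
  env_span n (ad x u).
Proof.
move=> gx; elim=> {u} [u [s [hs ls ->]]|c u v _ hu _ hv]; last first.
  have -> : ad x (env_scal g c * u + v) = env_scal g c * ad x u + ad x v.
    by apply: comm_lin; rewrite env_scalC.
  exact: EnvComb.
elim: s n hs ls => [|[a y] s IHs] n hs.
  by move=> _; rewrite big_nil /ad mulr1 mul1r subrr; exact: env_fil_0.
rewrite !big_cons /= => ls; set w := (if a then 1 else 2)%N in ls.
have gy : y \in lie_part g a by apply: (hs (a, y)); rewrite inE eqxx.
have hs' : {in s, forall t, t.2 \in lie_part g t.1}.
  by move=> t ts; apply: hs; rewrite inE ts orbT.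
set u' := \prod_(t <- s) _.
have -> : ad x (env_in y * u') = env_in (lie_br x y) * u' + env_in y * ad x u'.
  by apply: comm_prod; rewrite -(env_in_br gx gy) expr0 mul1r.
apply: (@fil_D _ (env_fil g)); apply: fil_le ls _.
  apply: env_fil_M; last by apply: EnvProd; exists s.
  by apply: (@env_fil_in _ _ a); rewrite -[a]addFb; apply: lie_br_part.
apply: env_fil_M; first exact: env_fil_in.
exact: IHs.
Qed.

Definition gr_even x (gx : x \in lie_part g false) : gr_env g :=
  symb (env_fil_even gx).
Definition gr_odd x (gx : x \in lie_part g true) : gr_env g :=
  symb (env_fil_odd gx).

Lemma gr_evenC x (gx : x \in lie_part g false) (a : gr_env g) :
  GRing.comm a (gr_even gx).
Proof.
apply: symb_central => m u hu; rewrite addn2 /=; apply: (@env_fil_S _ _ m).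
rewrite -opprB -sub0r; apply: env_fil_B (env_fil_0 _ _) _.
exact: env_span_ad.
Qed.

Lemma gr_scalC c (a : gr_env g) : GRing.comm a (gr_scal g c).
Proof.
apply: symb_central => m u _; rewrite env_scalC subrr; exact: fil_pred_0.
Qed.
End EnvelopingRelations.

Section SymmetricAlgebra.
Variables (K : fieldType) (g : lieSuperalgebra K).

Local Notation g0 := (lie_part g false).

(* S(g_0), as the polynomial ring on a basis of g_0. *)
Definition sym : comNzRingType := {mpoly K[\dim g0]}.

Definition sym_scal : {rmorphism K -> sym} := @mpolyC (\dim g0) K.

Definition sym_in (x : g) : sym :=
  \sum_(i < \dim g0) (coord (vbasis g0) i x)%:MP * 'X_i.

Definition sym_part n : set sym := [set p | (p : {mpoly K[\dim g0]}) \is n.-homog].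

Fact mem_vbasis0 i : (vbasis g0)`_i \in g0.
Proof.
case: (ltnP i (\dim g0)) => hi; last by rewrite nth_default ?size_tuple ?mem0v.
by apply/vbasis_mem/mem_nth; rewrite size_tuple.
Qed.

Definition gr_sym_fun : sym -> gr_env g :=
  mmap (gr_scal g) (fun i : 'I_(\dim g0) => gr_even (mem_vbasis0 i)).

Fact gr_sym_zmod : zmod_morphism gr_sym_fun.
Proof. exact: mmap_is_additive. Qed.

Fact gr_sym_monoid : monoid_morphism gr_sym_fun.
Proof.
have [h1 hM] : multiplicative gr_sym_fun.
  apply: commr_mmap_is_multiplicative => [i a|p m m']; first exact: gr_evenC.
  exact/commr_sym/gr_scalC.
by [].
Qed.

HB.instance Definition _ :=
  GRing.isZmodMorphism.Build sym (gr_env g) gr_sym_fun gr_sym_zmod.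
HB.instance Definition _ :=
  GRing.isMonoidMorphism.Build sym (gr_env g) gr_sym_fun gr_sym_monoid.

(* The map S(g_0) -> gr U(g) extending g_0 -> U_2 / U_1. *)
Definition gr_sym : {rmorphism sym -> gr_env g} := gr_sym_fun.

Lemma gr_sym_scal c : gr_sym (sym_scal c) = gr_scal g c.
Proof. exact: mmapC. Qed.

Lemma gr_sym_in x (gx : x \in g0) : gr_sym (sym_in x) = gr_even gx.
Proof.
have gX i : gr_sym ('X_i : {mpoly K[\dim g0]}) = gr_even (mem_vbasis0 i).
  by rewrite [LHS]mmapX mmap1U.
have comb c y z (gy : y \in g0) (gz : z \in g0) (gw : c *: y + z \in g0) :
    gr_scal g c * gr_even gy + gr_even gz = gr_even gw.
  rewrite -(symbM _ _ (fil_M (env_fil_scal g 0 c) (env_fil_even gy))).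
  rewrite -(symbD _ _ (fil_D (fil_M (env_fil_scal g 0 c) (env_fil_even gy))
                             (env_fil_even gz))).
  by apply: symb_ext; rewrite env_in_linear.
have ext y z (gy : y \in g0) (gz : z \in g0) : y = z -> gr_even gy = gr_even gz.
  by move=> e; apply: symb_ext; rewrite e.
suff h (s : seq 'I_(\dim g0)) (f : 'I_(\dim g0) -> K)
    (gw : \sum_(i <- s) f i *: (vbasis g0)`_i \in g0) :
    gr_sym (\sum_(i <- s) (f i)%:MP * 'X_i : {mpoly K[\dim g0]}) = gr_even gw.
  have e := coord_vbasis gx; have gw := gx; rewrite {1}e in gw.
  by rewrite (ext _ _ gx gw e) -h.
have zero (g00 : 0 \in g0) : gr_even g00 = 0.
  have := comb (-1) 0 0 g00 g00; rewrite scaler0 addr0 => /(_ g00).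
  by rewrite rmorphN1 mulN1r addNr => <-.
elim: s gw => [|i s IHs] gw.
  by move: gw; rewrite !big_nil => gw; rewrite rmorph0 zero.
move: gw; rewrite !big_cons => gw.
have gs : \sum_(i <- s) f i *: (vbasis g0)`_i \in g0.
  by apply: rpred_sum => j _; apply/rpredZ/mem_vbasis0.
rewrite -(comb _ _ _ (mem_vbasis0 i) gs) -(IHs gs) -gX -gr_sym_scal.
by rewrite rmorphD rmorphM.
Qed.

Lemma gr_oddD_br u v (gu : u \in lie_part g true) (gv : v \in lie_part g true) :
  gr_odd gu * gr_odd gv + gr_odd gv * gr_odd gu = gr_sym (sym_in (lie_br u v)).
Proof.
have guv : lie_br u v \in g0 by apply: (@lie_br_part _ g true true).
have Muv := fil_M (env_fil_odd gu) (env_fil_odd gv).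
have Mvu := fil_M (env_fil_odd gv) (env_fil_odd gu).
rewrite (gr_sym_in guv) -(symbM _ _ Muv) -(symbM _ _ Mvu).
rewrite -(symbD _ _ (fil_D Muv Mvu)); apply: symb_ext.
by rewrite -(env_in_br gu gv) /= expr1 mulN1r opprK.
Qed.
End SymmetricAlgebra.

Section GradedModules.

Definition is_grading (V : zmodType) (D : nat -> set V) : Prop :=
  [/\ forall m, D m 0 /\ (forall x y, D m x -> D m y -> D m (x - y)),
      forall x, exists n, exists2 y : nat -> V,
        forall m, D m (y m) & x = \sum_(m < n) y m &
      forall n (y : nat -> V), (forall m, D m (y m)) ->
        \sum_(m < n) y m = 0 -> forall m, (m < n)%N -> y m = 0].

Definition partial_sum (V : zmodType) (D : nat -> set V) (n : nat) : set V :=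
  [set x | exists2 y : nat -> V, forall m, D m (y m) & x = \sum_(m < n.+1) y m].

Definition fin_gen (A : pzRingType) (M : lmodType A) : Prop :=
  exists s : seq M, forall x, exists c : 'I_(size s) -> A,
    x = \sum_i c i *: s`_i.

Definition simple_module (A : pzRingType) (M : lmodType A) : Prop :=
  (exists x : M, x <> 0) /\
  forall P : set M, P 0 -> (forall a x y, P x -> P y -> P (a *: x + y)) ->
    (forall x, P x -> x = 0) \/ (forall x, P x).

Definition has_dim (K : fieldType) (V : lmodType K) (P : set V) (n : nat) :=
  exists v : 'I_n -> V,
    (forall x, P x <-> exists c : 'I_n -> K, x = \sum_i c i *: v i) /\
    (forall c : 'I_n -> K, \sum_i c i *: v i = 0 -> forall i, c i = 0).

(* de = (d, e) with dim (H n) = a_d 'C(n, d) + ... + a_0 for n >> 0, where     *)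
(* e = a_d != 0.                                                             *)
Definition has_growth (K : fieldType) (V : lmodType K) (H : nat -> set V)
    (de : nat * rat) : Prop :=
  exists a : nat -> rat,
    [/\ a de.1 = de.2, a de.1 != 0 &
        exists n0, forall n, (n0 <= n)%N -> exists2 h, has_dim (H n) h &
          h%:R = \sum_(i < de.1.+1) a i * ('C(n, i))%:R].

(* The pair (d, e), with junk value (0, 0) if there is none. *)
Definition growth (K : fieldType) (V : lmodType K) (H : nat -> set V)
  : nat * rat := xget (0%N, 0) [set de | has_growth H de].

Variables (K : fieldType) (g : lieSuperalgebra K).

Definition is_graded_module (N : lmodType (gr_env g)) (D : nat -> set N) : Prop :=
  is_grading D /\
  forall i m a x, gr_part i a -> D m x -> D (i + m)%N (a *: x).

Definition ann_sym (N : lmodType (gr_env g)) : {pred sym g} :=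
  fun p => `[< forall x : N, gr_sym g p *: x = 0 >].

(* N is torsion free over S(g_0) / ann_sym N. *)
Definition torsion_free (N : lmodType (gr_env g)) : Prop :=
  forall p (x : N), p \notin ann_sym N -> gr_sym g p *: x = 0 -> x = 0.

(* Regrading N by N(2m-1) + N(2m) amounts to using dim N_{2n}. *)
Definition module_growth (N : lmodType (gr_env g)) (D : nat -> set N) :=
  @growth K (restr (gr_scal g) N) (fun n => partial_sum D n.*2).
Definition module_dim (N : lmodType (gr_env g)) (D : nat -> set N) : nat :=
  (module_growth D).1.
Definition module_mult (N : lmodType (gr_env g)) (D : nat -> set N) : rat :=
  (module_growth D).2.
End GradedModules.

Definition prime_ideal (A : comNzRingType) (q : {pred A}) : Prop :=
  idealr_closed q /\ prime_idealr_closed q.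

Definition prime_mem (A : comNzRingType) (q : {pred A}) (hq : prime_ideal q)
  : {pred A} := q.

Section ResidueField.
Variables (A : comNzRingType) (q : {pred A}) (hq : prime_ideal q).

HB.instance Definition _ := isIdealr.Build A (prime_mem hq) hq.1.
HB.instance Definition _ := isPrimeIdealrClosed.Build A (prime_mem hq) hq.2.

Definition resring : Type := {ideal_quot (prime_mem hq : prime_idealr A)}.
HB.instance Definition _ := GRing.ComNzRing.on resring.

Definition resring_proj : {rmorphism A -> resring} :=
  \pi_{ideal_quot (prime_mem hq : prime_idealr A)}.

Definition resring_unit : {pred resring} := fun x => `[< exists y, y * x = 1 >].
Definition resring_inv (x : resring) : resring := xget x [set y | y * x = 1].

Fact resring_mulVr : {in resring_unit, left_inverse 1 resring_inv *%R}.
Proof. by move=> x /asboolP[y hy]; rewrite /resring_inv; case: xgetP => [z _|/(_ y)]. Qed.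
Fact resring_unitP x y : y * x = 1 -> resring_unit x.
Proof. by move=> h; apply/asboolP; exists y. Qed.
Fact resring_invN : {in [predC resring_unit], resring_inv =1 id}.
Proof.
move=> x /negP hx; rewrite /resring_inv; case: xgetP => // y _ hy.
by case: hx; apply: resring_unitP hy.
Qed.

HB.instance Definition _ := GRing.ComNzRing_hasMulInverse.Build resring
  resring_mulVr resring_unitP resring_invN.

Fact resring_domain (x y : resring) : x * y = 0 -> (x == 0) || (y == 0).
Proof. exact: (@Quotient.rquot_IdomainAxiom A (prime_mem hq : prime_idealr A)). Qed.

HB.instance Definition _ :=
  GRing.ComUnitRing_isIntegral.Build resring resring_domain.

Definition resfield : fieldType := {fraction resring}.
Definition resfield_proj : {rmorphism A -> resfield} :=
  (@FracField.tofrac resring) \o resring_proj.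
End ResidueField.

Record submodule (F : pzRingType) (V : lmodType F) := Submodule {
  submodule_pred :> V -> Prop;
  submodule_0 : submodule_pred 0;
  submodule_lin : forall a x y,
    submodule_pred x -> submodule_pred y -> submodule_pred (a *: x + y) }.

Definition submodule_mem (F : pzRingType) (V : lmodType F) (W : submodule V)
  : {pred V} := fun x => `[< W x >].

Section ModuleQuotient.
Variables (F : pzRingType) (V : lmodType F) (W : submodule V).

Fact submodule_zmod_closed : zmod_closed (submodule_mem W).
Proof.
split=> [|x y]; first exact/asboolP/submodule_0.
move=> /asboolP Wx /asboolP Wy; apply/asboolP.
by rewrite addrC -scaleN1r; apply: submodule_lin.
Qed.

HB.instance Definition _ :=
  GRing.isZmodClosed.Build V (submodule_mem W) submodule_zmod_closed.

Local Notation J := (submodule_mem W : zmodClosed V).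

Definition mquot : Type := {ideal_quot J}.
HB.instance Definition _ := GRing.Zmodule.on mquot.

Definition mquot_proj (x : V) : mquot := \pi_{ideal_quot J} x.
Definition mquot_repr (x : mquot) : V := repr (x : {ideal_quot J}).

Lemma mquot_reprK x : mquot_proj (mquot_repr x) = x.
Proof. exact: reprK. Qed.

Lemma mquot_eq x y : mquot_proj x = mquot_proj y <-> W (x - y).
Proof.
split=> [/eqP|h]; first by rewrite piE Quotient.equivE => /asboolP.
by apply/eqP; rewrite piE Quotient.equivE; apply/asboolP.
Qed.

Fact mquot_proj_zmod : zmod_morphism mquot_proj.
Proof. by move=> x y; rewrite /mquot_proj raddfB. Qed.

HB.instance Definition _ :=
  GRing.isZmodMorphism.Build V mquot mquot_proj mquot_proj_zmod.

Definition mquot_scale a (x : mquot) : mquot := mquot_proj (a *: mquot_repr x).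

Lemma mquot_projZ a x : mquot_scale a (mquot_proj x) = mquot_proj (a *: x).
Proof.
apply/mquot_eq; rewrite -scalerBr -[_ *: _]addr0.
apply: submodule_lin (submodule_0 W).
by apply/mquot_eq; rewrite mquot_reprK.
Qed.

Fact mquot_scaleA a b x : mquot_scale a (mquot_scale b x) = mquot_scale (a * b) x.
Proof. by rewrite -(mquot_reprK x) !mquot_projZ scalerA. Qed.
Fact mquot_scale1 : left_id 1 mquot_scale.
Proof. by move=> x; rewrite -(mquot_reprK x) !mquot_projZ scale1r. Qed.
Fact mquot_scaleDr : right_distributive mquot_scale +%R.
Proof.
move=> a x y; rewrite -(mquot_reprK x) -(mquot_reprK y).
by rewrite -raddfD !mquot_projZ scalerDr raddfD.
Qed.
Fact mquot_scaleDl x : {morph mquot_scale^~ x : a b / a + b >-> a + b}.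
Proof.
by move=> a b /=; rewrite -(mquot_reprK x) !mquot_projZ scalerDl raddfD.
Qed.

HB.instance Definition _ := GRing.Zmodule_isLmodule.Build F mquot
  mquot_scaleA mquot_scale1 mquot_scaleDr mquot_scaleDl.
End ModuleQuotient.

(* The Clifford algebra of a bilinear form, with u v + v u = B(u, v). *)
Section Clifford.
Variables (F : fieldType) (V : lmodType F) (B : V -> V -> F).

Local Notation gen := (@free_gen F V).

Variant clifford_rel : free_alg F V -> Prop :=
| CliffordLin c x y :
    clifford_rel (gen (c *: x + y) - (free_scal F V c * gen x + gen y))
| CliffordSq x y :
    clifford_rel (gen x * gen y + gen y * gen x - free_scal F V (B x y)).

Definition clifford : Type := quot2 (ideal2_gen clifford_rel).
HB.instance Definition _ := GRing.PzRing.on clifford.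

Definition clifford_proj : {rmorphism free_alg F V -> clifford} :=
  @qproj _ (ideal2_gen clifford_rel).
Definition clifford_in (x : V) : clifford := clifford_proj (gen x).
Definition clifford_scal : {rmorphism F -> clifford} :=
  clifford_proj \o @free_scal F V.
End Clifford.

Section CliffordAtPrime.
Variables (K : fieldType) (g : lieSuperalgebra K).
Variables (q : {pred sym g}) (hq : prime_ideal q).

Local Notation g1 := (lie_part g true).
Local Notation F := (resfield hq).

(* The bracket on g_1 reduced mod q, in coordinates: g_1 (x) F_q is the space  *)
(* of row vectors in the basis vbasis g_1.                                    *)
Definition gram : 'M[F]_(\dim g1) :=
  \matrix_(i, j) resfield_proj hq
    (sym_in (lie_br (vbasis g1)`_i (vbasis g1)`_j)).

Definition gram_form (x y : 'rV[F]_(\dim g1)) : F := (x *m gram *m y^T) 0 0.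

Definition form_rank : nat := \rank gram.

Fact gram_rad_0 y : gram_form 0 y = 0.
Proof. by rewrite /gram_form !mul0mx mxE. Qed.
Fact gram_rad_lin a x x' :
  (forall y, gram_form x y = 0) -> (forall y, gram_form x' y = 0) ->
  forall y, gram_form (a *: x + x') y = 0.
Proof.
move=> hx hx' y; move: (hx y) (hx' y); rewrite /gram_form.
move=> h h'; rewrite !mulmxDl -!scalemxAl mxE h' addr0.
by rewrite [LHS]mxE h mulr0.
Qed.

Definition gram_rad : submodule 'rV[F]_(\dim g1) :=
  Submodule gram_rad_0 gram_rad_lin.

(* The induced form on (g_1 (x) F_q) / rad; it does not depend on the choice  *)
(* of representatives.                                                       *)
Definition induced_form (x y : mquot gram_rad) : F :=
  gram_form (mquot_repr x) (mquot_repr y).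

Definition clifford_at : Type := clifford induced_form.
HB.instance Definition _ := GRing.PzRing.on clifford_at.

Definition ell : nat := ((form_rank + 1) %/ 2)%N.

Definition clifford_split : Prop :=
  exists L : lmodType clifford_at,
    simple_module L /\
    @has_dim F (restr (clifford_scal induced_form) L) setT
      (2 ^ ell)%N.

Definition quot_part (m : nat) : set (resring hq) := resring_proj hq @` sym_part m.

(* S(g_0) / q, graded by the images of the homogeneous polynomials. *)
Definition quot_growth :=
  @growth K (restr (resring_proj hq \o sym_scal g) (resring hq)^o)
    (partial_sum quot_part).
Definition quot_dim : nat := quot_growth.1.
Definition quot_mult : rat := quot_growth.2.
End CliffordAtPrime.

(* Main.v *)
(* Write A = S(g_0), F = Frac(A / q), and let s_1, ..., s_t be homogeneous      *)
(* A-generators of N. Filtering N by the spans of tails of this list, the      *)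
(* graded pieces are cyclic, A / I_i with I_i homogeneous and containing q. A   *)
(* Hilbert function counts the monomials outside a set of leading monomials,   *)
(* hence is eventually polynomial, and it drops in degree as soon as I_i is    *)
(* larger than q. So d(N) = d(A / q) and e(N) = r e(A / q), where r, the       *)
(* number of i with I_i = q, is the rank of N over A / q.                      *)
(*   The odd generators act on N (x) F = F ^ r by matrices E_i satisfying       *)
(* E_i E_j + E_j E_i = B(u_i, u_j). Choose a nonsingular principal minor of B   *)
(* of maximal size k and an orthogonal basis for it. The products of basis     *)
(* vectors are eigenvectors, with distinct characters, for the conjugations by *)
(* the basis vectors; this gives 2 ^ k <= r ^ 2. If k is odd, the product z of *)
(* all of them is central and z ^ 2 is, up to squares and scalars, the minor,  *)
(* which is homogeneous of odd degree k and hence not a square in F; working   *)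
(* over F(z) one gains a factor 2. Thus r >= 2 ^ ell for every such system,    *)
(* which also applies to stable subspaces of F ^ r. If r = 2 ^ ell, then F ^ r *)
(* is irreducible, the radical acts by zero (the kernel of a radical vector is *)
(* stable and nonzero), and F ^ r is a simple C_q-module.                      *)

From HB Require Import structures.
Require Import Defs.
From mathcomp Require Import all_boot all_order all_algebra.
From mathcomp Require Import -(notations) monalg.
From mathcomp Require Import ring_quotient fraction perm zify ring lra.
From mathcomp Require Import boolp classical_sets reals complex mpoly.

Set Implicit Arguments.
Unset Strict Implicit.
Unset Printing Implicit Defensive.

Import Order.TTheory GRing.Theory Num.Theory.
Local Open Scope ring_scope.

(** Everything is governed by one number, the rank r of N over the domain A / q, where A = S(g_0). A
    finitely generated graded module has a filtration with cyclic quotients A / I, each I a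
    homogeneous ideal containing q. The quotients with I = q contribute the full growth of A / q; a
    larger I contributes nothing in top degree ([hilb_larger_growth]). Hence d(N) = d(A / q) and
    e(N) = r e(A / q) ([span_hilb_growth]). As e(A / q) > 0, what remains is r >= 2 ^ ell, and the
    splitting of C_q when r = 2 ^ ell.

    These are statements about matrices over F = Frac(A / q). Torsion freeness embeds N into F ^ r
    ([free_part_coord]), and the odd elements, which commute with the central A, act there by
    matrices satisfying the Clifford relations of the reduced bracket ([odd_matrices]). Let k be the
    rank of the form. For even k the 2 ^ k ordered products of an orthogonal basis of a
    nondegenerate part are independent, so 2 ^ k <= r ^ 2. For odd k the product z of the whole
    basis is central, and its square is up to signs, powers of 2 and squares a minor of the bracket,
    represented by a form of odd degree k. Since q is homogeneous, this is not a square in F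
    ([odd_degree_nonsquare]), so F ^ r is a vector space over the field F(z), which improves the
    bound to 2 ^ (k + 1) <= r ^ 2. Both cases say r >= 2 ^ ell ([clifford_dim_bound]).

    The same bound holds for every nonzero stable subspace ([gram_stable_rank]), so r = 2 ^ ell
    makes F ^ r irreducible. A radical vector then acts by zero ([row_lift_radical]), and F ^ r
    becomes a simple C_q-module of dimension 2 ^ ell ([clifford_simple_module]). *)

(** * Functions whose iterated differences are eventually constant *)

Definition eveq (f g : nat -> rat) : Prop :=
  exists n0, forall n, (n0 <= n)%N -> f n = g n.

Lemma eveq_trans g f h : eveq f g -> eveq g h -> eveq f h.
Proof.
move=> [a fg] [b gh]; exists (maxn a b) => n.
by rewrite geq_max => /andP[an bn]; rewrite fg // gh.
Qed.

Lemma eveq_sym f g : eveq f g -> eveq g f.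
Proof. by move=> [a fg]; exists a => n /fg. Qed.

Definition fdiff (f : nat -> rat) (n : nat) : rat := f n.+1 - f n.

Lemma eveq_fdiff f g : eveq f g -> eveq (fdiff f) (fdiff g).
Proof. by move=> [a fg]; exists a => n an; rewrite /fdiff !fg // leqW. Qed.

Lemma eveq_iter_fdiff d f g :
  eveq f g -> eveq (iter d fdiff f) (iter d fdiff g).
Proof. by move=> fg; elim: d => //= d; exact: eveq_fdiff. Qed.

(* Equivalently, f agrees for large n with a polynomial in n of degree at      *)
(* most d whose coefficient of n ^ d is e / d`!.                              *)
Definition poly_growth (d : nat) (e : rat) (f : nat -> rat) : Prop :=
  eveq (iter d fdiff f) (fun=> e).

Section PolyGrowth.
Implicit Types (f g : nat -> rat) (d c : nat) (e : rat).

Lemma poly_growth_ext d e f g :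
  eveq f g -> poly_growth d e f -> poly_growth d e g.
Proof.
by move=> /eveq_sym fg; apply: eveq_trans; exact: eveq_iter_fdiff.
Qed.

Lemma poly_growthSr d e f : poly_growth d e (fdiff f) <-> poly_growth d.+1 e f.
Proof. by rewrite /poly_growth iterSr. Qed.

Lemma poly_growthD d e1 e2 f g : poly_growth d e1 f -> poly_growth d e2 g ->
  poly_growth d (e1 + e2) (fun n => f n + g n).
Proof.
elim: d f g => [|d IHd] f g; last first.
  rewrite -!poly_growthSr => hf hg; apply: poly_growth_ext (IHd _ _ hf hg).
  by exists 0 => n _; rewrite /fdiff; ring.
move=> [a hf] [b hg]; exists (maxn a b) => n.
by rewrite geq_max => /andP[an bn] /=; rewrite [f n]hf // [g n]hg.
Qed.

Lemma poly_growthZ d e a f :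
  poly_growth d e f -> poly_growth d (a * e) (fun n => a * f n).
Proof.
elim: d f => [|d IHd] f; last first.
  rewrite -!poly_growthSr => hf; apply: poly_growth_ext (IHd _ hf).
  by exists 0 => n _; rewrite /fdiff; ring.
by move=> [b hf]; exists b => n /hf /= ->.
Qed.

Lemma poly_growthB d e1 e2 f g : poly_growth d e1 f -> poly_growth d e2 g ->
  poly_growth d (e1 - e2) (fun n => f n - g n).
Proof.
move=> hf /(poly_growthZ (-1)) hg; rewrite -mulN1r.
apply: poly_growth_ext (poly_growthD hf hg).
by exists 0 => n _; rewrite mulN1r.
Qed.

Lemma poly_growth0 d : poly_growth d 0 (fun=> 0).
Proof.
elim: d => [|d IHd]; first by exists 0.
apply/poly_growthSr; apply: poly_growth_ext IHd.
by exists 0 => n _; rewrite /fdiff subrr.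
Qed.

Lemma poly_growthS d e f : poly_growth d e f -> poly_growth d.+1 0 f.
Proof.
by move=> [a hf]; exists a => n an /=; rewrite /fdiff !hf ?subrr // leqW.
Qed.

Lemma poly_growth_le d d' f :
  (d <= d')%N -> poly_growth d 0 f -> poly_growth d' 0 f.
Proof.
move=> /subnK <- hf; elim: (d' - d)%N => // k IHk.
by rewrite addSn; exact: poly_growthS IHk.
Qed.

Lemma poly_growth_shift c d e f :
  poly_growth d e f -> poly_growth d e (fun n => f (n - c)%N).
Proof.
elim: d f => [|d IHd] f.
  by move=> [a hf]; exists (a + c)%N => n h /=; rewrite [LHS]hf // leq_subRL; lia.
rewrite -!poly_growthSr => hf; apply: poly_growth_ext (IHd _ hf).
by exists c => n cn; rewrite /fdiff subSn.
Qed.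

Lemma poly_growth_sum d e f :
  poly_growth d e f -> poly_growth d.+1 e (fun n => \sum_(i < n.+1) f i).
Proof.
move=> hf; apply/poly_growthSr.
have hS : poly_growth d e (fun n => f n.+1).
  elim: d f hf => [|d IHd] f.
    by move=> [a hf]; exists a => n an /=; rewrite [LHS]hf // leqW.
  by rewrite -!poly_growthSr => /IHd.
apply: poly_growth_ext hS; exists 0 => n _.
by rewrite /fdiff [X in X - _]big_ord_recr /= addrAC subrr add0r.
Qed.

Lemma poly_growth_eq d e e' f : poly_growth d e f -> poly_growth d e' f -> e = e'.
Proof.
move=> [a ha] [b hb].
by rewrite -(ha (maxn a b)) ?leq_maxl // hb ?leq_maxr.
Qed.

(** If [d < d'], then the [d']-th difference of [f] is eventually zero, against [e' != 0]. *)
Lemma poly_growth_uniq d e d' e' f : e != 0 -> e' != 0 ->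
  poly_growth d e f -> poly_growth d' e' f -> (d, e) = (d', e').
Proof.
wlog dd' : d e d' e' / (d <= d')%N => [th|] e0 e'0 h h'.
  by case: (leqP d d') => [|/ltnW] dd'; [|apply/esym]; apply: th.
move: dd'; rewrite leq_eqVlt => /orP[/eqP dd'|dd'].
  by rewrite -dd' in h' *; rewrite (poly_growth_eq h h').
have := poly_growth_le dd' (poly_growthS h).
by move=> /(poly_growth_eq h') h0; rewrite h0 eqxx in e'0.
Qed.

(** The last iterated difference that is not eventually zero is eventually constant; its order is
    the exact degree. *)
Lemma poly_growth_lead D f : poly_growth D 0 f ->
  eveq f (fun=> 0) \/
  exists d e, [/\ (d < D)%N, e != 0 & poly_growth d e f].
Proof.
elim: D => [|D IHD]; first by left.
move=> [a hf]; set e := iter D fdiff f a.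
have he : poly_growth D e f.
  exists a => n /subnK <-; elim: (n - a)%N => // k IHk.
  have := hf (k + a)%N (leq_addl _ _); rewrite /= /fdiff IHk addSn => /eqP.
  by rewrite subr_eq0 => /eqP.
case: (eqVneq e 0) => [e0|e0]; last by right; exists D, e.
rewrite e0 in he; case: (IHD he) => [|[d [e' [dD e'0 hd]]]]; first by left.
by right; exists d, e'; rewrite leqW.
Qed.

Let unbounded_below f := forall M, exists n0, forall n, (n0 <= n)%N -> f n <= M.

Lemma unbounded_below_fdiff a n0 f : a < 0 ->
  (forall n, (n0 <= n)%N -> fdiff f n <= a) -> unbounded_below f.
Proof.
move=> a0 hf M.
have hn k : f (k + n0)%N <= f n0 + k%:R * a.
  elim: k => [|k IHk]; first by rewrite mul0r addr0.
  have := hf (k + n0)%N (leq_addl _ _); rewrite /fdiff addSn -natr1 mulrDl mul1r.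
  move: IHk; lra.
have [k hk] : exists k : nat, (f n0 - M) / - a <= k%:R.
  exists (Num.bound `|(f n0 - M) / - a|); apply/ltW.
  exact: le_lt_trans (ler_norm _) (archi_boundP (normr_ge0 _)).
exists (k + n0)%N => n kn; have -> : n = (n - n0 + n0)%N by lia.
apply: le_trans (hn _) _.
have : k%:R <= (n - n0)%:R :> rat by rewrite ler_nat; lia.
move: hk; rewrite ler_pdivrMr ?oppr_gt0 //.
move=> h1 h2; have : (n - n0)%:R * a <= k%:R * a by apply: ler_wnM2r; first exact: ltW.
lra.
Qed.

(** Were [e] negative, repeated summation of the differences would drive [f] below every bound. *)
Lemma poly_growth_ge0 d e f :
  poly_growth d e f -> (forall n, 0 <= f n) -> 0 <= e.
Proof.
move=> h f0; rewrite leNgt; apply/negP => e0; case: d h => [[a ha]|d h].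
  by have := f0 a; rewrite -[f a]/(iter 0 fdiff f a) ha // leNgt e0.
suff /(_ (-1))[n0 /(_ n0 (leqnn _))] : unbounded_below f by have := f0 n0; lra.
elim: d f h {f0} => [|d IHd] f.
  by move=> [a ha]; apply: (@unbounded_below_fdiff e a) => // n /ha /= ->.
move=> /poly_growthSr/IHd/(_ (-1))[a ha].
exact: (@unbounded_below_fdiff (-1) a).
Qed.

(** The difference of 'C(n, i + 1) is 'C(n, i), so taking differences shifts the coefficients in the
    binomial basis. This links iterated differences with [has_growth]. *)
Lemma poly_growth_binP d e f :
  poly_growth d e f <-> exists2 a : nat -> rat, a d = e &
    eveq f (fun n => \sum_(i < d.+1) a i * 'C(n, i)%:R).
Proof.
have fdiff_bin (a : nat -> rat) k n :
    fdiff (fun n => \sum_(i < k.+1) a i * 'C(n, i)%:R) n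
    = \sum_(i < k) a i.+1 * 'C(n, i)%:R.
  rewrite /fdiff !big_ord_recl !bin0 opprD addrACA subrr add0r -sumrB.
  apply: eq_bigr => i _; rewrite /= binS natrD; ring.
split; elim: d f => [|d IHd] f.
- move=> [n0 hf]; exists (fun=> e) => //; exists n0 => n /hf /= ->.
  by rewrite big_ord1 bin0 mulr1.
- move=> /poly_growthSr/IHd[a ad [n0 ha]].
  set s := fun n => \sum_(i < d.+1) a i * 'C(n, i.+1)%:R.
  (* The constant term of the antiderivative is fixed by the value of [f] at [n0]. *)
  set b := fun i => if i is j.+1 then a j else f n0 - s n0.
  have bE m : \sum_(i < d.+2) b i * 'C(m, i)%:R = b 0%N + s m.
    by rewrite big_ord_recl bin0 mulr1.
  exists b => //; exists n0 => n /subnK <-; rewrite bE.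
  elim: (n - n0)%N => [|k IHk]; first by rewrite subrK.
  have := ha (k + n0)%N (leq_addl _ _).
  rewrite -(fdiff_bin b d.+1) /fdiff !bE IHk addSn => /(canRL (subrK _)) ->.
  by rewrite /=; ring.
- move=> [a <- [n0 hf]]; exists n0 => n /hf /= ->.
  by rewrite big_ord1 bin0 mulr1.
- move=> [a ad hf]; apply/poly_growthSr/IHd.
  exists (fun i => a i.+1) => //; apply: eveq_trans (eveq_fdiff hf) _.
  by exists 0 => n _; rewrite fdiff_bin.
Qed.

Lemma poly_growth_sumr (I : Type) (s : seq I) d (e : I -> rat)
    (f : I -> nat -> rat) :
  (forall i, poly_growth d (e i) (f i)) ->
  poly_growth d (\sum_(i <- s) e i) (fun n => \sum_(i <- s) f i n).
Proof.
move=> h; elim: s => [|i s IHs].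
  rewrite big_nil; apply: poly_growth_ext (poly_growth0 d).
  by exists 0 => n _; rewrite big_nil.
rewrite big_cons; apply: poly_growth_ext (poly_growthD (h i) IHs).
by exists 0 => n _; rewrite big_cons.
Qed.

(* Both f and g - f are nonnegative, so the degree of f is at most that of g. *)
Lemma poly_growth_dominated d D f g : poly_growth d 0 g -> poly_growth D 0 f ->
  (forall n, 0 <= f n) -> (exists n0, forall n, (n0 <= n)%N -> f n <= g n) ->
  poly_growth d 0 f.
Proof.
move=> hg /poly_growth_lead[[a hf] f0 fg|[k [e [_ e0 hf]]] f0 [n0 fg]].
  by apply: poly_growth_le (leq0n _) _; exists a.
case: (leqP d k) => [dk|kd]; last exact: poly_growth_le kd (poly_growthS hf).
have e_ge0 := poly_growth_ge0 hf f0.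
have hB := poly_growthB (poly_growth_le dk hg) hf.
have : 0 <= 0 - e.
  apply: poly_growth_ge0 (_ : poly_growth k _ (fun n => `|g n - f n|)) _ => //.
  apply: poly_growth_ext hB; exists n0 => n /fg h.
  by rewrite ger0_norm ?subr_ge0.
by rewrite sub0r oppr_ge0 => h; move: e0; rewrite eq_le h e_ge0.
Qed.
End PolyGrowth.

(** * Up-closed sets of exponent vectors and the count of their complements *)

(** Up-closedness of a set of exponent vectors of length [k], phrased one coordinate at a time so
    that induction on [k] applies to each slice. *)
Fixpoint upset (k : nat) (U : seq nat -> Prop) : Prop :=
  if k is k'.+1 then
    (forall j l, size l = k' -> U (j :: l) -> U (j.+1 :: l)) /\
    forall j, upset k' (fun l => U (j :: l))
  else True.

Lemma upset_le k (U : seq nat -> Prop) :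
  (forall l l', size l = k -> size l' = k ->
     (forall i, nth 0%N l i <= nth 0%N l' i)%N -> U l -> U l') -> upset k U.
Proof.
elim: k U => [|k IHk] //= U h; split=> [j l sl|j].
  by apply: h; rewrite /= ?sl // => -[|i] /=.
apply: IHk => l l' sl sl' ll'; apply: h; rewrite /= ?sl ?sl' //.
by case=> [|i] /=.
Qed.

(* Along an ascending chain indexed by t, the diagonal slices U t (t :: _)     *)
(* stabilize, which bounds all but finitely many slices U t (j :: _).         *)
Lemma upset_chain k (U : nat -> seq nat -> Prop) :
  (forall t, upset k (U t)) ->
  (forall t l, size l = k -> U t l -> U t.+1 l) ->
  exists T, forall t l, (T <= t)%N -> size l = k -> U t l -> U T l.
Proof.
elim: k U => [|k IHk] U upU chU.
  case: (pselect (exists t, U t [::])) => [[T UT]|nU].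
    by exists T => t l _ /size0nil ->.
  by exists 0%N => t l _ /size0nil -> Ut; case: nU; exists t.
have chU' s t l : (s <= t)%N -> size l = k.+1 -> U s l -> U t l.
  move=> /subnK <- sl Us; elim: (t - s)%N => // d; rewrite addSn; exact: chU.
have slU i j t l : (i <= j)%N -> size l = k -> U t (i :: l) -> U t (j :: l).
  move=> /subnK <- sl Us; elim: (j - i)%N => // d; rewrite addSn.
  exact: (upU t).1.
have [||T hT] := IHk (fun t l => U t (t :: l)).
- by move=> t; apply: (upU t).2.
- by move=> t l sl Ut; apply: chU; rewrite /= ?sl //; apply: slU Ut.
have hj j : exists T', forall t l, (T' <= t)%N -> size l = k ->
    U t (j :: l) -> U T' (j :: l).
  apply: IHk => [t|t l sl]; first exact: (upU t).2.
  by apply: chU; rewrite /= sl.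
have [f hf] := choice hj.
exists (maxn T (\max_(j < T) f j)) => t [//|j l] ht [sl] Ut.
have [jT|Tj] := ltnP j T.
  have fj : (f j <= maxn T (\max_(j < T) f j))%N.
    by rewrite leq_max (leq_bigmax (Ordinal jT)) orbT.
  apply: (chU' _ _ _ fj); first by rewrite /= sl.
  exact: hf (leq_trans fj ht) sl Ut.
(* For [j >= T], raising both the index and the first exponent to [maxn t j] lands on the diagonal,
   which is stable from [T] on. *)
apply: (chU' T); rewrite /= ?sl ?leq_maxl //.
apply: (slU T) => //; apply: (hT (maxn t j)) => //.
  by rewrite leq_max Tj orbT.
apply: (slU j) => //; first by rewrite leq_maxr.
by apply: (chU' t); rewrite /= ?sl ?leq_maxl.
Qed.

Fixpoint exps (k n : nat) : seq (seq nat) :=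
  if k is k'.+1 then
    [seq j :: l | j <- iota 0 n.+1, l <- exps k' (n - j)]
  else [:: [::]].

Lemma mem_exps k n l : (l \in exps k n) = (size l == k) && (sumn l <= n)%N.
Proof.
elim: k n l => [|k IHk] n l; first by case: l.
apply/allpairsPdep/idP => [[j [l' [hj hl' ->]]]|].
  by move: hl' hj; rewrite IHk mem_iota /= => /andP[/eqP -> ?] ?; rewrite eqxx /=; lia.
case: l => [//|j l] /andP[sl h]; rewrite [sumn _]/= in h.
exists j, l; split=> //; first by rewrite mem_iota; lia.
by rewrite IHk; apply/andP; split; [|lia].
Qed.

Lemma uniq_exps k n : uniq (exps k n).
Proof.
elim: k n => [|k IHk] n //.
by apply: allpairs_uniq_dep => // [|[? ?] [? ?] _ _ /= [-> ->]]; rewrite ?iota_uniq.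
Qed.

Definition coheight (k : nat) (U : seq nat -> Prop) (n : nat) : nat :=
  count (fun l => `[< ~ U l >]) (exps k n).

Lemma coheightS k U n :
  coheight k.+1 U n = (\sum_(j < n.+1) coheight k (fun l => U (val j :: l)) (n - j))%N.
Proof.
rewrite /coheight -[exps k.+1 n]/(flatten _) count_flatten -map_comp sumnE big_map.
rewrite -[iota _ _]/(index_iota 0 n.+1) big_mkord.
by apply: eq_bigr => j _; rewrite /= count_map.
Qed.

Lemma coheight_ext k U V n :
  (forall l, size l = k -> U l <-> V l) -> coheight k U n = coheight k V n.
Proof.
move=> UV; apply: eq_in_count => l; rewrite mem_exps => /andP[/eqP sl _].
by apply: asbool_equiv_eq; rewrite UV.
Qed.

(** Slice by the first exponent. By [upset_chain] the slices are constant from some [T] on, so the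
    count is a finite sum of shifted functions of polynomial growth plus the summation of one such
    function. *)
Lemma coheight_poly k U : upset k U ->
  exists D, poly_growth D 0 (fun n => (coheight k U n)%:R).
Proof.
elim: k U => [|k IHk] U upU.
  by exists 1%N; exists 0%N => n _; rewrite /= /fdiff /coheight subrr.
pose s j l := U (j :: l).
have [|T hT] := @upset_chain k s upU.2; first by move=> t l; exact: upU.1.
have sT j n : (T <= j)%N -> coheight k (s j) n = coheight k (s T) n.
  move=> Tj; apply: coheight_ext => l sl; split; first exact: hT.
  move: Tj => /subnK <-; elim: (j - T)%N => // d IHd /IHd.
  by rewrite addSn; exact: upU.1.
have [f hf] := choice (fun j => IHk _ (upU.2 j)).
pose D := (\max_(j < T.+1) f j)%N.
have hD j : (j <= T)%N -> poly_growth D 0 (fun n => (coheight k (s j) (n - j))%:R).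
  rewrite -ltnS => jT; apply: (@poly_growth_shift j D 0 (fun n => (coheight k (s j) n)%:R)).
  exact: poly_growth_le (leq_bigmax (Ordinal jT)) (hf j).
have h1 : poly_growth D 0
    (fun n => \sum_(j < T) (coheight k (s j) (n - j))%:R).
  have {}hD (j : 'I_T) := hD j (ltnW (ltn_ord j)).
  by have := poly_growth_sumr (index_enum _) hD; rewrite big1.
have h2 : poly_growth D.+1 0
    (fun n => \sum_(i < (n - T).+1) (coheight k (s T) i)%:R).
  apply: (@poly_growth_shift T D.+1 0 (fun n => \sum_(i < n.+1) (coheight k (s T) i)%:R)).
  apply: (@poly_growth_sum D 0 (fun i => (coheight k (s T) i)%:R)).
  exact: poly_growth_le (leq_bigmax (ord_max : 'I_T.+1)) (hf T).
exists D.+1; have := poly_growthD (poly_growthS h1) h2; rewrite addr0.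
apply: poly_growth_ext; exists T => n Tn; rewrite coheightS natr_sum.
have -> : n.+1 = (T + (n - T).+1)%N by lia.
rewrite big_split_ord /=; congr (_ + _).
(* Reversing the index turns the remaining degree [n - (T + i)] into the summation variable. *)
rewrite [LHS](reindex_inj rev_ord_inj); apply: eq_bigr => i _ /=.
rewrite -/(s (T + i)%N) sT ?leq_addr //; congr (coheight _ _ _)%:R.
by have := ltn_ord i; lia.
Qed.

(** * Homogeneous components in a graded group *)

Section GradingComponents.
Variables (V : zmodType) (D : nat -> set V).
Hypothesis D_grading : is_grading D.

Lemma grading0 m : D m 0. Proof. by case: D_grading => /(_ m)[]. Qed.

Lemma gradingB m x y : D m x -> D m y -> D m (x - y).
Proof. by case: D_grading => /(_ m)[_ h] _ _; exact: h. Qed.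

Lemma gradingN m x : D m x -> D m (- x).
Proof. by rewrite -sub0r; apply/gradingB/grading0. Qed.

Lemma gradingD m x y : D m x -> D m y -> D m (x + y).
Proof. by move=> Dx Dy; rewrite -[y]opprK; apply/gradingB/gradingN. Qed.

Lemma grading_sum m (I : Type) (s : seq I) (P : pred I) (f : I -> V) :
  (forall i, P i -> D m (f i)) -> D m (\sum_(i <- s | P i) f i).
Proof.
by move=> h; elim/big_ind: _ => //; [exact: grading0|exact: gradingD].
Qed.

(** A decomposition is chosen for each element and padded with zeros. Uniqueness of decompositions
    makes the choice canonical, hence additive in the element. *)
Lemma grading_comp : exists c : nat -> V -> V,
  [/\ forall m x, D m (c m x),
      forall m, {morph c m : x y / x - y},
      forall m x, D m x -> c m x = x,
      forall m m' x, D m x -> m != m' -> c m' x = 0 &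
      forall x, exists n0, forall n, (n0 <= n)%N -> x = \sum_(m < n) c m x].
Proof.
have [_ D_ex D_uniq] := D_grading.
have /choice[y hy] : forall x, exists y : nat -> V, (forall m, D m (y m)) /\
    exists n0, forall n, (n0 <= n)%N -> x = \sum_(m < n) y m.
  move=> x; have [n [y Dy xE]] := D_ex x.
  exists (fun m => if (m < n)%N then y m else 0); split=> [m|].
    by case: ifP => _ //; exact: grading0.
  exists n => N nN; rewrite xE (big_ord_widen_cond _ xpredT y nN) big_mkcond /=.
  by [].
have uniq (z z' : nat -> V) (x : V) n0 : (forall m, D m (z m)) ->
    (forall m, D m (z' m)) ->
    (forall n, (n0 <= n)%N -> x = \sum_(m < n) z m) ->
    (forall n, (n0 <= n)%N -> x = \sum_(m < n) z' m) -> z =1 z'.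
  move=> Dz Dz' hz hz' m; apply/eqP; rewrite -subr_eq0; apply/eqP.
  pose N := (n0 + m.+1)%N.
  apply: (D_uniq N (fun m => z m - z' m)); last by rewrite /N; lia.
    by move=> i; apply: gradingB.
  by rewrite sumrB -hz ?leq_addr // -hz' ?leq_addr // subrr.
have uniq' (z : nat -> V) x : (forall m, D m (z m)) ->
    (exists n0, forall n, (n0 <= n)%N -> x = \sum_(m < n) z m) -> y x =1 z.
  move=> Dz [a hz]; have [Dy [b hyb]] := hy x.
  apply: (uniq _ _ x (maxn a b)) => // n; rewrite geq_max => /andP[? ?].
    exact: hyb.
  exact: hz.
have hhom m x : D m x -> y x =1 (fun m' => if m' == m then x else 0).
  move=> Dx; apply: uniq' => [m'|].
    by case: eqP => [->|_] //; exact: grading0.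
  exists m.+1 => n mn; rewrite -big_mkcond /=.
  by rewrite (big_pred1 (Ordinal mn)).
exists (fun m x => y x m); split=> [m x|m x x'|m x Dx|m m' x Dx mm'|x].
- exact: (hy x).1.
- apply: (uniq' (fun m => y x m - y x' m)).
    by move=> i; apply: gradingB; [exact: (hy x).1|exact: (hy x').1].
  have [_ [a ha]] := hy x; have [_ [b hb]] := hy x'.
  exists (maxn a b) => n; rewrite geq_max => /andP[? ?].
  by rewrite sumrB -ha // -hb.
- by rewrite (hhom m) // eqxx.
- by rewrite (hhom m) // eq_sym (negPf mm').
- exact: (hy x).2.
Qed.
End GradingComponents.

(** * Dimensions of subsets, additivity, and the link with [growth] *)

Section HasDim.
Variable K : fieldType.

(** Two bases of [P] express each other through matrices whose product is the identity, which bounds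
    one size by the other. *)
Lemma has_dim_le (V : lmodType K) (P : set V) m n :
  has_dim P m -> has_dim P n -> (m <= n)%N.
Proof.
move=> [v [vP vfree]] [w [wP wfree]].
have Pv i : P (v i).
  apply/vP; exists (fun j => (i == j)%:R).
  rewrite (bigD1 i) //= eqxx scale1r big1 ?addr0 // => j /negPf.
  by rewrite eq_sym => ->; rewrite scale0r.
have Pw i : P (w i).
  apply/wP; exists (fun j => (i == j)%:R).
  rewrite (bigD1 i) //= eqxx scale1r big1 ?addr0 // => j /negPf.
  by rewrite eq_sym => ->; rewrite scale0r.
have [f hf] := choice (fun i => (wP _).1 (Pv i)).
have [g hg] := choice (fun i => (vP _).1 (Pw i)).
apply: (@mulmx1_min _ _ _ (\matrix_(i, j) f i j) (\matrix_(i, j) g i j)).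
apply/matrixP => i j; rewrite !mxE; apply/eqP; rewrite -subr_eq0; apply/eqP.
move: j; apply: vfree; under eq_bigr do rewrite scalerBl.
rewrite sumrB [X in _ - X](bigD1 i) //= eqxx scale1r.
rewrite [X in _ - (_ + X)]big1 => [|j /negPf ji]; last first.
  by rewrite eq_sym ji scale0r.
rewrite addr0 [in X in _ - X]hf; apply/eqP; rewrite subr_eq0; apply/eqP.
under eq_bigr do rewrite scaler_suml; rewrite exchange_big /=.
apply: eq_bigr => l _; rewrite hg scaler_sumr; apply: eq_bigr => j _.
by rewrite !mxE scalerA.
Qed.

Lemma has_dim_uniq (V : lmodType K) (P : set V) m n :
  has_dim P m -> has_dim P n -> m = n.
Proof. by move=> hm hn; apply/eqP; rewrite eqn_leq !(has_dim_le hm hn, has_dim_le hn hm). Qed.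

Lemma has_dim_ext (V : lmodType K) (P Q : set V) n :
  (forall x, P x <-> Q x) -> has_dim P n -> has_dim Q n.
Proof. by move=> PQ [v [vP vfree]]; exists v; split=> // x; rewrite -PQ. Qed.

(** Used with [f] the identity, to carry a dimension between two [K]-module structures on the same
    set. *)
Lemma has_dim_transport (V W : lmodType K) (f : V -> W) (P : set V) (Q : set W) n :
  linear f -> injective f -> (forall x, P x <-> Q (f x)) ->
  (forall y, exists x, y = f x) -> has_dim P n -> has_dim Q n.
Proof.
move=> f_lin f_inj PQ f_surj [v [vP vfree]]; exists (f \o v).
have f0 : f 0 = 0 by have := f_lin (-1) 0 0; rewrite !scaleN1r oppr0 addr0 addNr.
have fs c : f (\sum_i c i *: v i) = \sum_i c i *: f (v i).
  apply: (big_ind2 (fun x y => f x = y)) => [//|x1 x2 y1 y2 <- <-|i _].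
    by rewrite -[x1]scale1r f_lin !scale1r.
  by have := f_lin (c i) (v i) 0; rewrite f0 !addr0.
split=> [y|c].
  have [x ->] := f_surj y; rewrite -PQ vP.
  by split=> -[c h]; exists c; [rewrite h fs|apply: f_inj; rewrite fs].
by rewrite /= -fs -f0 => /f_inj /vfree.
Qed.

(** Additivity in a short exact sequence, without forming the quotient: the [F i] with [i] in [s]
    are a basis of [P] modulo [P']. *)
Lemma has_dim_exact (V : lmodType K) (I : eqType) (s : seq I) (F : I -> V)
    (P P' : set V) n : uniq s -> has_dim P' n ->
  (forall x, P x <-> exists c : I -> K, P' (x - \sum_(i <- s) c i *: F i)) ->
  (forall c : I -> K, P' (\sum_(i <- s) c i *: F i) ->
     forall i, i \in s -> c i = 0) ->
  has_dim P (size s + n).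
Proof.
move=> s_uniq [v [vP vfree]] hP s_free.
have [i0|s0] := pselect (exists i0 : I, i0 \in s); last first.
  have s_nil : s = [::].
    by case: s s0 {s_uniq hP s_free} => // i s []; exists i; rewrite mem_head.
  rewrite s_nil /= add0n; exists v; split=> // x; rewrite hP s_nil.
  by split=> [[c]|Px]; [rewrite big_nil subr0 vP|exists (fun=> 0); rewrite big_nil subr0 vP].
case: i0 => i0 _.
pose w (j : 'I_(size s + n)) : V :=
  match split j with inl i => F (nth i0 s i) | inr i => v i end.
have wE (c : 'I_(size s + n) -> K) (c1 : I -> K) :
    (forall i : 'I_(size s), c1 (nth i0 s i) = c (lshift n i)) ->
    \sum_j c j *: w j = \sum_(i <- s) c1 i *: F i + \sum_i c (rshift (size s) i) *: v i.
  move=> hc; rewrite big_split_ord /= (big_nth i0) big_mkord; congr (_ + _).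
    by apply: eq_bigr => i _; rewrite /w (unsplitK (inl _ i)) hc.
  by apply: eq_bigr => i _; rewrite /w (unsplitK (inr _ i)).
pose tol (c : 'I_(size s + n) -> K) (i : I) : K :=
  if insub (index i s) is Some j then c (lshift n j) else 0.
have tolE c (i : 'I_(size s)) : tol c (nth i0 s i) = c (lshift n i).
  by rewrite /tol index_uniq // valK.
exists w; split=> [x|c].
  rewrite hP; split=> [[c1 /vP[c2 hx]]|[c ->]]; last first.
    exists (tol c); rewrite (wE c (tol c)) // addrAC subrr add0r vP.
    by exists (fun i => c (rshift (size s) i)).
  exists (fun j => match split j with inl i => c1 (nth i0 s i) | inr i => c2 i end).
  rewrite (wE _ c1) => [|i]; last by rewrite (unsplitK (inl _ i)).
  apply/eqP; rewrite addrC -subr_eq hx; apply/eqP; apply: eq_bigr => i _.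
  by rewrite (unsplitK (inr _ i)).
rewrite (wE c (tol c)) // => h.
have c10 i : i \in s -> tol c i = 0.
  apply: s_free; apply/vP; exists (fun i => - c (rshift (size s) i)).
  apply/eqP; rewrite -subr_eq0 -sumrN; apply/eqP; rewrite -[RHS]h; congr (_ + _).
  by apply: eq_bigr => l _; rewrite scaleNr opprK.
have c20 : forall i, c (rshift (size s) i) = 0.
  apply: vfree; rewrite -[RHS]h [in RHS]big_seq [X in _ = X + _]big1 ?add0r //.
  by move=> i /c10 ->; rewrite scale0r.
move=> j; rewrite -(splitK j); case: (split j) => i /=; last exact: c20.
by rewrite -tolE c10 // mem_nth.
Qed.

(* growth selects some growth; uniqueness makes it the one at hand. *)
Lemma growthE (V : lmodType K) (H : nat -> set V) (h : nat -> nat) d e :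
  e != 0 -> poly_growth d e (fun n => (h n)%:R) ->
  (exists n0, forall n, (n0 <= n)%N -> has_dim (H n) (h n)) ->
  growth H = (d, e).
Proof.
move=> e0 hde [n0 hH].
have has_gr : has_growth H (d, e).
  have [a ad [n1 ha]] := (poly_growth_binP _ _ _).1 hde.
  exists a; split=> //=; first by rewrite ad.
  exists (maxn n0 n1) => n; rewrite geq_max => /andP[? ?].
  by exists (h n); [exact: hH|exact: ha].
rewrite /growth; case: xgetP => [[d' e'] _ /= [a /= [ad' ad'0 [n1 ha]]]|/(_ (d, e)) //].
have hd' : poly_growth d' e' (fun n => (h n)%:R).
  apply/poly_growth_binP; exists a => //; exists (maxn n0 n1) => n.
  rewrite geq_max => /andP[/hH hn /ha[h' hn' <-]].
  by rewrite (has_dim_uniq hn hn').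
by rewrite ad' in ad'0; rewrite -(poly_growth_uniq e0 ad'0 hde hd').
Qed.
End HasDim.

(** * Standard monomials and Hilbert functions of ideals *)

Section Standard.
Variables (K : fieldType) (k : nat).
Implicit Types (I J : {mpoly K[k]} -> Prop) (p t : {mpoly K[k]}) (m : 'X_{1..k}).

Definition lead_set I m : Prop := exists p, [/\ I p, p != 0 & mlead p = m].

Lemma mlead_cancel m p t : p != 0 -> t != 0 -> mlead p = m -> mlead t = m ->
  let p' := p - (p@_m / t@_m) *: t in p' != 0 -> (mlead p' < m)%O.
Proof.
move=> p0 t0 pm tm p' p'0; rewrite lt_neqAle; apply/andP; split.
  apply: contra p'0 => /eqP p'm; rewrite -mleadc_eq0 p'm mcoeffB mcoeffZ.
  by rewrite divfK ?subrr // -tm mleadc_eq0.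
apply: le_trans (mleadB_le _ _) _; rewrite leUx pm lexx /=.
by apply: le_trans (mleadZ_le _ _) _; rewrite tm.
Qed.

(** Division with remainder along the well-founded monomial order: each leading term is cancelled by
    an element of [I] or moved to the remainder. The order is compatible with degree, so neither
    part outgrows [p]. *)
Lemma mpoly_reduce I p b : I 0 ->
    (forall c x y, I x -> I y -> I (c *: x + y)) -> (msize p <= b)%N ->
  exists p1 r : {mpoly K[k]}, [/\ p = p1 + r, I p1, (msize p1 <= b)%N, (msize r <= b)%N &
    forall m, m \in msupp r -> ~ lead_set I m].
Proof.
move=> I0 I_lin.
have zero : exists p1 r : {mpoly K[k]}, [/\ 0 = p1 + r, I p1, (msize p1 <= b)%N,
    (msize r <= b)%N & forall m, m \in msupp r -> ~ lead_set I m].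
  exists 0, 0; rewrite addr0 mmeasure0 leq0n; split=> // m.
  by rewrite msupp0.
have [m] : exists m, p = 0 \/ mlead p = m by exists (mlead p); right.
elim/(well_founded_induction (@ltom_wf k)): m p => m IHm p [-> //|pm] pb.
case: (eqVneq p 0) => [-> //|p0].
(* Here [t] will be an element of [I] with the leading monomial of [p], or that monomial itself. *)
have step t : t != 0 -> mlead t = m ->
    exists p1 r : {mpoly K[k]}, [/\ p - (p@_m / t@_m) *: t = p1 + r, I p1, (msize p1 <= b)%N,
      (msize r <= b)%N & forall m, m \in msupp r -> ~ lead_set I m].
  move=> t0 tm; set p' := p - _.
  have p'm := mlead_cancel p0 t0 pm tm.
  case: (eqVneq p' 0) => [-> //|p'0].
  apply: (IHm (mlead p')); [exact: p'm|by right|].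
  rewrite -mlead_deg //; apply: leq_trans pb; rewrite -mlead_deg // ltnS pm.
  exact/lemc_mdeg/ltW/p'm.
have tb t c : t != 0 -> mlead t = m -> (msize (c *: t) <= b)%N.
  move=> t0 tm; apply: leq_trans (msizeZ_le _ _) _.
  by rewrite -mlead_deg // tm -pm mlead_deg.
have sizeD x y : (msize x <= b)%N -> (msize y <= b)%N -> (msize (x + y) <= b)%N.
  move=> hx hy; apply: leq_trans (mmeasureD_le _ _ _) _.
  by rewrite geq_max hx.
case: (pselect (lead_set I m)) => [[t [It t0 tm]]|nm].
  have [p1 [r [/(canRL (subrK _)) -> Ip1 p1b rb hr]]] := step t t0 tm.
  exists ((p@_m / t@_m) *: t + p1), r; split=> //; first by rewrite addrAC [p1 + _]addrC.
    exact: I_lin.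
  by apply: sizeD => //; exact: tb.
have X0 : 'X_[m] != 0 :> {mpoly K[k]} by rewrite -msupp_eq0 msuppX.
have [p1 [r [/(canRL (subrK _)) -> Ip1 p1b rb hr]]] := step 'X_[m] X0 (mleadXm _ m).
set c := p@_m / _; exists p1, (r + c *: 'X_[m]); split=> //.
- by rewrite addrA.
- by apply: sizeD => //; apply: tb => //; exact: mleadXm.
move=> m' /msuppD_le; rewrite mem_cat => /orP[/hr //|].
by move=> /msuppZ_le; rewrite msuppX inE => /eqP ->.
Qed.

Definition mnm_of_exp (l : seq nat) : 'X_{1..k} := [multinom nth 0%N l i | i < k].

Lemma mnm_of_expK m : mnm_of_exp m = m.
Proof. by apply/mnmP => i; rewrite mnmE (mnm_nth 0%N). Qed.

Lemma mdeg_mnm_of_exp l : size l = k -> mdeg (mnm_of_exp l) = sumn l.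
Proof.
move=> sl; rewrite mdegE sumnE (big_nth 0%N) sl big_mkord.
by apply: eq_bigr => i _; rewrite mnmE.
Qed.

Definition std_mons I n : seq 'X_{1..k} :=
  [seq mnm_of_exp l | l <- [seq l <- exps k n | `[< ~ lead_set I (mnm_of_exp l) >]]].

Lemma mem_std_mons I n m :
  m \in std_mons I n <-> (mdeg m <= n)%N /\ ~ lead_set I m.
Proof.
split=> [/mapP[l]|[mn nm]].
  rewrite mem_filter mem_exps => /and3P[/asboolP nl /eqP sl ln] ->.
  by rewrite mdeg_mnm_of_exp.
apply/mapP; exists (m : seq nat); last by rewrite mnm_of_expK.
have sm : size (m : seq nat) = k by rewrite size_tuple.
rewrite mem_filter mem_exps mnm_of_expK sm eqxx -mdeg_mnm_of_exp // mnm_of_expK.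
by rewrite mn /= andbT; apply/asboolP.
Qed.

Lemma uniq_std_mons I n : uniq (std_mons I n).
Proof.
rewrite map_inj_in_uniq ?filter_uniq ?uniq_exps // => l l'.
rewrite !mem_filter !mem_exps => /and3P[_ /eqP sl _] /and3P[_ /eqP sl' _] ll'.
apply: (@eq_from_nth _ 0%N) => [|i]; first by rewrite sl sl'.
rewrite sl => ik; have /mnmP/(_ (Ordinal ik)) := ll'.
by rewrite !mnmE.
Qed.

(** For an ideal this is Macaulay's description of the Hilbert function: the standard monomials of
    degree at most [n] form a basis of the polynomials of degree at most [n] modulo [I]. *)
Definition hilb I n : nat := size (std_mons I n).

Lemma hilbE I n : hilb I n = coheight k (fun l => lead_set I (mnm_of_exp l)) n.
Proof. by rewrite /hilb size_map size_filter. Qed.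

(** Multiplying by a monomial shifts leading monomials, so those of an ideal form an up-set and
    [coheight_poly] applies. *)
Lemma hilb_poly I : (forall p q, I p -> I (q * p)) ->
  exists D, poly_growth D 0 (fun n => (hilb I n)%:R).
Proof.
move=> I_M; have [|D hD] := @coheight_poly k (fun l => lead_set I (mnm_of_exp l)).
  apply: upset_le => l l' _ _ ll' [p [Ip p0 pl]].
  pose m := (mnm_of_exp l' - mnm_of_exp l)%MM.
  have X0 : 'X_[m] != 0 :> {mpoly K[k]} by rewrite -msupp_eq0 msuppX.
  exists ('X_[m] * p); split; [exact: I_M|by rewrite mulf_neq0|].
  rewrite mleadM // mleadXm pl /m submK //.
  by apply/mnm_lepP => i; rewrite !mnmE.
by exists D; apply: poly_growth_ext hD; exists 0%N => n _; rewrite hilbE.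
Qed.

Lemma hilb_sub I J n : (forall p, I p -> J p) -> (hilb J n <= hilb I n)%N.
Proof.
move=> IJ; apply: uniq_leq_size (uniq_std_mons _ _) _ => m.
move=> /mem_std_mons[mn nm]; apply/mem_std_mons; split=> // -[p [Ip p0 pm]].
by apply: nm; exists p; split=> //; exact: IJ.
Qed.

Lemma hilb_ext I J n : (forall p, I p <-> J p) -> hilb I n = hilb J n.
Proof.
by move=> IJ; apply/eqP; rewrite eqn_leq !hilb_sub // => p /IJ.
Qed.

Lemma hilb_gt0 I n : (forall p c, I p -> I (c *: p)) -> ~ I 1 -> (0 < hilb I n)%N.
Proof.
move=> I_Z nI; rewrite /hilb; suff: 0%MM \in std_mons I n by case: (std_mons I n).
apply/mem_std_mons; rewrite mdeg0; split=> // -[p [Ip p0 pm]].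
have := mlead_deg p0; rewrite pm mdeg0 => /esym/eqP/msize_poly1P[c c0 pE].
case: nI; have := I_Z _ c^-1 Ip; rewrite pE -mul_mpolyC -mpolyCM mulVf //.
Qed.
End Standard.

(** * Graded modules over a polynomial ring whose variables have weight [w] *)

Section GradedModule.
Variables (K : fieldType) (k : nat).
Local Notation A := {mpoly K[k]}.
Variables (V : lmodType A) (D : nat -> set V) (w : nat).
Hypothesis w_gt0 : (0 < w)%N.
Hypothesis D_grading : is_grading D.
Hypothesis D_scale : forall e m (p : A) x,
  p \is e.-homog -> D m x -> D (m + w * e)%N (p *: x).
Implicit Types (s : seq (nat * V)) (p q : A) (x y : V).

Definition mpolyC_rmorph : {rmorphism K -> A} := @mpolyC k K.
Local Notation W := (restr mpolyC_rmorph V).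

(** The submodule generated by the list. Recursion on the list exposes the filtration by spans of
    tails, along which dimensions are computed. *)
Fixpoint gen_span s : set V :=
  if s is (_, x) :: s' then [set y | exists p, gen_span s' (y - p *: x)]
  else [set 0].

(** The ideal I for which A / I is isomorphic, through [x], to the span of [x] and [s] modulo the
    span of [s]. *)
Definition conductor s x : A -> Prop := fun p => gen_span s (p *: x).

Fixpoint hom_gens s : Prop :=
  if s is (d, x) :: s' then D d x /\ hom_gens s' else True.

Lemma gen_span0 s : gen_span s 0.
Proof. by elim: s => //= -[_ x] s IHs; exists 0; rewrite scale0r subr0. Qed.

Lemma gen_span_lin s p x y :
  gen_span s x -> gen_span s y -> gen_span s (p *: x + y).
Proof.
elim: s x y => [|[_ z] s IHs] x y /=; first by move=> -> ->; rewrite scaler0 addr0.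
move=> [a ha] [b hb]; exists (p * a + b).
suff -> : p *: x + y - (p * a + b) *: z = p *: (x - a *: z) + (y - b *: z) by exact: IHs.
by rewrite scalerBr scalerDl -scalerA opprD addrACA.
Qed.

Lemma gen_spanD s x y : gen_span s x -> gen_span s y -> gen_span s (x + y).
Proof. by move=> hx hy; rewrite -[x]scale1r; exact: gen_span_lin. Qed.

Lemma gen_spanZ s p x : gen_span s x -> gen_span s (p *: x).
Proof. by move=> hx; rewrite -[_ *: _]addr0; apply/gen_span_lin/gen_span0. Qed.

Lemma gen_spanB s x y : gen_span s x -> gen_span s y -> gen_span s (x - y).
Proof. by move=> hx hy; rewrite addrC -scaleN1r; exact: gen_span_lin. Qed.

Lemma gen_span_sum s (J : Type) (r : seq J) (P : pred J) (f : J -> V) :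
  (forall i, P i -> gen_span s (f i)) -> gen_span s (\sum_(i <- r | P i) f i).
Proof.
by move=> h; elim/big_ind: _ => //; [exact: gen_span0|exact: gen_spanD].
Qed.

Lemma gen_span_cons s d x y : gen_span s y -> gen_span ((d, x) :: s) y.
Proof. by move=> hy; exists 0; rewrite scale0r subr0. Qed.

Lemma gen_span_head s d x p : gen_span ((d, x) :: s) (p *: x).
Proof. by exists p; rewrite subrr; exact: gen_span0. Qed.

Lemma gen_span_mem s t : t \in s -> gen_span s t.2.
Proof.
elim: s => // -[d x] s IHs; rewrite inE => /orP[/eqP ->|/IHs]; last exact: gen_span_cons.
by rewrite -[X in gen_span _ X]scale1r; exact: gen_span_head.
Qed.

Lemma conductor_lin s x (c : K) p q :
  conductor s x p -> conductor s x q -> conductor s x (c *: p + q).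
Proof.
move=> hp hq; rewrite /conductor scalerDl -mul_mpolyC -scalerA.
exact: gen_span_lin.
Qed.

Lemma conductor0 s x : conductor s x 0.
Proof. by rewrite /conductor scale0r; exact: gen_span0. Qed.

Lemma conductorM s x p q : conductor s x p -> conductor s x (q * p).
Proof. by rewrite /conductor -scalerA; exact: gen_spanZ. Qed.

(* The Hilbert function of the span of s, counted through its filtration by    *)
(* the spans of the tails of s, whose graded pieces are the A / conductor.     *)
Fixpoint span_hilb s (M : nat) : nat :=
  if s is (d, x) :: s' then
    ((if d <= M then hilb (conductor s' x) ((M - d) %/ w) else 0)
     + span_hilb s' M)%N
  else 0%N.

Section Components.
Variable c : nat -> V -> V.
Hypothesis c_D : forall m x, D m (c m x).
Hypothesis c_B : forall m, {morph c m : x y / x - y}.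
Hypothesis c_id : forall m x, D m x -> c m x = x.
Hypothesis c_neq : forall m m' x, D m x -> m != m' -> c m' x = 0.
Hypothesis c_sum : forall x, exists n0, forall n, (n0 <= n)%N -> x = \sum_(m < n) c m x.

HB.instance Definition _ m := GRing.isZmodMorphism.Build V V (c m) (@c_B m).

Lemma comp_scale d x m p : D d x ->
  c m (p *: x) = (\sum_(e < msize p | (d + w * e)%N == m) pihomog mdeg e p) *: x.
Proof.
move=> Dx; rewrite {1}[p](@pihomog_partitionE _ _ mdeg (msize p)) //.
rewrite !scaler_suml raddf_sum [RHS]big_mkcond; apply: eq_bigr => e _ /=.
have De := D_scale (pihomogP mdeg e p) Dx.
by case: eqP => [<-|/eqP ne]; [exact: c_id|exact: c_neq De ne].
Qed.

Lemma gen_span_comp s m y : hom_gens s -> gen_span s y -> gen_span s (c m y).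
Proof.
elim: s y => [|[d x] s IHs] y /=; first by move=> _ ->; rewrite raddf0.
move=> [Dx hs] [p /(IHs _ hs)]; rewrite raddfB /= (comp_scale _ _ Dx) => h.
by eexists; exact: h.
Qed.

(** Homogeneous generators make the span closed under taking components, so the conductor of a
    homogeneous element is a homogeneous ideal. *)
Lemma conductor_comp s d x p e : hom_gens s -> D d x ->
  conductor s x p -> conductor s x (pihomog mdeg e p).
Proof.
move=> hs Dx /(gen_span_comp (d + w * e)%N hs); rewrite (comp_scale _ _ Dx).
(* As [w] is positive, only the part of degree [e] of [p] contributes to the component of degree
   [d + w * e]. *)
rewrite (eq_bigl (fun i : 'I__ => (i : nat) == e)) => [|i]; last first.
  by rewrite eqn_add2l eqn_pmul2l.
case: (ltnP e (msize p)) => [ep|pe].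
  by rewrite (big_pred1 (Ordinal ep)).
move=> _; have -> : pihomog mdeg e p = 0.
  rewrite pihomogE big_seq_cond big1 // => m /andP[/msize_mdeg_lt mp /eqP me].
  by move: mp pe; rewrite me ltnNge => /negP mp /mp.
exact: conductor0.
Qed.

Definition trunc M y := \sum_(m < M.+1) c m y.

Lemma trunc_partial_sum M y : partial_sum D M (trunc M y).
Proof. by exists (fun m => c m y). Qed.

Lemma truncE M y : partial_sum D M y -> y = trunc M y.
Proof.
move=> [z Dz ->]; apply: eq_bigr => i _; rewrite raddf_sum (bigD1 i) //=.
rewrite c_id // big1 ?addr0 // => j ji; apply: c_neq (Dz j) _.
exact: ji.
Qed.

Lemma truncD M x y : trunc M (x - y) = trunc M x - trunc M y.
Proof. by rewrite /trunc -sumrB; apply: eq_bigr => i _; rewrite raddfB. Qed.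

Lemma gen_span_trunc s M y : hom_gens s -> gen_span s y -> gen_span s (trunc M y).
Proof. by move=> hs hy; apply: gen_span_sum => i _; exact: gen_span_comp. Qed.

Lemma partial_sumB M x y :
  partial_sum D M x -> partial_sum D M y -> partial_sum D M (x - y).
Proof. by move=> /truncE -> /truncE ->; rewrite -truncD; exact: trunc_partial_sum. Qed.

Lemma partial_sum_D m M x : (m <= M)%N -> D m x -> partial_sum D M x.
Proof.
move=> mM Dx; exists (fun i => if i == m then x else 0) => [i|].
  by case: eqP => [->|_] //; exact: grading0.
by rewrite -big_mkcond (big_pred1 (Ordinal (mM : m < M.+1)%N)).
Qed.

Lemma partial_sum_sum M (J : Type) (r : seq J) (P : pred J) (f : J -> V) :
  (forall i, P i -> partial_sum D M (f i)) ->
  partial_sum D M (\sum_(i <- r | P i) f i).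
Proof.
have p0 : partial_sum D M 0 by apply: (partial_sum_D (leq0n M)); exact: grading0.
move=> h; elim/big_ind: _ => // x y hx hy; rewrite -[y]opprK.
by apply: partial_sumB => //; rewrite -sub0r; exact: partial_sumB.
Qed.

Lemma partial_sum_scale d x p M b : D d x -> (msize p <= b)%N ->
  (forall e, (e < b)%N -> (d + w * e <= M)%N) -> partial_sum D M (p *: x).
Proof.
move=> Dx pb hb; rewrite [p](@pihomog_partitionE _ _ mdeg b) // scaler_suml.
apply: partial_sum_sum => e _.
by apply: partial_sum_D (D_scale (pihomogP mdeg e p) Dx); exact: hb.
Qed.

(** Truncation discards the homogeneous parts of [p] of degree above [(M - d) %/ w]. Since [msize]
    is the degree plus one, and 0 for the zero polynomial, the bound 0 encodes that nothing survives
    when [d > M]. *)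
Lemma trunc_scale d x p M : D d x -> exists p', trunc M (p *: x) = p' *: x /\
  (msize p' <= if d <= M then ((M - d) %/ w).+1 else 0)%N.
Proof.
move=> Dx; rewrite /trunc.
under eq_bigr do rewrite (comp_scale _ _ Dx).
rewrite -scaler_suml; eexists; split; first by [].
elim/big_ind: _ => [|x' y' hx hy|i _]; first by rewrite mmeasure0.
  by apply: leq_trans (mmeasureD_le _ _ _) _; rewrite geq_max hx.
elim/big_ind: _ => [|x' y' hx hy|e /eqP ei]; first by rewrite mmeasure0.
  by apply: leq_trans (mmeasureD_le _ _ _) _; rewrite geq_max hx.
have iM := ltn_ord i; rewrite ltnS in iM.
have -> : (d <= M)%N by rewrite (leq_trans _ iM) // -ei leq_addr.
have eM : (e <= (M - d) %/ w)%N.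
  by rewrite leq_divRL // mulnC; move: iM; rewrite -ei; lia.
rewrite msizeE; apply/bigmax_leqP_seq => m /= + _.
rewrite mcoeff_msupp pihomogE => h; rewrite ltnS; apply: leq_trans eM.
have := pihomogP mdeg e p => /dhomogP -> //.
by rewrite mcoeff_msupp pihomogE.
Qed.

(** Induction on the filtration by tails. Modulo the span of [s], the part of degree at most [M] has
    as basis the multiples of [x] by the standard monomials of the conductor of degree at most
    [(M - d) %/ w]: truncation bounds the multiplier of [x], and [mpoly_reduce] replaces it by a
    standard remainder of no larger size. *)
Lemma span_hilb_dim_comp s M : hom_gens s ->
  @has_dim K W (fun y => gen_span s y /\ partial_sum D M y) (span_hilb s M).
Proof.
elim: s => [|[d x] s IHs] /=.
  move=> _; exists (fun=> 0); split=> [y|c' _ []//]; split.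
    by move=> [-> _]; exists (fun=> 0); rewrite big_ord0.
  move=> [c' ->]; rewrite big_ord0; split=> //.
  by apply: (partial_sum_D (leq0n M)); exact: grading0.
move=> [Dx hs]; pose I := conductor s x.
pose S := if (d <= M)%N then std_mons I ((M - d) %/ w) else [::].
have -> : (if (d <= M)%N then hilb I ((M - d) %/ w) else 0)%N = size S.
  by rewrite /S; case: ifP.
have S_uniq : uniq S by rewrite /S; case: ifP => // _; exact: uniq_std_mons.
have S_std m : m \in S -> ~ lead_set I m.
  by rewrite /S; case: ifP => // _ /mem_std_mons[].
pose t (a : 'X_{1..k} -> K) : A := \sum_(m <- S) a m *: 'X_[m].
have tx a : \sum_(m <- S) a m *: ('X_[m] *: x : W) = t a *: x.
  rewrite /t scaler_suml; apply: eq_bigr => m _.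
  by rewrite -mul_mpolyC -scalerA.
pose b := (if d <= M then ((M - d) %/ w).+1 else 0)%N.
have b_bound e : (e < b)%N -> (d + w * e <= M)%N.
  rewrite /b; case: ifP => // dM; rewrite ltnS leq_divRL //; lia.
have S_bound m : m \in S -> (mdeg m < b)%N.
  by rewrite /S /b; case: ifP => // _ /mem_std_mons[].
have tb a : (msize (t a) <= b)%N.
  rewrite /t big_seq; elim/big_ind: _ => [|x' y' hx hy|m /S_bound mb].
  - by rewrite mmeasure0.
  - by apply: leq_trans (mmeasureD_le _ _ _) _; rewrite geq_max hx.
  by apply: leq_trans (msizeZ_le _ _) _; rewrite msizeX.
have t_coef a m : m \in S -> (t a)@_m = a m.
  move=> mS; rewrite /t raddf_sum (bigD1_seq m) //= mcoeffZ mcoeffX eqxx mulr1.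
  rewrite big1 ?addr0 // => m' /negPf m'm.
  by rewrite mcoeffZ mcoeffX m'm mulr0.
have t_supp a m : m \in msupp (t a) -> m \in S.
  rewrite mcoeff_msupp; apply: contraR => mS; rewrite /t raddf_sum big_seq big1 // => m' m'S.
  rewrite /= mcoeffZ mcoeffX; case: eqP => [m'm|_]; last by rewrite mulr0.
  by move: mS; rewrite -m'm m'S.
have tE r : (msize r <= b)%N -> (forall m, m \in msupp r -> ~ lead_set I m) ->
    r = t (fun m => r@_m).
  move=> rb rstd; apply/mpolyP => m; case: (boolP (m \in S)) => mS.
    by rewrite t_coef.
  rewrite [RHS]memN_msupp_eq0; last by apply: contra mS; exact: t_supp.
  apply: memN_msupp_eq0; apply: contra mS => mr.
  move: (msize_mdeg_lt mr) (rstd _ mr) => mr' nm.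
  move: (leq_trans mr' rb); rewrite /b /S; case: ifP => // _ mb.
  by apply/mem_std_mons.
apply: (@has_dim_exact K W _ S (fun m => 'X_[m] *: x) _ _ _ S_uniq (IHs hs)) => [y|a].
  split=> [[[p hp] yM]|[a]]; last first.
    rewrite tx => -[hy yM]; split; first by exists (t a).
    have yE : y = ((y : V) - t a *: (x : V)) - (0 - t a *: (x : V)) :> V.
      by rewrite sub0r opprK subrK.
    rewrite yE; apply: partial_sumB; first exact: yM.
    apply: partial_sumB; last exact: partial_sum_scale (tb a) b_bound.
    by apply: (partial_sum_D (leq0n M)); exact: grading0.
  have [p' [p'x p'b]] := trunc_scale p M Dx.
  have {}hp : gen_span s (y - p' *: x).
    by rewrite [y](truncE yM) -p'x -truncD; exact: gen_span_trunc.
  have [p1 [r [p'E Ip1 p1b rb rstd]]] :=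
    mpoly_reduce (@conductor0 s x) (@conductor_lin s x) p'b.
  exists (fun m => r@_m); rewrite tx -tE //; split.
    have -> : y - r *: x = (y - p' *: x) + p1 *: x.
      by rewrite p'E scalerDl opprD addrA addrAC [y - _ - _]addrAC addrAC subrK.
    exact: gen_spanD.
  by apply: partial_sumB => //; exact: partial_sum_scale rb b_bound.
(* Independence: a nonzero [t a] in the conductor would have a leading monomial that is also
   standard. *)
rewrite tx => -[ta _].
suff t0 : t a = 0 by move=> m mS; rewrite -t_coef // t0 mcoeff0.
apply: contrapT => /eqP t0; have := mlead_supp t0.
by move=> /t_supp/S_std; apply; exists (t a).
Qed.
End Components.

Lemma span_hilb_dim s M : hom_gens s ->
  @has_dim K W (fun y => gen_span s y /\ partial_sum D M y) (span_hilb s M).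
Proof.
have [c [cD cB cid cneq _]] := grading_comp D_grading.
exact: (span_hilb_dim_comp cD cB cid cneq).
Qed.

Lemma conductor_pihomog s d x p e : hom_gens s -> D d x ->
  conductor s x p -> conductor s x (pihomog mdeg e p).
Proof.
have [c [cD cB cid cneq _]] := grading_comp D_grading.
exact: (conductor_comp cB cid cneq).
Qed.
End GradedModule.

(** * Two ways to count a cyclic module *)

Section CyclicModule.
Variables (K : fieldType) (k : nat).
Local Notation A := {mpoly K[k]}.
Variables (V : lmodType A) (D : nat -> set V).
Hypothesis D_grading : is_grading D.
Hypothesis D_scale : forall e m (p : A) x,
  p \is e.-homog -> D m x -> D (m + 1 * e)%N (p *: x).
Variable x : V.
Hypothesis Dx : D 0 x.
Hypothesis x_gen : forall y, exists p : A, y = p *: x.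
Local Notation W := (restr (mpolyC_rmorph K k) V).

Lemma cyclic_hilb_dim n (I : A -> Prop) : (forall p, I p <-> p *: x = 0) ->
  @has_dim K W (partial_sum D n) (hilb I n).
Proof.
move=> hI; have homs : hom_gens D [:: (0%N, x)] by [].
have := span_hilb_dim (ltn0Sn 0) D_grading D_scale n homs.
rewrite /= divn1 subn0 addn0 (@hilb_ext _ _ _ I) => [|p]; last first.
  by rewrite /conductor /= hI.
apply: has_dim_ext => y; split=> [[]//|hy]; split=> //.
by have [p ->] := x_gen y; exists p; rewrite subrr.
Qed.

(** Listing the redundant generator [y] after [x] counts the cyclic module as its quotient by A y
    plus A y itself, shifted by [e]. Compared with [cyclic_hilb_dim], this gives the Hilbert
    function of a principal extension of an ideal. *)
Lemma cyclic_hilb_dim2 n e y (I J : A -> Prop) : D e y ->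
  (forall p, I p <-> p *: y = 0) -> (forall p, J p <-> exists r : A, p *: x = r *: y) ->
  @has_dim K W (partial_sum D n) (hilb J n + if e <= n then hilb I (n - e) else 0)%N.
Proof.
move=> Dy hI hJ; have homs : hom_gens D [:: (0%N, x); (e, y)] by [].
have := span_hilb_dim (ltn0Sn 0) D_grading D_scale n homs.
rewrite /= !divn1 subn0 addn0 (@hilb_ext _ _ (conductor [::] y) I) => [|p]; last first.
  by rewrite /conductor /= hI.
rewrite (@hilb_ext _ _ (conductor _ x) J) => [|p]; last first.
  rewrite /conductor /= hJ; split=> -[r h]; exists r; apply/eqP.
    by rewrite -subr_eq0 h.
  by rewrite h subrr.
apply: has_dim_ext => z; split=> [[]//|hz]; split=> //.
by have [p ->] := x_gen z; exists p, 0; rewrite scale0r subr0 subrr.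
Qed.
End CyclicModule.

(** * The residue field of a prime ideal *)

Lemma fraction_tofrac (R : idomainType) (x : {fraction R}) :
  exists n d, d != 0 /\ x = @FracField.tofrac R n / @FracField.tofrac R d.
Proof.
elim/quotW: x => x; have d0 : (val x).2 != 0 by case: x.
exists (val x).1, (val x).2; split=> //.
apply: (canRL (mulfK _)); first by rewrite tofrac_eq0.
unlock FracField.tofrac; rewrite -[LHS]FracField.pi_mul.
apply/eqmodP; rewrite /= FracField.equivfE /FracField.mulf.
by rewrite !numden_Ratio ?(oner_neq0, mulr1) // mulrC.
Qed.

Lemma rmorph_frac_sq (A : comNzRingType) (F : fieldType) (f : {rmorphism A -> F})
    h a b : f b != 0 -> (f a / f b) ^+ 2 = f h -> f (a ^+ 2 - h * b ^+ 2) = 0.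
Proof.
move=> b0 hab; rewrite !expr2 rmorphB !rmorphM -!expr2 -hab.
by rewrite expr_div_n divfK ?subrr // expf_neq0.
Qed.

Section ResidueField.
Variables (A : comNzRingType) (q : {pred A}) (hq : prime_ideal q).
Local Notation iota := (resfield_proj hq).

Lemma resring_proj_eq0 p : (resring_proj hq p == 0) = (p \in q).
Proof.
have -> : (p \in q) = (p \in prime_mem hq) by [].
rewrite -[p in RHS]subr0 Quotient.idealrBE -/(resring_proj hq p) .
by rewrite -(rmorph0 (resring_proj hq)).
Qed.

Lemma resfield_proj_eq0 p : (iota p == 0) = (p \in q).
Proof. by rewrite /resfield_proj /= tofrac_eq0 resring_proj_eq0. Qed.

Lemma resring_proj_surj (x : resring hq) : exists p, x = resring_proj hq p.
Proof. by exists (repr x); rewrite /resring_proj /= reprK. Qed.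

Lemma resfield_frac (x : resfield hq) :
  exists a b, b \notin q /\ x = iota a / iota b.
Proof.
have [n [d [d0 ->]]] := fraction_tofrac x.
have [a aE] := resring_proj_surj n; have [b bE] := resring_proj_surj d.
exists a, b; rewrite -resring_proj_eq0 -bE d0; split=> //.
by rewrite aE bE.
Qed.

Lemma resfield_nonsquare h :
  (forall a b, b \notin q -> a ^+ 2 - h * b ^+ 2 \notin q) ->
  forall x, x ^+ 2 != iota h.
Proof.
move=> h_nsq x; apply/eqP => xE; have [a [b [bq xab]]] := resfield_frac x.
have b0 : iota b != 0 by rewrite resfield_proj_eq0.
have /negP := h_nsq a b bq; apply; rewrite -resfield_proj_eq0; apply/eqP.
by apply: rmorph_frac_sq b0 _; rewrite -xab.
Qed.

Lemma prime_ideal0 : 0 \in q.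
Proof. by case: hq => -[]. Qed.

Lemma prime_idealD x y : x \in q -> y \in q -> x + y \in q.
Proof.
move=> hx hy; rewrite -resfield_proj_eq0 rmorphD.
by move: hx hy; rewrite -!resfield_proj_eq0 => /eqP -> /eqP ->; rewrite addr0.
Qed.

Lemma prime_idealB x y : x \in q -> y \in q -> x - y \in q.
Proof.
move=> hx hy; rewrite -resfield_proj_eq0 rmorphB.
by move: hx hy; rewrite -!resfield_proj_eq0 => /eqP -> /eqP ->; rewrite subrr.
Qed.

Lemma prime_idealM x y : (x * y \in q) = (x \in q) || (y \in q).
Proof. by rewrite -!resfield_proj_eq0 rmorphM mulf_eq0. Qed.

Lemma prime_ideal_sum (I : Type) (r : seq I) (P : pred I) (f : I -> A) :
  (forall i, P i -> f i \in q) -> \sum_(i <- r | P i) f i \in q.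
Proof.
by move=> h; elim/big_ind: _ => //; [exact: prime_ideal0|exact: prime_idealD].
Qed.

Lemma prime_ideal1 : 1 \notin q.
Proof. by rewrite -resfield_proj_eq0 rmorph1 oner_eq0. Qed.
End ResidueField.

Lemma in_tuple_cons0 (T : Type) (x : T) s : tnth (in_tuple (x :: s)) ord0 = x.
Proof. by rewrite (tnth_nth x). Qed.

Lemma in_tuple_consS (T : Type) (x : T) s (i : 'I_(size s)) :
  tnth (in_tuple (x :: s)) (lift ord0 i) = tnth (in_tuple s) i.
Proof. by rewrite !(tnth_nth x). Qed.

(** * The rank of a torsion free module and its embedding into a vector space *)

Section Rank.
Variables (K : fieldType) (k : nat).
Local Notation A := {mpoly K[k]}.
Variables (V : lmodType A) (q : {pred A}) (hq : prime_ideal q).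
Hypothesis q_ann : forall p (x : V), p \in q -> p *: x = 0.
Hypothesis q_tf : forall p (x : V), p \notin q -> p *: x = 0 -> x = 0.
Implicit Types (s t : seq (nat * V)) (p : A) (x y : V).
Local Notation F := (resfield hq).
Local Notation iota := (resfield_proj hq : {rmorphism A -> F}).

Lemma ann_conductor s x p : p \in q -> conductor s x p.
Proof. by move=> pq; rewrite /conductor q_ann //; exact: gen_span0. Qed.

(** With [ann_conductor] this says that the conductor is exactly [q], so that [x] generates a copy
    of A / q modulo the span of [s]. *)
Definition is_free s x : bool := `[< forall p, conductor s x p -> p \in q >].

(* The number of these generators is the rank of V over A / q. *)
Fixpoint free_part s : seq (nat * V) :=
  if s is t :: s' then
    if is_free s' t.2 then t :: free_part s' else free_part s'
  else [::].

Lemma gen_spanP t y : gen_span t y <->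
  exists a : 'I_(size t) -> A, y = \sum_i a i *: (tnth (in_tuple t) i).2.
Proof.
elim: t y => [|[d x] t IHt] y.
  by split=> [->|[a ->]]; [exists (fun=> 0)|]; rewrite /= big_ord0.
split=> [[p /IHt[a hy]]|[a ->]].
  exists (fun i => if unlift ord0 i is Some j then a j else p).
  rewrite (canRL (subrK _) hy) big_ord_recl unlift_none in_tuple_cons0 /= addrC.
  congr (_ + _).
  by apply: eq_bigr => i _; rewrite liftK in_tuple_consS.
exists (a ord0); apply/IHt; exists (fun i => a (lift ord0 i)).
rewrite big_ord_recl in_tuple_cons0 /= addrAC subrr add0r.
by apply: eq_bigr => i _; rewrite in_tuple_consS.
Qed.

(** A generator that is not free has a multiple, by some [c] outside [q], in the span of the later
    ones. Clearing such denominators one by one stays outside [q] because [q] is prime. *)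
Lemma gen_span_free_part s y : gen_span s y ->
  exists2 b, b \notin q & gen_span (free_part s) (b *: y).
Proof.
elim: s y => [|[d x] s IHs] y /=.
  by move=> ->; exists 1; rewrite ?scaler0 // (prime_ideal1 hq).
move=> [p hy]; have [b bq hb] := IHs _ hy.
case: ifP => [_|/asboolP nf].
  exists b => //; exists (b * p); rewrite -scalerA -scalerBr.
  exact: hb.
have [c [cx cq]] : exists c, conductor s x c /\ c \notin q.
  apply: contrapT => h; apply: nf => p' hp'; apply: contrapT => /negP p'q.
  by apply: h; exists p'.
have [b' b'q hb'] := IHs _ cx.
exists (b * b' * c); first by rewrite !(prime_idealM hq) !negb_or bq b'q.
have -> : (b * b' * c) *: y = (b' * c) *: (b *: (y - p *: x)) + (p * b) *: (b' *: (c *: x)).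
  rewrite !scalerA scalerBr !scalerA; rewrite addrC.
  have -> : b' * c * b * p = p * b * b' * c by ring.
  by rewrite [_ + (_ - _)]addrC subrK; congr (_ *: _); ring.
by apply: gen_span_lin => //; exact: gen_spanZ.
Qed.

Lemma free_part_sub s y : gen_span (free_part s) y -> gen_span s y.
Proof.
elim: s y => [|[d x] s IHs] y //=; case: ifP => _ /=.
  by move=> [p /IHs hp]; exists p.
by move=> /IHs; exact: gen_span_cons.
Qed.

(** The leading coefficient of a relation lies in a conductor equal to [q]; it then acts by zero,
    and the relation shortens. *)
Lemma free_part_free s (a : 'I_(size (free_part s)) -> A) :
  \sum_i a i *: (tnth (in_tuple (free_part s)) i).2 = 0 ->
  forall i, a i \in q.
Proof.
elim: s a => [|[d x] s IHs] /=; first by move=> a _ [].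
case: ifP => [/asboolP xfree|_] a; last exact: IHs.
rewrite big_ord_recl in_tuple_cons0 /= => h.
have a0 : a ord0 \in q.
  apply: xfree; apply: free_part_sub.
  rewrite (canRL (addrK _) h) sub0r -scaleN1r; apply/gen_spanZ/gen_spanP.
  exists (fun i => a (lift ord0 i)); apply: eq_bigr => i _.
  by rewrite in_tuple_consS.
rewrite q_ann // add0r in h.
move=> i; case: (unliftP ord0 i) => [j|] -> //.
apply: (IHs (fun i => a (lift ord0 i))); rewrite -[RHS]h.
by apply: eq_bigr => l _; rewrite in_tuple_consS.
Qed.

(* phi embeds V into V (x) F = F ^ r, with basis the elements of free_part s. *)
Lemma free_part_coord s : (forall y, gen_span s y) ->
  exists (phi : V -> 'rV[F]_(size (free_part s)))
         (e : 'I_(size (free_part s)) -> V),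
  [/\ {morph phi : x y / x + y},
      forall p x, phi (p *: x) = iota p *: phi x,
      forall x, phi x = 0 -> x = 0,
      forall i, phi (e i) = delta_mx 0 i &
      forall x, exists b (a : 'I_(size (free_part s)) -> A),
        b \notin q /\ b *: x = \sum_i a i *: e i].
Proof.
move=> s_gen; set r := size _.
pose e (i : 'I_r) := (tnth (in_tuple (free_part s)) i).2.
have ex x : exists ba : A * ('I_r -> A),
    ba.1 \notin q /\ ba.1 *: x = \sum_i ba.2 i *: e i.
  have [b bq /gen_spanP[a ha]] := gen_span_free_part (s_gen x).
  by exists (b, a).
have [f hf] := choice ex.
have iota0 p : p \notin q -> iota p != 0 by rewrite resfield_proj_eq0.
pose phi x : 'rV[F]_r := \row_i (iota ((f x).2 i) / iota (f x).1).
(* The coordinates do not depend on the chosen denominator, so additivity and linearity may be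
   checked with a convenient one. *)
have phiE x b (a : 'I_r -> A) : b \notin q -> b *: x = \sum_i a i *: e i ->
    phi x = \row_i (iota (a i) / iota b).
  move=> bq hb; have [cq hc] := hf x; apply/rowP => i; rewrite !mxE.
  apply/eqP; rewrite eqr_div ?iota0 // -!rmorphM -subr_eq0 -rmorphB.
  rewrite resfield_proj_eq0; move: i; apply: (@free_part_free s).
  under eq_bigr => i _ do rewrite scalerBl [_ * b]mulrC -[(b * _) *: _]scalerA
    [a i * _]mulrC -[(_ * a i) *: _]scalerA.
  by rewrite sumrB -!scaler_sumr -hb -hc !scalerA mulrC subrr.
have q1 := prime_ideal1 hq.
exists phi, e; split=> [x y|p x|x|i|x].
- have [xq hx] := hf x; have [yq hy] := hf y.
  rewrite (phiE _ ((f x).1 * (f y).1)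
            (fun i => (f y).1 * (f x).2 i + (f x).1 * (f y).2 i)).
  + apply/rowP => i; rewrite !mxE rmorphD !rmorphM.
    by rewrite addf_div ?iota0 //; congr (_ / _); ring.
  + by rewrite (prime_idealM hq) negb_or xq.
  under eq_bigr do rewrite scalerDl -!scalerA.
  by rewrite big_split -!scaler_sumr /= -hx -hy scalerDr !scalerA [(f y).1 * _]mulrC.
- have [xq hx] := hf x; rewrite (phiE _ (f x).1 (fun i => p * (f x).2 i)) //.
    by apply/rowP => i; rewrite !mxE rmorphM mulrA.
  under eq_bigr do rewrite -scalerA.
  by rewrite -scaler_sumr -hx !scalerA mulrC.
- move=> phi0; have [xq hx] := hf x; apply: (q_tf xq); rewrite hx big1 // => i _.
  apply: q_ann; rewrite -(resfield_proj_eq0 hq); have /rowP/(_ i) := phi0.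
  by rewrite !mxE => /eqP; rewrite mulf_eq0 invr_eq0 (negPf (iota0 _ xq)) orbF.
- rewrite (phiE _ 1 (fun j => (i == j)%:R)) //.
    by apply/rowP => j; rewrite !mxE rmorph1 divr1 rmorph_nat eqxx eq_sym.
  rewrite scale1r (bigD1 i) //= eqxx scale1r big1 ?addr0 // => j.
  by rewrite eq_sym => /negPf ->; rewrite scale0r.
- by have [xq hx] := hf x; exists (f x).1, (f x).2.
Qed.

(** An endomorphism commuting with A extends to F ^ r: after clearing a denominator it is determined
    by its values on the [e i]. Matrices act on rows from the right. *)
Lemma free_part_mx s (phi : V -> 'rV[F]_(size (free_part s)))
    (e : 'I_(size (free_part s)) -> V) (u : V -> V) :
  {morph phi : x y / x + y} -> (forall p x, phi (p *: x) = iota p *: phi x) ->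
  (forall i, phi (e i) = delta_mx 0 i) ->
  (forall x, exists b (a : 'I_(size (free_part s)) -> A),
        b \notin q /\ b *: x = \sum_i a i *: e i) ->
  {morph u : x y / x + y} -> (forall p x, u (p *: x) = p *: u x) ->
  forall x, phi (u x) = phi x *m \matrix_i phi (u (e i)).
Proof.
move=> phiD phiZ phie phi_ex uD uZ x; set M := \matrix_i _.
have [b [a [bq hb]]] := phi_ex x.
have b0 : iota b != 0 by rewrite resfield_proj_eq0.
have sumE (f : V -> 'rV[F]_(size (free_part s))) : {morph f : x y / x + y} ->
    forall (c : 'I_(size (free_part s)) -> V), f (\sum_i c i) = \sum_i f (c i).
  move=> fD c; apply: (big_morph f fD).
  by apply: (addrI (f 0)); rewrite -fD !addr0.
apply: (scalerI b0); rewrite scalemxAl -!phiZ -uZ hb.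
rewrite -[phi (u _)]/((phi \o u) _) (sumE (phi \o u)) => [|y z]; last by rewrite /= uD phiD.
rewrite sumE // mulmx_suml; apply: eq_bigr => i _ /=.
by rewrite uZ !phiZ -scalemxAl phie -rowE rowK.
Qed.
End Rank.

(** * Lower bounds for the size of matrices satisfying Clifford relations *)

(** The operator product of the factors 1 + (-1) ^+ eps j i0 T_j kills every [y i] whose character
    differs from that of [i0], and multiplies [y i0] by a power of 2. *)
Lemma sum_eigenvectors_eq0 (F : fieldType) (V : lmodType F) (I J : finType)
    (T : J -> {linear V -> V}) (y : I -> V) (eps : J -> I -> bool) :
  (2%:R : F) != 0 ->
  (forall j i, T j (y i) = (-1) ^+ eps j i *: y i) ->
  (forall i i', (forall j, eps j i = eps j i') -> i = i') ->
  \sum_i y i = 0 -> forall i, y i = 0.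
Proof.
move=> two_neq0 Ty eps_inj y0 i0.
pose c (js : seq J) i : F := \prod_(j <- js) (1 + (-1) ^+ eps j i0 * (-1) ^+ eps j i).
have c_sum js : \sum_i c js i *: y i = 0.
  elim: js => [|j js IHjs].
    by rewrite -[RHS]y0; apply: eq_bigr => i _; rewrite /c big_nil scale1r.
  transitivity (\sum_i c js i *: y i
                + (-1) ^+ eps j i0 *: T j (\sum_i c js i *: y i)); last first.
    by rewrite IHjs raddf0 scaler0 addr0.
  rewrite raddf_sum scaler_sumr -big_split; apply: eq_bigr => i _ /=.
  rewrite linearZ /= Ty !scalerA -scalerDl /c big_cons; congr (_ *: _); ring.
have := c_sum (enum J); rewrite (bigD1 i0) //= big1 => [|i ii0]; last first.
  have [j ej] : exists j, eps j i0 != eps j i.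
    apply: contrapT => h; case/eqP: ii0; apply: eps_inj => j.
    by apply/eqP; rewrite eq_sym; apply: contrapT => /negP ne; apply: h; exists j.
  suff -> : c (enum J) i = 0 by rewrite scale0r.
  rewrite /c (bigD1_seq j) ?mem_enum ?enum_uniq //=.
  by case: (eps j i0) (eps j i) ej => -[] // _; rewrite ?expr0 ?expr1 ?mulr1 ?mul1r subrr mul0r.
rewrite addr0 => /eqP; rewrite scaler_eq0 => /orP[|/eqP //].
rewrite /c prodf_seq_eq0 => /hasP[j _ /=].
by rewrite -expr2 sqrr_sign (negPf two_neq0).
Qed.

Lemma card_free_le (F : fieldType) (m : nat) (I : finType) (x : I -> 'rV[F]_m) :
  (forall a : I -> F, \sum_i a i *: x i = 0 -> forall i, a i = 0) -> (#|I| <= m)%N.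
Proof.
move=> x_free; pose B := \matrix_(i < #|I|) x (enum_val i).
suff /eqP <- : row_free B by exact: rank_leq_col.
rewrite -kermx_eq0; apply/eqP/row_matrixP => i; rewrite row0.
have : row i (kermx B) *m B = 0 by rewrite -row_mul mulmx_ker row0.
set u := row _ _ => uB; apply/rowP => j; rewrite [RHS]mxE.
rewrite -(enum_valK j); apply: (x_free (fun i => u 0 (enum_rank i))).
rewrite -[RHS]uB mulmx_sum_row (reindex (@enum_rank I)) /=; last first.
  by apply: onW_bij; exact: enum_rank_bij.
by apply: eq_bigr => l _; rewrite rowK enum_rankK.
Qed.

Section CliffordSystem.
Variables (F : fieldType) (d' : nat).
Local Notation d := d'.+1.
Hypothesis two_neq0 : (2%:R : F) != 0.

Section Words.
Variables (n : nat) (v : 'I_n -> 'M[F]_d) (a : 'I_n -> F).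
Hypothesis a_neq0 : forall i, a i != 0.
Hypothesis v_anti : forall i j, i != j -> v i * v j = - (v j * v i).
Hypothesis v_sq : forall i, v i * v i = (a i)%:A.

Definition word (l : seq 'I_n) : 'M[F]_d := \prod_(i <- l) v i.

Lemma word_anti j l :
  v j * word l = (-1) ^+ count (predC1 j) l *: (word l * v j).
Proof.
rewrite /word; elim: l => [|i l IHl].
  by rewrite big_nil mulr1 mul1r scale1r.
rewrite big_cons /= mulrA; case: (eqVneq i j) => [->|ij] /=.
  by rewrite add0n -[in LHS]mulrA [in LHS]IHl -scalerAr mulrA.
by rewrite v_anti 1?eq_sym // mulNr -!mulrA [in LHS]IHl -scalerAr exprD expr1 mulN1r scaleNr.
Qed.

(** The sign is left unspecified; the nonsquare hypotheses used later cover both signs. *)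
Lemma word_sq l : exists e, word l * word l = ((-1) ^+ e * \prod_(i <- l) a i)%:A.
Proof.
rewrite /word; elim: l => [|j l [e IHl]].
  exists 0%N; rewrite !big_nil expr0 !mul1r.
  by rewrite scale1r.
exists (count (predC1 j) l + e)%N; rewrite !big_cons.
have := word_anti j l; rewrite /word; set P := \prod_(i <- l) v i => jP.
have Pj : P * v j = (-1) ^+ count (predC1 j) l *: (v j * P).
  by rewrite jP scalerA -expr2 sqrr_sign scale1r.
rewrite mulrA -(mulrA (v j)) Pj -scalerAr -scalerAl -!mulrA IHl mulrA v_sq.
by rewrite -scalerAl mul1r !scalerA exprD; congr (_ *: _); ring.
Qed.

Lemma word_neq0 l : word l \is a GRing.unit.
Proof.
have [e we] := word_sq l; apply/unitrP.
have p0 : (-1) ^+ e * \prod_(i <- l) a i != 0.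
  rewrite mulf_neq0 ?signr_eq0 // prodf_seq_neq0.
  by apply/allP => i _; rewrite a_neq0.
exists (((-1) ^+ e * \prod_(i <- l) a i)^-1 *: word l).
by rewrite -scalerAl -scalerAr we scalerA mulVf // scale1r.
Qed.

Definition setword (I : {set 'I_n}) : 'M[F]_d := word (enum I).

Lemma odd_count_predC1 j (I : {set 'I_n}) :
  odd (count (predC1 j) (enum I)) = odd #|I| (+) (j \in I).
Proof.
have := count_predC (pred1 j) (enum I); rewrite -cardE count_uniq_mem ?enum_uniq //.
by rewrite mem_enum => <-; rewrite oddD oddb addbAC addbb.
Qed.

(** Conjugation by [v j] fixes the coefficients and multiplies the word of [I] by the sign of
    exponent |I| + [j in I]. For even [n] these characters separate subsets. Coefficients in the
    centralizer, not just scalars, are allowed so that a central z can serve as an extra scalar. *)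
Lemma setwords_free (z : {set 'I_n} -> 'M[F]_d) : ~~ odd n ->
  (forall I j, GRing.comm (z I) (v j)) ->
  \sum_I z I * setword I = 0 -> forall I, z I = 0.
Proof.
move=> n_even zC zs0 I.
suff : z I * setword I = 0 by move/(canRL (mulrK (word_neq0 _))); rewrite mul0r.
(* Conjugation by [v j], whose inverse is [(a j)^-1 *: v j]. *)
pose T0 (j : 'I_n) (X : 'M[F]_d) := (a j)^-1 *: (v j * X * v j).
have T0_lin j : linear (T0 j).
  move=> c X Y; rewrite /T0 mulrDr mulrDl -scalerAr -scalerAl scalerDr.
  by rewrite !scalerA mulrC.
pose T j : {linear 'M[F]_d -> 'M[F]_d} :=
  HB.pack (T0 j) (GRing.isLinear.Build _ _ _ _ (T0 j) (T0_lin j)).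
apply: (@sum_eigenvectors_eq0 _ _ _ _ T (fun I => z I * setword I)
          (fun j I => odd #|I| (+) (j \in I))) => // [j J|J J' h].
  rewrite /= /T0 [v j * _]mulrA -(zC J j) -!mulrA [v j * _]mulrA /setword.
  rewrite word_anti -scalerAl -mulrA v_sq -!scalerAr mulr1 -odd_count_predC1.
  by rewrite signr_odd !scalerA mulrCA mulVf ?mulr1.
apply/setP => j; case: (odd #|J| =P odd #|J'|) => [oJ|oJ].
  by have := h j; rewrite oJ => /addbI.
(* Equal characters with sizes of different parity force complementary subsets, whose sizes add up
   to the even number [n]. *)
have J'E : J' = ~: J.
  apply/setP => i; have := h i; rewrite inE.
  by case: (odd #|J|) (odd #|J'|) oJ => -[] // _; case: (i \in J); case: (i \in J').
case: oJ; rewrite J'E; move: n_even; rewrite -[X in odd X]card_ord -(cardsC J) oddD.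
by case: (odd #|J|); case: (odd _).
Qed.
End Words.

Lemma clifford_dim_even n (v : 'I_n -> 'M[F]_d) (a : 'I_n -> F) :
  ~~ odd n -> (forall i, a i != 0) ->
  (forall i j, i != j -> v i * v j = - (v j * v i)) ->
  (forall i, v i * v i = (a i)%:A) -> (2 ^ n <= d * d)%N.
Proof.
move=> n_even a0 va vs; rewrite -[n in (2 ^ n)%N]card_ord -cardsT -card_powerset.
rewrite powersetT cardsT.
apply: (card_free_le (x := fun I => mxvec (setword v I))) => c hc I.
have /(_ I) : forall I, (c I)%:A = 0 :> 'M[F]_d.
  apply: (setwords_free a0 va vs n_even) => [J j|].
    by rewrite /GRing.comm -scalerAl -scalerAr mul1r mulr1.
  apply: (can_inj mxvecK); rewrite linear0 -[RHS]hc linear_sum.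
  by apply: eq_bigr => J _; rewrite -scalerAl mul1r linearZ.
by move=> /eqP; rewrite scaler_eq0 oner_eq0 orbF => /eqP.
Qed.

(** As [c] is not a square, [z] makes F ^ d a vector space over the field F(z), and the rows of [W]
    are a basis over it. It is found as a largest family for which [W] and [W *m z] are jointly
    independent. *)
Lemma sqrt_free_basis (z : 'M[F]_d) (c : F) : (forall x, x ^+ 2 != c) ->
  z * z = c%:A ->
  exists m (W : 'M[F]_(m, d)), (m + m <= d)%N /\ row_full (col_mx W (W *m z)).
Proof.
move=> c_nsq zz0.
have zz : z *m z = c%:M by rewrite -[LHS]/(z * z) zz0 -scalemx1.
pose Q m := `[< exists W : 'M[F]_(m, d), \rank (col_mx W (W *m z)) = (m + m)%N >].
have Q0 : exists m, Q m.
  exists 0%N; apply/asboolP; exists 0; apply/eqP; rewrite -leqn0.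
  exact: rank_leq_row.
have Qle m : Q m -> (m <= d)%N.
  by move=> /asboolP[W hW]; have := rank_leq_col (col_mx W (W *m z)); lia.
case: (ex_maxnP Q0 Qle) => m /asboolP[W hW] m_max; exists m, W.
split; first by rewrite -hW; exact: rank_leq_col.
set U := col_mx W (W *m z).
have Uz : (U *m z <= U)%MS.
  rewrite /U mul_col_mx -mulmxA zz mul_mx_scalar col_mx_sub.
  apply/andP; split.
    by rewrite -addsmxE addsmxSr.
  by rewrite scalemx_sub // -addsmxE addsmxSl.
apply: contrapT => nfull; have [x xU] : exists x : 'rV_d, ~ (x <= U)%MS.
  apply: contrapT => h; apply: nfull; rewrite -sub1mx; apply/row_subP => i.
  by apply: contrapT => hi; apply: h; exists (row i 1%:M).
pose X := col_mx x (x *m z).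
(* Multiplying by the conjugate [al%:M - be *: z] returns [x] times the norm al ^ 2 - be ^ 2 c,
   which vanishes only for al = be = 0. *)
have XU (al be : F) : ((al *: x + be *: (x *m z))%R <= U)%MS -> al = 0 /\ be = 0.
  move=> h; have : (((al *: x + be *: (x *m z)) *m (al%:M - be *: z))%R <= U)%MS.
    rewrite mulmxBr mul_mx_scalar -scalemxAr; apply: addmx_sub.
      by apply: scalemx_sub.
    rewrite eqmx_opp; apply: scalemx_sub.
    exact: submx_trans (submxMr _ h) Uz.
  have -> : (al *: x + be *: (x *m z)) *m (al%:M - be *: z) = (al ^+ 2 - be ^+ 2 * c) *: x.
    rewrite mulmxBr mul_mx_scalar -scalemxAr mulmxDl -!scalemxAl -mulmxA.
    rewrite zz mul_mx_scalar.
    rewrite !scalerDr !scalerA [X in _ - X]addrC opprD addrACA [al * be]mulrC subrr addr0.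
    by rewrite scalerBl -!expr2.
  case: (eqVneq (al ^+ 2 - be ^+ 2 * c) 0) => [e0 _|e0]; last first.
    by move=> hx; case: xU; rewrite -[x](scalerK e0) scalemx_sub.
  case: (eqVneq be 0) => [b0|b0].
    move: e0; rewrite b0 expr0n mul0r subr0 => /eqP.
    by rewrite sqrf_eq0 => /eqP.
  case/eqP: (c_nsq (al / be)); rewrite expr_div_n.
  have /eqP := e0; rewrite subr_eq0 => /eqP ->.
  by rewrite mulrAC divff ?mul1r // expf_neq0.
have Xrow (u : 'rV[F]_(1 + 1)) : u *m X = u 0 0 *: x + u 0 1 *: (x *m z).
  rewrite mulmx_sum_row big_split_ord !big_ord1 /=; congr (_ *: _ + _ *: _).
  - by congr (u _ _); apply: val_inj.
  - by rewrite rowKu; apply/rowP => i; rewrite mxE ord1.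
  - by congr (u _ _); apply: val_inj.
  - by rewrite rowKd; apply/rowP => i; rewrite mxE ord1.
have u0 (u : 'rV[F]_(1 + 1)) : u 0 0 = 0 -> u 0 1 = 0 -> u = 0.
  move=> h0 h1; apply/rowP => -[[|[|//]] hi]; rewrite [RHS]mxE.
    by rewrite -[RHS]h0; congr (u _ _); apply: val_inj.
  by rewrite -[RHS]h1; congr (u _ _); apply: val_inj.
have Xrank : \rank X = 2%N.
  apply/eqP; rewrite -[_ == _]/(row_free X) -kermx_eq0.
  apply/eqP/row_matrixP => i; rewrite row0.
  have : row i (kermx X) *m X = 0 by rewrite -row_mul mulmx_ker row0.
  rewrite Xrow => h; have [] := XU (row i (kermx X) 0 0) (row i (kermx X) 0 1).
    by rewrite h sub0mx.
  exact: u0.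
have UX : (U :&: X = 0)%MS.
  apply/eqP/rowV0P => y; rewrite sub_capmx => /andP[yU /submxP[u yE]].
  move: yU; rewrite yE Xrow => /XU[h0 h1].
  by rewrite -Xrow (u0 u h0 h1) mul0mx.
have := mxrank_disjoint_sum UX; rewrite hW Xrank => hrank.
have : Q m.+1.
  apply/asboolP; rewrite -addn1; exists (col_mx W x).
  transitivity (\rank (U + X)%MS); last by rewrite hrank; lia.
  apply/eqP; rewrite eqn_leq !mxrankS //.
    rewrite addsmx_sub !col_mx_sub; apply/and3P; split.
    + apply/andP; split; rewrite -addsmxE.
        by apply: submx_trans (addsmxSl _ _); rewrite -addsmxE addsmxSl.
      by apply: submx_trans (addsmxSr _ _); rewrite mul_col_mx -addsmxE addsmxSl.
    + by rewrite -addsmxE; apply: submx_trans (addsmxSl _ _); rewrite -addsmxE addsmxSr.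
    rewrite -addsmxE; apply: submx_trans (addsmxSr _ _).
    by rewrite mul_col_mx -addsmxE addsmxSr.
  rewrite !col_mx_sub mul_col_mx col_mx_sub -!andbA; apply/and4P; split.
  + by apply: submx_trans (addsmxSl _ _); rewrite -addsmxE addsmxSl.
  + by apply: submx_trans (addsmxSr _ _); rewrite -addsmxE addsmxSl.
  + by apply: submx_trans (addsmxSl _ _); rewrite -addsmxE addsmxSr.
  by apply: submx_trans (addsmxSr _ _); rewrite -addsmxE addsmxSr.
by move=> /m_max; rewrite ltnn.
Qed.
End CliffordSystem.

Section CliffordBound.
Variables (F : fieldType).
Hypothesis two_neq0 : (2%:R : F) != 0.

(* The span of the given products lies in the centralizer of z, which embeds   *)
(* into Hom(W, F ^ d) for a subspace W with W + W z = F ^ d.                    *)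
Lemma clifford_dim_odd d' k (v : 'I_k -> 'M[F]_d'.+1) (a : 'I_k -> F) :
  odd k -> (forall i, a i != 0) ->
  (forall i j, i != j -> v i * v j = - (v j * v i)) ->
  (forall i, v i * v i = (a i)%:A) ->
  (forall e x, x ^+ 2 != (-1) ^+ e * \prod_i a i) -> (2 ^ k.+1 <= d'.+1 * d'.+1)%N.
Proof.
case: k v a => [//|n] v a /= n_even a0 va vs nsq; set d := d'.+1.
pose z := setword v [set: 'I_n.+1].
have zC j : GRing.comm z (v j).
  rewrite /GRing.comm [RHS](word_anti va) -signr_odd odd_count_predC1.
  by rewrite cardsT card_ord inE addbT /= negbK (negPf n_even) expr0 scale1r.
have [e zz] : exists e, z * z = ((-1) ^+ e * \prod_(i <- enum [set: 'I_n.+1]) a i)%:A.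
  exact: word_sq va vs _.
have prodE : \prod_(i <- enum [set: 'I_n.+1]) a i = \prod_i a i.
  by rewrite big_enum /=; apply: eq_bigl => i; rewrite inE.
rewrite prodE in zz; set c := (-1) ^+ e * _ in zz.
have [m [W [mW Wfull]]] := sqrt_free_basis two_neq0 (nsq e) zz.
(* Dropping one generator leaves an even number, so the words in the others are independent over the
   commuting scalars F + F z. *)
pose u i := v (lift ord_max i); pose b i := a (lift ord_max i).
have b0 i : b i != 0 by exact: a0.
have ua i j : i != j -> u i * u j = - (u j * u i).
  by move=> ij; apply: va; rewrite (inj_eq lift_inj).
have us i : u i * u i = (b i)%:A by exact: vs.
have zw I : GRing.comm z (setword u I) by apply: commr_prod => i _; exact: zC.
pose x (t : {set 'I_n} * bool) := (if t.2 then z else 1) * setword u t.1.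
have xz t : GRing.comm z (x t).
  by apply: commrM => //; case: t.2 => //; exact: commr1.
have : (#|[the finType of ({set 'I_n} * bool)%type]| <= m * d)%N.
  apply: (card_free_le (x := fun t => mxvec (W *m x t))) => f hf.
  have : \sum_I ((f (I, false))%:A + f (I, true) *: z) * setword u I = 0.
    have -> : \sum_I ((f (I, false))%:A + f (I, true) *: z) * setword u I = \sum_t f t *: x t.
      transitivity (\sum_I \sum_b f (I, b) *: x (I, b)); last first.
        by rewrite pair_bigA; apply: eq_bigr => -[].
      apply: eq_bigr => I _; rewrite big_bool /x /= mulrDl addrC.
      by rewrite -!scalerAl.
    set Y := \sum_t _.
    have WY : W *m Y = 0.
      apply: (can_inj mxvecK); rewrite linear0 -[RHS]hf mulmx_sumr linear_sum.
      by apply: eq_bigr => t _; rewrite -scalemxAr linearZ.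
    (* Commuting with [z], a [Y] that vanishes on [W] also vanishes on [W *m z], hence
       everywhere. *)
    have Yz : z * Y = Y * z.
      apply: commr_sum => t _; rewrite /GRing.comm -scalerAr -scalerAl.
      by congr (_ *: _); exact: xz.
    have UY : col_mx W (W *m z) *m Y = 0.
      rewrite mul_col_mx WY -mulmxA -[z *m Y]/(z * Y) Yz -[Y * z]/(Y *m z).
      by rewrite mulmxA WY mul0mx col_mx0.
    by rewrite -[Y]mul1mx -(mulVpmx Wfull) -mulmxA UY mulmx0.
  have fC I j : GRing.comm ((f (I, false))%:A + f (I, true) *: z) (u j).
    apply/commr_sym/commrD.
      by rewrite /GRing.comm -scalerAl -scalerAr mul1r mulr1.
    by rewrite /GRing.comm -scalerAl -scalerAr; congr (_ *: _); exact/commr_sym/zC.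
  move=> /(setwords_free two_neq0 b0 ua us n_even fC) f0.
  (* Otherwise [z] would be a scalar whose square is [c]. *)
  have f1 I : f (I, true) = 0.
    apply/eqP; apply: contraT => f10; have := f0 I.
    move=> /eqP; rewrite addr_eq0 -scaleNr => /eqP h.
    have zE : z = (f (I, false) / - f (I, true))%:A.
      by rewrite mulrC -scalerA h scalerA mulVf ?oppr_eq0 // scale1r.
    move: zz; rewrite zE -scalerAl mul1r scalerA -expr2 => /eqP.
    rewrite -subr_eq0 -scalerBl scaler_eq0 oner_eq0 orbF subr_eq0.
    by rewrite (negPf (nsq _ _)).
  case=> I [] //; have := f0 I; rewrite f1 scale0r addr0 => /eqP.
  by rewrite scaler_eq0 oner_eq0 orbF => /eqP.
rewrite card_prod card_bool -cardsT -powersetT card_powerset cardsT card_ord.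
have : (0 < d)%N by [].
rewrite !expnS; move: mW; rewrite -/d; move: (2 ^ n)%N => N; nia.
Qed.

(** Polarization in characteristic other than 2 yields a vector [x] with nonzero norm; the form
    splits along [x] and its orthogonal complement, the kernel of [c]. *)
Lemma sym_diagonalize k (H : 'M[F]_k) : H^T = H -> H \in unitmx ->
  exists (P : 'M[F]_k) (a : 'rV[F]_k), P \in unitmx /\ P *m H *m P^T = diag_mx a.
Proof.
elim: k H => [|k IHk] H H_sym H_unit.
  by exists 1%:M, 0; rewrite unitmx1; split=> //; apply/matrixP => -[].
have [x x0] : exists x : 'rV_k.+1, (x *m H *m x^T) 0 0 != 0.
  apply: contrapT => nx.
  have q0 (x : 'rV_k.+1) : x *m H *m x^T = 0.
    apply/rowP => i; rewrite ord1 [RHS]mxE; apply/eqP.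
    by apply: contrapT => /negP h; apply: nx; exists x.
  have b0 (x y : 'rV_k.+1) : x *m H *m y^T = 0.
    have := q0 (x + y); rewrite linearD /= !mulmxDl !mulmxDr !q0 addr0 add0r.
    have -> : y *m H *m x^T = x *m H *m y^T.
      transitivity (x *m H *m y^T)^T; first by rewrite !trmx_mul trmxK H_sym mulmxA.
      by rewrite [X in X^T]mx11_scalar tr_scalar_mx -mx11_scalar.
    rewrite -mulr2n -scaler_nat => /eqP; rewrite scaler_eq0 (negPf two_neq0).
    by move=> /eqP.
  have H0 : H = 0.
    apply/matrixP => i j; have /matrixP/(_ 0 0) := b0 (delta_mx 0 i) (delta_mx 0 j).
    by rewrite trmx_delta -rowE -colE !mxE.
  by move: H_unit; rewrite H0 unitmxE det0 unitr0.
pose c := H *m x^T; have xc : x *m c = ((x *m H *m x^T) 0 0)%:M.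
  by rewrite /c mulmxA; exact: mx11_scalar.
have c_rank : \rank c = 1%N.
  apply/eqP; rewrite eqn_leq rank_leq_col lt0n mxrank_eq0.
  apply: contraNneq x0 => c0; move: xc; rewrite c0 mulmx0 => /matrixP/(_ 0 0).
  by rewrite !mxE eqxx mulr1n => <-.
have : exists Q : 'M_(\rank (kermx c), k.+1), row_free Q /\ Q *m c = 0.
  exists (row_base (kermx c)); split; first exact: row_base_free.
  by apply/sub_kermxP; rewrite eq_row_base.
rewrite mxrank_ker c_rank subSS subn0 => -[Q [Q_free Qc]].
set a := (x *m H *m x^T) 0 0 in x0 xc.
pose P1 : 'M_(1 + k, k.+1) := col_mx x Q.
have P1_free : row_free P1.
  rewrite -kermx_eq0; apply/eqP/row_matrixP => i; rewrite row0.
  have : row i (kermx P1) *m P1 = 0 by rewrite -row_mul mulmx_ker row0.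
  set u := row _ _ => uP; rewrite -[u]hsubmxK in uP *.
  rewrite mul_row_col in uP; have := congr1 (mulmx^~ c) uP.
  rewrite mulmxDl mul0mx -!mulmxA Qc mulmx0 addr0 xc mul_mx_scalar => /eqP.
  rewrite scaler_eq0 (negPf x0) => /eqP u0; move: uP.
  rewrite u0 mul0mx add0r -[RHS](mul0mx _ Q) => /(row_free_inj Q_free) ->.
  by rewrite row_mx0.
have P1_unit : (P1 : 'M_k.+1) \in unitmx by rewrite -row_free_unit.
have QH : x *m H *m Q^T = 0.
  by apply: trmx_inj; rewrite !trmx_mul trmxK H_sym trmx0 -/c Qc.
have P1E : P1 *m H *m P1^T = block_mx a%:M 0 0 (Q *m H *m Q^T) :> 'M_(1 + k).
  rewrite mul_col_mx tr_col_mx mul_col_row QH -[Q *m H *m x^T]mulmxA -/c Qc.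
  by rewrite -mulmxA -/c xc.
have H1_sym : (Q *m H *m Q^T)^T = Q *m H *m Q^T by rewrite !trmx_mul trmxK H_sym mulmxA.
have H1_unit : Q *m H *m Q^T \in unitmx.
  have : (P1 *m H *m P1^T : 'M_k.+1) \in unitmx.
    by rewrite !unitmx_mul unitmx_tr P1_unit H_unit.
  rewrite P1E unitmxE -[k.+1]/(1 + k)%N det_ublock det_scalar1 unitfE.
  by rewrite mulf_eq0 negb_or unitmxE unitfE => /andP[].
have [P' [a' [P'_unit P'E]]] := IHk _ H1_sym H1_unit.
pose P2 : 'M_(1 + k) := block_mx 1%:M 0 0 P'.
exists (P2 *m P1 : 'M_k.+1), (row_mx a%:M a' : 'rV_(1 + k)); split.
  rewrite unitmx_mul P1_unit andbT unitmxE -[k.+1]/(1 + k)%N det_ublock.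
  by rewrite det1 mul1r -unitmxE.
transitivity (P2 *m (P1 *m H *m P1^T) *m P2^T).
  by rewrite trmx_mul !mulmxA.
rewrite P1E /P2 tr_block_mx !mulmx_block !trmx0 trmx1.
rewrite !(mul0mx, mulmx0, addr0, add0r, mul1mx, mulmx1) P'E.
have aE : a%:M = diag_mx (a%:M : 'rV_1) by apply/matrixP => i j; rewrite !ord1 !mxE.
rewrite [X in block_mx X]aE; apply/esym.
refine (@diag_mx_row _ k 1%N (a%:M) a').
Qed.

(** A congruence [P] turns the generators into anticommuting [v i] with squares [a 0 i / 2]. The
    even and odd cases then compare squares of 2 ^ ((k + 1) %/ 2) and [d'.+1]. *)
Lemma clifford_dim_bound d' k (H : 'M[F]_k) (E : 'I_k -> 'M[F]_d'.+1) :
  H^T = H -> H \in unitmx ->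
  (forall i j, E i * E j + E j * E i = (H i j)%:A) ->
  (odd k -> forall e x, x ^+ 2 != (-1) ^+ e * 2%:R ^+ k * \det H) ->
  (2 ^ ((k + 1) %/ 2) <= d'.+1)%N.
Proof.
move=> H_sym H_unit EE nsq.
have [P [a [P_unit PE]]] := sym_diagonalize H_sym H_unit.
have detE : \det P ^+ 2 * \det H = \prod_i a 0 i.
  by rewrite -det_diag -PE !det_mulmx det_tr expr2 mulrAC.
have detP : \det P != 0 by rewrite -unitfE -unitmxE.
have detH : \det H != 0 by rewrite -unitfE -unitmxE.
have a0 i : a 0 i != 0.
  have : \prod_i a 0 i != 0 by rewrite -detE mulf_neq0 // expf_neq0.
  by move=> /prodf_neq0/(_ i isT).
pose v i := \sum_j P i j *: E j.
have vv i j : v i * v j + v j * v i = (diag_mx a i j)%:A.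
  rewrite -PE /v !mulr_suml; under eq_bigr do rewrite mulr_sumr.
  under [X in _ + X]eq_bigr do rewrite mulr_sumr.
  rewrite [X in _ + X]exchange_big -big_split /= !mxE scaler_suml.
  under [RHS]eq_bigr do rewrite mxE mulr_suml scaler_suml.
  rewrite [RHS]exchange_big; apply: eq_bigr => l _ /=.
  rewrite -big_split; apply: eq_bigr => m _ /=; rewrite mxE.
  rewrite -!scalerAl -!scalerAr !scalerA [P j m * _]mulrC -scalerDr EE scalerA.
  by rewrite mulrAC.
have v_anti i j : i != j -> v i * v j = - (v j * v i).
  move=> ij; apply/eqP; rewrite -addr_eq0 vv mxE (negPf ij) mulr0n.
  by rewrite scale0r.
have v_sq i : v i * v i = (a 0 i / 2%:R)%:A.
  apply: (scalerI two_neq0); rewrite scalerA [_ * (_ / _)]mulrC divfK //.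
  by rewrite scaler_nat mulr2n vv mxE eqxx mulr1n.
have b0 i : a 0 i / 2%:R != 0 by rewrite mulf_neq0 ?invr_eq0.
case: (boolP (odd k)) => k_odd; last first.
  have := clifford_dim_even two_neq0 k_odd b0 v_anti v_sq.
  have -> : ((k + 1) %/ 2 = k./2)%N by have := odd_double_half k; rewrite (negPf k_odd); lia.
  rewrite -{1}(odd_double_half k) (negPf k_odd) add0n -addnn expnD.
  by move: (2 ^ _)%N d'.+1; nia.
have := clifford_dim_odd k_odd b0 v_anti v_sq.
have -> : ((k + 1) %/ 2 = k./2.+1)%N.
  by have := odd_double_half k; rewrite k_odd; lia.
have -> : k.+1 = (k./2.+1 + k./2.+1)%N.
  by have := odd_double_half k; rewrite k_odd; lia.
rewrite expnD.
move=> h; suff : (2 ^ k./2.+1 * 2 ^ k./2.+1 <= d'.+1 * d'.+1)%N.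
  by move: (2 ^ _)%N d'.+1; nia.
apply: h => e x; apply/eqP => hx.
(* The product of the [a 0 i / 2] is det P ^ 2 det H / 2 ^ k, so a square root of it rescales by 2 ^
   k / det P to one of 2 ^ k det H, up to the common sign. *)
have /eqP[] := nsq k_odd e (2%:R ^+ k * x / \det P).
rewrite big_split /= prodr_const card_ord -detE exprVn in hx.
rewrite expr_div_n exprMn hx; field.
by rewrite detP expf_neq0.
Qed.
End CliffordBound.

(** * Simple Clifford modules from irreducible systems of matrices *)

(** A matrix of maximal rank with row space inside [P] exhausts [P], since a missing vector would
    raise the rank. This turns the bare sets of [simple_module] into row spaces. *)
Lemma linear_set_mx (F : fieldType) d (P : set 'rV[F]_d) : P 0 ->
  (forall a x y, P x -> P y -> P (a *: x + y)) ->
  exists W : 'M[F]_d, forall u, P u <-> (u <= W)%MS.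
Proof.
move=> P0 P_lin.
pose Q r := `[< exists W : 'M[F]_d, \rank W = r /\ forall u, (u <= W)%MS -> P u >].
have Q0 : exists r, Q r.
  exists 0%N; apply/asboolP; exists 0; rewrite mxrank0; split=> // u.
  by rewrite submx0 => /eqP ->.
have Qle r : Q r -> (r <= d)%N by move=> /asboolP[W [<- _]]; exact: rank_leq_col.
case: (ex_maxnP Q0 Qle) => r /asboolP[W [Wr WP]] r_max; exists W => u.
split=> [Pu|]; last exact: WP; apply: contraT => nu.
have : Q (\rank (W + u)%MS).
  apply/asboolP; exists (W + u)%MS; split=> // y /sub_addsmxP[[a b] /= ->].
  rewrite [b]mx11_scalar mul_scalar_mx addrC; apply: P_lin => //.
  by apply: WP; exact: submxMl.
move=> /r_max; rewrite -Wr leqNgt => /negP[].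
have : (W < W + u)%MS by rewrite ltmxE addsmxSl addsmx_sub submx_refl /= nu.
by rewrite ltmxErank => /andP[].
Qed.

Section RMorphRelations.
Variables (A B : pzRingType) (f : {rmorphism A -> B}).

Lemma rmorph_lin_rel a x y z : f (z - (a * x + y)) = f z - (f a * f x + f y).
Proof. by rewrite rmorphB rmorphD rmorphM. Qed.

Lemma rmorph_anti_rel x y z :
  f (x * y + y * x - z) = f x * f y + f y * f x - f z.
Proof. by rewrite rmorphB rmorphD !rmorphM. Qed.
End RMorphRelations.

Section QuotientLift.
Variables (A B : pzRingType) (I : ideal2 A) (f : {rmorphism A -> B}).
Hypothesis f_ker : forall x, I x -> f x = 0.

Definition quot2_lift (u : quot2 I) : B :=
  f (xget 0 [set x | u = qproj I x]).

Lemma quot2_liftE x : quot2_lift (qproj I x) = f x.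
Proof.
rewrite /quot2_lift; case: xgetP => [y _ /= /qproj_eq/f_ker|/(_ x) h]; last by case: h.
by rewrite rmorphB => /eqP; rewrite subr_eq0 => /eqP.
Qed.

Fact quot2_lift_zmod : zmod_morphism quot2_lift.
Proof.
move=> u v; have [x ->] := qproj_surj u; have [y ->] := qproj_surj v.
by rewrite -rmorphB !quot2_liftE rmorphB.
Qed.

Fact quot2_lift_monoid : monoid_morphism quot2_lift.
Proof.
split=> [|u v]; first by rewrite -(rmorph1 (qproj I)) quot2_liftE rmorph1.
have [x ->] := qproj_surj u; have [y ->] := qproj_surj v.
by rewrite -rmorphM !quot2_liftE rmorphM.
Qed.

Lemma quot2_lift_rmorph :
  exists h : {rmorphism quot2 I -> B}, forall x, h (qproj I x) = f x.
Proof.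
pose h : {rmorphism quot2 I -> B} := HB.pack quot2_lift
  (GRing.isZmodMorphism.Build _ _ _ quot2_lift_zmod)
  (GRing.isMonoidMorphism.Build _ _ _ quot2_lift_monoid).
by exists h; exact: quot2_liftE.
Qed.
End QuotientLift.

Section FreeAlgEval.
Variables (F : fieldType) (X : choiceType) (d : nat) (G : X -> 'M[F]_d.+1).

Definition monom_eval (m : monalg.fmonom X) : 'M[F]_d.+1 :=
  \prod_(x <- monalg.fmonom_val m) G x.

Fact monom_eval_mmorphism : @monalg.mmorphism (monalg.fmonom X) 'M[F]_d.+1 monom_eval.
Proof.
split=> [m m'|]; first by rewrite /monom_eval monalg.fmM big_cat.
by rewrite /monom_eval monalg.fm1 big_nil.
Qed.

HB.instance Definition _ :=
  monalg.isMultiplicative.Build (monalg.fmonom X) 'M[F]_d.+1 monom_eval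
    monom_eval_mmorphism.

Definition free_eval : free_alg F X -> 'M[F]_d.+1 :=
  monalg.mmap (@scalar_mx F d.+1) monom_eval.

Fact free_eval_zmod : zmod_morphism free_eval.
Proof. exact: monalg.mmap_is_additive. Qed.

Fact free_eval_monoid : monoid_morphism free_eval.
Proof.
have [hM h1] : multiplicative free_eval.
  apply: monalg.commr_mmap_is_multiplicative => g m m'.
  exact/esym/scalar_mxC.
by [].
Qed.

HB.instance Definition _ :=
  GRing.isZmodMorphism.Build (free_alg F X) 'M[F]_d.+1 free_eval free_eval_zmod.
HB.instance Definition _ :=
  GRing.isMonoidMorphism.Build (free_alg F X) 'M[F]_d.+1 free_eval free_eval_monoid.

Lemma free_eval_gen x : free_eval (free_gen F x) = G x.
Proof.
rewrite /free_eval /free_gen monalg.mmapU /= mul1r.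
by rewrite /monom_eval monalg.fmU big_seq1.
Qed.

Lemma free_eval_scal c : free_eval (free_scal F X c) = c%:M.
Proof.
rewrite /free_eval /free_scal /= monalg.mmapU /monom_eval monalg.fm1 big_nil.
by rewrite mulr1.
Qed.
End FreeAlgEval.

Definition row_module (F : fieldType) (d : nat) : Type := 'rV[F]_d.+1.

Section RowModule.
Variables (F : fieldType) (d : nat).
HB.instance Definition _ := GRing.Zmodule.on (row_module F d).

(* The transpose turns the right action of matrices on rows into a left one.   *)
Definition row_scale (a : 'M[F]_d.+1) (x : row_module F d) : row_module F d :=
  (x : 'rV_d.+1) *m a^T.

Fact row_scaleA a b x : row_scale a (row_scale b x) = row_scale (a * b) x.
Proof. by rewrite /row_scale -mulmxA -trmx_mul. Qed.
Fact row_scale1 : left_id 1 row_scale.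
Proof. by move=> x; rewrite /row_scale trmx1 mulmx1. Qed.
Fact row_scaleDr : right_distributive row_scale +%R.
Proof. by move=> a x y; rewrite /row_scale -mulmxDl. Qed.
Fact row_scaleDl x : {morph row_scale^~ x : a b / a + b >-> a + b}.
Proof. by move=> a b; rewrite /row_scale linearD /= mulmxDr. Qed.

HB.instance Definition _ := GRing.Zmodule_isLmodule.Build 'M[F]_d.+1
  (row_module F d) row_scaleA row_scale1 row_scaleDr row_scaleDl.
End RowModule.

(** Transposing the matrices reverses products, and the Clifford relation is symmetric under
    reversal, so they define a left module on row vectors. Its submodules are row spaces stable
    under every [E x]. *)
Lemma clifford_simple_module (F : fieldType) (V : lmodType F) (B : V -> V -> F)
    d (E : V -> 'M[F]_d.+1) :
  linear E -> (forall x y, E x * E y + E y * E x = (B x y)%:M) ->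
  (forall W : 'M[F]_d.+1, W != 0 -> (forall x, (W *m E x <= W)%MS) -> row_full W) ->
  exists L : lmodType (clifford B), simple_module L /\
    @has_dim F (restr (clifford_scal B) L) setT d.+1.
Proof.
move=> E_lin E_cliff E_irr.
pose G x := (E x)^T.
pose ev : {rmorphism free_alg F V -> 'M[F]_d.+1} := free_eval G.
have ev_gen x : ev (free_gen F x) = G x by exact: free_eval_gen.
have ev_scal c : ev (free_scal F V c) = c%:M by exact: free_eval_scal.
have ker t : ideal2_gen (clifford_rel B) t -> ev t = 0.
  have J0 : ev 0 = 0 by exact: rmorph0.
  have JB x y : ev x = 0 -> ev y = 0 -> ev (x - y) = 0.
    by move=> hx hy; rewrite rmorphB hx hy subrr.
  have JMl a x : ev x = 0 -> ev (a * x) = 0.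
    by move=> hx; rewrite rmorphM hx mulr0.
  have JMr a x : ev x = 0 -> ev (x * a) = 0.
    by move=> hx; rewrite rmorphM hx mul0r.
  move=> /(_ (Ideal2 J0 JB JMl JMr)); apply => _ [c x y|x y] /=.
    apply: etrans (rmorph_lin_rel ev _ _ _ _) _; rewrite !ev_gen ev_scal /G.
    by rewrite E_lin linearP /= -[_%:M * _]/(_%:M *m _) mul_scalar_mx subrr.
  have GM u v : G u * G v = (E v * E u)^T by apply/esym/trmx_mul.
  apply: etrans (rmorph_anti_rel ev _ _ _) _; rewrite !ev_gen ev_scal !GM.
  by rewrite -linearD /= [E y * _ + _]addrC E_cliff tr_scalar_mx subrr.
have [Gam GamE] := quot2_lift_rmorph ker.
have Gam_in x : Gam (clifford_in B x) = G x by rewrite -ev_gen -GamE.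
have Gam_scal c : Gam (clifford_scal B c) = c%:M by rewrite -ev_scal -GamE.
pose L : lmodType (clifford B) := restr Gam (row_module F d).
have scaleE c (x : L) : clifford_scal B c *: x = c *: (x : 'rV[F]_d.+1) :> 'rV_d.+1.
  by rewrite restrE Gam_scal -[LHS]/(_ *m _) tr_scalar_mx mul_mx_scalar.
have inE x (y : L) : clifford_in B x *: y = (y : 'rV[F]_d.+1) *m E x :> 'rV_d.+1.
  by rewrite restrE Gam_in -[LHS]/(_ *m _) trmxK.
exists L; split; first split.
- exists (delta_mx 0 0 : 'rV[F]_d.+1) => /matrixP/(_ 0 0)/eqP.
  by rewrite !mxE !eqxx oner_eq0.
- move=> P P0 P_lin.
  have P_lin' (a : F) (x y : 'rV[F]_d.+1) : P x -> P y -> P (a *: x + y).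
    by move=> Px Py; have := P_lin (clifford_scal B a) _ _ Px Py; rewrite scaleE.
  have [W PW] := linear_set_mx P0 P_lin'.
  case: (eqVneq W 0) => [W0|W0].
    by left=> x /PW; rewrite W0 submx0 => /eqP.
  right=> x; apply/PW/submx_full/E_irr => // y.
  apply/row_subP => i; rewrite row_mul; apply/PW.
  have := P_lin (clifford_in B y) _ _ ((PW _).2 (row_sub i W)) P0.
  by rewrite inE addr0.
have sumE (c : 'I_d.+1 -> F) :
    \sum_i c i *: (delta_mx 0 i : restr (clifford_scal B) L) = \row_i c i :> 'rV_d.+1.
  rewrite [RHS]row_sum_delta; apply: eq_bigr => i _; rewrite mxE.
  exact: scaleE.
exists (fun i => delta_mx 0 i : 'rV[F]_d.+1); split=> [x|c].
  split=> // _; exists (fun i => (x : 'rV[F]_d.+1) 0 i).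
  by rewrite sumE; apply/rowP => i; rewrite mxE.
by rewrite sumE => /rowP h i; have := h i; rewrite !mxE.
Qed.

(** * The action of the odd generators over S(g_0) *)

Section OddGenerators.
Variables (K : fieldType) (g : lieSuperalgebra K).
Local Notation g0 := (lie_part g false).
Local Notation g1 := (lie_part g true).
Local Notation A := {mpoly K[\dim g0]}.
Variables (N : lmodType (gr_env g)).

Lemma gr_symC p (a : gr_env g) : GRing.comm a (gr_sym g p).
Proof.
rewrite /gr_sym /= /gr_sym_fun /mmap; apply: commr_sum => m _.
apply: commrM; first exact: gr_scalC.
by apply: commr_prod => i _; apply/commrX/gr_evenC.
Qed.

Definition sym_module : lmodType A := restr (gr_sym g) N.

Lemma sym_moduleE p (x : N) : p *: (x : sym_module) = gr_sym g p *: x.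
Proof. by []. Qed.

Lemma scale_symC p (a : gr_env g) (x : N) :
  a *: (p *: (x : sym_module) : N) = p *: (a *: x : sym_module).
Proof. by rewrite !sym_moduleE !scalerA gr_symC. Qed.

Fact mem_vbasis1 (i : 'I_(\dim g1)) : (vbasis g1)`_i \in g1.
Proof. by apply/vbasis_mem/mem_nth; rewrite size_tuple. Qed.

Definition odd_gen i : gr_env g := gr_odd (mem_vbasis1 i).

Lemma odd_gen_anti i j (x : N) : odd_gen i *: (odd_gen j *: x) =
  sym_in (lie_br (vbasis g1)`_i (vbasis g1)`_j) *: (x : sym_module)
  - odd_gen j *: (odd_gen i *: x).
Proof.
by rewrite sym_moduleE -(gr_oddD_br (mem_vbasis1 i) (mem_vbasis1 j)) !scalerA
  scalerDl addrK.
Qed.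

Lemma odd_gen_sq (two_neq0 : (2%:R : K) != 0) i (x : N) :
  odd_gen i *: (odd_gen i *: x) =
  ((2%:R^-1)%:MP * sym_in (lie_br (vbasis g1)`_i (vbasis g1)`_i) : A)
    *: (x : sym_module).
Proof.
set y : sym_module := odd_gen i *: _.
have : y + y = sym_in (lie_br (vbasis g1)`_i (vbasis g1)`_i) *: (x : sym_module).
  by rewrite {1}/y odd_gen_anti subrK.
rewrite -scalerA => <-; rewrite -mulr2n -scaler_nat scalerA.
by rewrite -(rmorph_nat (@mpolyC (\dim g0) K)) -rmorphM /= mulVf // scale1r.
Qed.

(* Odd generators anticommute up to S(g_0), so over S(g_0) the products of     *)
(* distinct ones, taken in a fixed order, suffice.                            *)
Fixpoint odd_gens (hs : seq (nat * sym_module)) (l : seq 'I_(\dim g1)) :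
    seq (nat * sym_module) :=
  if l is j :: l' then
    let t := odd_gens hs l' in
    t ++ [seq (dx.1.+1, (odd_gen j *: (dx.2 : N) : sym_module)) | dx <- t]
  else hs.

Lemma gen_span_cat (t1 t2 : seq (nat * sym_module)) y : gen_span (t1 ++ t2) y <->
  exists y1 y2, [/\ gen_span t1 y1, gen_span t2 y2 & y = y1 + y2].
Proof.
elim: t1 y => [|[d x] t1 IHt1] y /=.
  split=> [hy|[y1 [y2 [-> hy2 ->]]]]; last by rewrite add0r.
  by exists 0, y; rewrite add0r.
split=> [[p /IHt1[y1 [y2 [h1 h2 hy]]]]|[y1 [y2 [[p h1] h2 ->]]]].
  exists (y1 + p *: x), y2; split=> //; first by exists p; rewrite addrK.
  by rewrite addrAC -hy subrK.
exists p; apply/IHt1; exists (y1 - p *: x), y2; split=> //.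
by rewrite addrAC.
Qed.

Lemma gen_span_map_odd j (t : seq (nat * sym_module)) (y : sym_module) :
  gen_span [seq (dx.1.+1, (odd_gen j *: (dx.2 : N) : sym_module)) | dx <- t] y <->
  exists2 z, gen_span t z & y = odd_gen j *: (z : N).
Proof.
elim: t y => [|[d x] t IHt] y /=.
  by split=> [->|[z -> ->]]; [exists 0|]; rewrite ?[odd_gen j *: _]scaler0 ?scaler0.
split=> [[p /IHt[z hz hy]]|[z [p hz] ->]].
  exists (z + p *: x); first by exists p; rewrite addrK.
  rewrite [odd_gen j *: _]scalerDr -[X in X + _]hy scale_symC.
  exact: esym (subrK _ _).
exists p; apply/IHt; exists (z - p *: x) => //.
rewrite [RHS]scalerBr scale_symC //.
Qed.

Lemma odd_gens_cons hs j l (y : sym_module) :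
  gen_span (odd_gens hs (j :: l)) y <-> exists y1 y2 : sym_module,
    [/\ gen_span (odd_gens hs l) y1, gen_span (odd_gens hs l) y2 &
        y = y1 + (odd_gen j *: (y2 : N))].
Proof.
split=> [/gen_span_cat[y1 [_ [h1 /gen_span_map_odd[y2 h2 ->] ->]]]|].
  by exists y1, y2.
move=> [y1 [y2 [h1 h2 ->]]]; apply/gen_span_cat.
exists y1, (odd_gen j *: (y2 : N)); split=> //.
by apply/gen_span_map_odd; exists y2.
Qed.

(** An element of the span for [j :: l] is y1 + u_j y2. Acting by u_j exchanges the two terms, since
    u_j ^ 2 comes from S(g_0); another u_i moves past u_j at the cost of a bracket in S(g_0), and
    induction applies to u_i y1 and u_i y2. *)
Lemma odd_gens_stable (two_neq0 : (2%:R : K) != 0) hs l i (y : sym_module) :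
  i \in l -> gen_span (odd_gens hs l) y ->
  gen_span (odd_gens hs l) (odd_gen i *: (y : N)).
Proof.
elim: l y => // j l IHl y; rewrite inE => ijl.
move=> /odd_gens_cons[y1 [y2 [h1 h2 ->]]]; apply/odd_gens_cons.
case: (eqVneq i j) ijl => [-> _|ij il].
  eexists; exists y1; split; last first.
  - by rewrite [odd_gen j *: _]scalerDr odd_gen_sq // addrC.
  - exact: h1.
  exact: gen_spanZ.
exists (odd_gen i *: (y1 : N)
        + sym_in (lie_br (vbasis g1)`_i (vbasis g1)`_j) *: y2).
exists (- (odd_gen i *: (y2 : N))); split.
- by apply: gen_spanD; [exact: IHl|exact: gen_spanZ].
- have := gen_spanB (gen_span0 (odd_gens hs l)) (IHl y2 il h2).
  by rewrite sub0r.
rewrite [LHS]scalerDr odd_gen_anti [odd_gen j *: (- _ : N)]scalerN.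
exact: addrA.
Qed.

Lemma odd_gens_sub hs l y : gen_span hs y -> gen_span (odd_gens hs l) y.
Proof.
move=> hy; elim: l => // j l IHl; apply/odd_gens_cons; exists y, 0; split=> //.
  exact: gen_span0.
by rewrite [odd_gen j *: _]scaler0 addr0.
Qed.
End OddGenerators.

(** * Homogeneous generators over S(g_0) *)

Section HomogeneousGenerators.
Variables (K : fieldType) (g : lieSuperalgebra K).
Local Notation g0 := (lie_part g false).
Local Notation g1 := (lie_part g true).
Local Notation A := {mpoly K[\dim g0]}.
Variables (N : lmodType (gr_env g)) (D : nat -> set N).
Hypothesis N_graded : is_graded_module D.
Local Notation V := (sym_module N).

Local Notation DV := (D : nat -> set V).

Let D_grading : is_grading D := N_graded.1.

Lemma sym_module_grading : @is_grading V D. Proof. exact: D_grading. Qed.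

Lemma gr_part_scale n a m (x : N) : gr_part n a -> D m x -> D (m + n)%N (a *: x).
Proof. by rewrite addnC; exact: N_graded.2. Qed.

Lemma gr_part_odd_gen i : gr_part 1 (odd_gen i : gr_env g).
Proof. by eexists; eexists. Qed.

Lemma sym_scale_graded e m (p : A) (x : V) : (p : A) \is e.-homog -> D m x ->
  D (m + 2 * e)%N (p *: x).
Proof.
move=> p_hom Dx.
pose good (r : A) f := forall m (x : V), D m x -> D (m + 2 * f)%N (r *: x).
have good1 : good 1 0%N by move=> d y Dy; rewrite muln0 addn0 scale1r.
have goodM r s f h : good r f -> good s h -> good (r * s) (f + h)%N.
  move=> hr hs d y Dy; rewrite -scalerA mulnDr [(2 * f + _)%N]addnC addnA.
  exact/hr/hs.
have goodX i : good 'X_i 1%N.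
  move=> d y Dy; rewrite sym_moduleE muln1; apply: gr_part_scale => //.
  have -> : gr_sym g ('X_i : A) = gr_even (mem_vbasis0 g i).
    by rewrite [LHS]mmapX mmap1U.
  by eexists; eexists.
have goodXm (n : 'X_{1..\dim g0}) : good 'X_[n] (mdeg n).
  rewrite mpolyXE_id mdegE.
  apply: (big_ind2 good) => [|x1 x2 y1 y2|i _]; [exact: good1|exact: goodM|].
  elim: (n i) => [|k IHk]; first by rewrite expr0.
  by rewrite exprS -add1n; exact: goodM.
rewrite [p]mpolyE scaler_suml big_seq; apply: (grading_sum D_grading) => n np.
have hX : D (m + 2 * e)%N ('X_[n] *: x : V).
  by rewrite -(elimT (dhomogP _ _ _) p_hom n np); exact: goodXm.
have ga : gr_part 0 (gr_scal g p@_n).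
  by exists (env_scal g p@_n), (env_fil_scal g 0 p@_n).
rewrite -mul_mpolyC -scalerA; have := gr_part_scale ga hX.
by rewrite addn0 -gr_sym_scal.
Qed.

Lemma hom_gens_odd_gens (hs : seq (nat * V)) l :
  hom_gens DV hs -> hom_gens DV (odd_gens hs l).
Proof.
have catP (t1 t2 : seq (nat * V)) : hom_gens DV t1 -> hom_gens DV t2 -> hom_gens DV (t1 ++ t2).
  by elim: t1 => // -[d x] t1 IHt1 /= [Dx /IHt1 h1] /h1.
move=> h; elim: l => //= j l IHl; apply: catP => //.
elim: (odd_gens hs l) IHl => // -[d x] t IHt /= [Dx /IHt ht]; split=> //.
by rewrite -addn1; apply: gr_part_scale Dx; exact: gr_part_odd_gen.
Qed.

Section Stable.
Variable T : set V.
Hypothesis T_lin : forall (p : A) x y, T x -> T y -> T (p *: x + y).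
Hypothesis T_0 : T 0.
Hypothesis T_odd : forall i x, T x -> T (odd_gen i *: (x : N)).

Let T_D x y : T x -> T y -> T (x + y).
Proof. by move=> Tx Ty; rewrite -[x]scale1r; exact: T_lin. Qed.

Let T_Z p x : T x -> T (p *: x).
Proof. by move=> Tx; rewrite -[_ *: _]addr0; exact: T_lin. Qed.

Let T_scal c (x : V) : T x -> T (gr_scal g c *: (x : N)).
Proof. by move=> Tx; rewrite -gr_sym_scal; exact: T_Z. Qed.

Let T_gr_odd u (gu : u \in g1) x : T x -> T (gr_odd gu *: (x : N)).
Proof.
move=> Tx.
have lin c y z (gy : y \in g1) (gz : z \in g1) (gw : c *: y + z \in g1) :
    gr_scal g c * gr_odd gy + gr_odd gz = gr_odd gw.
  rewrite -(symbM _ _ (fil_M (env_fil_scal g 0 c) (env_fil_odd gy))).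
  rewrite -(symbD _ _ (fil_D (fil_M (env_fil_scal g 0 c) (env_fil_odd gy))
                             (env_fil_odd gz))).
  by apply: symb_ext; rewrite env_in_linear.
have ext y z (gy : y \in g1) (gz : z \in g1) : y = z -> gr_odd gy = gr_odd gz.
  by move=> e; apply: symb_ext; rewrite e.
suff h (s : seq 'I_(\dim g1)) (f : 'I_(\dim g1) -> K)
    (gw : \sum_(i <- s) f i *: (vbasis g1)`_i \in g1) : T (gr_odd gw *: (x : N)).
  have e := coord_vbasis gu; have gw := gu; rewrite {1}e in gw.
  by rewrite (ext _ _ gu gw e); exact: h.
elim: s gw => [|i s IHs] gw.
  have g0' : 0 \in g1 by exact: mem0v.
  have z0 : gr_odd g0' = 0.
    have := lin (-1) 0 0 g0' g0'; rewrite scaler0 addr0 => /(_ g0').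
    by rewrite rmorphN1 mulN1r addNr => <-.
  by rewrite (ext _ 0 gw g0') ?big_nil // z0 scale0r.
have gs : \sum_(j <- s) f j *: (vbasis g1)`_j \in g1.
  by apply: rpred_sum => j _; apply/rpredZ/mem_vbasis1.
have gw' : f i *: (vbasis g1)`_i + \sum_(j <- s) f j *: (vbasis g1)`_j \in g1.
  by rewrite big_cons in gw.
rewrite (ext _ _ gw gw') ?big_cons // -(lin _ _ _ (mem_vbasis1 i) gs) scalerDl.
apply: T_D; last exact: IHs.
by rewrite -scalerA; apply/T_scal/T_odd.
Qed.

Let weight (s : seq (bool * g)) := (\sum_(t <- s) (if t.1 then 1 else 2))%N.

Let symb_cast n n' u u' (hu : env_fil g n u) (hu' : env_fil g n' u') :
  n = n' -> u = u' -> symb hu = symb hu'.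
Proof. by move=> e; subst n'; exact: symb_ext. Qed.

Let T_prod (s : seq (bool * g)) (x : V)
    (h : env_fil g (weight s) (\prod_(t <- s) env_in t.2)) :
  {in s, forall t, t.2 \in lie_part g t.1} -> T x -> T (symb h *: (x : N)).
Proof.
elim: s h => [|[a u] s IHs] h hs Tx.
  have -> : symb h = 1.
    by rewrite -(symb1 (fil_1 (env_fil g))); apply: symb_cast; rewrite /weight big_nil.
  by rewrite scale1r.
have hs' : {in s, forall t, t.2 \in lie_part g t.1}.
  by move=> t ts; apply: hs; rewrite inE ts orbT.
have gu : u \in lie_part g a by apply: (hs (a, u)); rewrite inE eqxx.
have hs0 : env_fil g (weight s) (\prod_(t <- s) env_in t.2).
  by apply: EnvProd; exists s.
have -> : symb h = symb (env_fil_in gu) * symb hs0.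
  rewrite -(symbM _ _ (fil_M (env_fil_in gu) hs0)); apply: symb_cast.
    by rewrite /weight big_cons.
  by rewrite big_cons.
rewrite -scalerA; move: (IHs hs0 hs' Tx); move: (_ *: _) => y Ty.
case: a gu {hs h} => gu.
  have -> : symb (env_fil_in gu) = gr_odd gu by exact: symb_ext.
  exact: T_gr_odd.
have -> : symb (env_fil_in gu) = gr_sym g (sym_in u).
  by rewrite (gr_sym_in gu); exact: symb_ext.
exact: T_Z.
Qed.

Let T_symb n u (hu : env_fil g n u) (x : V) : T x -> T (symb hu *: (x : N)).
Proof.
move=> Tx; have hu' : env_span n u := hu.
elim: hu' hu => {u} [u [s [hs ls uE]]|c u v hu IHu hv IHv] h.
  (* A product of weight below [n] has zero symbol in degree [n]. *)
  case: (ltnP (weight s) n) => [sn|ns].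
    have -> : symb h = 0.
      rewrite -(subrr (symb h)) -(symbB _ _ (fil_B h h)).
      apply/symb_eq; rewrite subrr subr0; case: n sn ls h => // n sn _ h /=.
      by apply: EnvProd; exists s.
    by rewrite scale0r.
  have sn : n = weight s by apply/eqP; rewrite eqn_leq ls ns.
  have h' : env_fil g (weight s) (\prod_(t <- s) env_in t.2).
    by apply: EnvProd; exists s.
  by rewrite (symb_cast h h' sn uE); exact: T_prod.
have -> : symb h = gr_scal g c * symb (hu : env_fil g n u) + symb (hv : env_fil g n v).
  rewrite -(symbM _ _ (fil_M (env_fil_scal g 0 c) (hu : env_fil g n u))).
  rewrite -(symbD _ _ (fil_D (fil_M (env_fil_scal g 0 c) (hu : env_fil g n u))
                             (hv : env_fil g n v))).
  exact: symb_ext.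
rewrite scalerDl -scalerA; apply: T_D; last exact: IHv.
by apply: T_scal; exact: IHu.
Qed.

(** Every element of gr U(g) is a sum of symbols, and the symbol of a product of full weight is the
    product of the symbols of its factors: even ones come from S(g_0), odd ones are combinations of
    the [odd_gen i]. *)
Lemma stable_gr_env (a : gr_env g) (x : V) : T x -> T (a *: (x : N)).
Proof.
move=> Tx; have [p ->] := qproj_surj a.
have hp n : env_fil g n (val p)`_n by have /asboolP := valP p.
have -> : p = \sum_(n < size (val p)) Rees (symb_mem (hp n)).
  apply: val_inj; rewrite raddf_sum /= -[LHS]coefK poly_def.
  by apply: eq_bigr.
rewrite raddf_sum scaler_suml /=.
elim/big_ind: _ => // n _; exact: (T_symb (hp n)).
Qed.
End Stable.

(** The homogeneous components of the given generators, multiplied by the ordered products of odd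
    generators, have a span over S(g_0) that is stable under gr U(g). *)
Lemma fin_gen_hom (two_neq0 : (2%:R : K) != 0) : fin_gen N ->
  exists s : seq (nat * V), hom_gens DV s /\ forall y, gen_span s y.
Proof.
move=> [s s_gen].
have [c [cD _ _ _ c_sum]] := grading_comp sym_module_grading.
have [hs [hs_hom hsP]] : exists hs : seq (nat * V), hom_gens DV hs /\
    forall x, x \in s -> gen_span hs (x : V).
  elim: s {s_gen} => [|x s [hs [hs_hom hsP]]]; first by exists [::].
  have [n0 /(_ n0 (leqnn _)) xE] := c_sum x.
  pose xs := [seq (m, c m x) | m <- iota 0 n0].
  exists (xs ++ hs); split.
    by rewrite /xs; elim: (iota 0 n0) => //= m r IHr; split.
  move=> y; rewrite inE => /orP[/eqP ->|/hsP hy]; apply/gen_span_cat.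
    exists x, 0; split; rewrite ?addr0 //; last exact: gen_span0.
    rewrite xE; apply: gen_span_sum => i _.
    apply: (gen_span_mem (t := (val i, c i x))); apply/mapP; exists (val i) => //.
    by rewrite mem_iota add0n ltn_ord.
  by exists 0, y; rewrite add0r; split=> //; exact: gen_span0.
pose l := enum 'I_(\dim g1).
exists (odd_gens hs l); split; first exact: hom_gens_odd_gens.
move=> y; have [a ->] := s_gen y.
apply: gen_span_sum => i _; apply: stable_gr_env.
- by move=> p u v; exact: gen_span_lin.
- exact: gen_span0.
- by move=> j x hx; apply: odd_gens_stable; rewrite ?mem_enum.
by apply/odd_gens_sub/hsP/mem_nth.
Qed.
End HomogeneousGenerators.

(** * Homogeneous primes: nonsquares of odd degree and growth of larger ideals *)

Lemma pihomog_top_mul (K : fieldType) k (p r : {mpoly K[k]}) a b :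
  (msize p <= a.+1)%N -> (msize r <= b.+1)%N ->
  pihomog mdeg (a + b)%N (p * r) = pihomog mdeg a p * pihomog mdeg b r.
Proof.
move=> pa rb; rewrite {1}[p](@pihomog_partitionE _ _ mdeg a.+1) //.
rewrite {1}[r](@pihomog_partitionE _ _ mdeg b.+1) // mulr_suml raddf_sum /=.
have hom i j : pihomog mdeg (a + b)%N (pihomog mdeg i p * pihomog mdeg j r)
    = if (i + j == a + b)%N then pihomog mdeg i p * pihomog mdeg j r else 0.
  have h := dhomogM (pihomogP mdeg i p) (pihomogP mdeg j r).
  by case: eqP => [<-|/eqP ne]; [exact: pihomog_dE|exact: pihomog_ne0 ne h].
rewrite (bigD1 ord_max) //= mulr_sumr raddf_sum (bigD1 ord_max) //= hom eqxx.
rewrite big1 ?addr0 => [|j jb]; last first.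
  by rewrite hom eqn_add2l -[_ == b]/(j == ord_max) (negPf jb).
rewrite big1 ?addr0 // => i ia; rewrite mulr_sumr raddf_sum big1 //= => j _.
rewrite hom; case: eqP => // ij.
have : (i < a)%N by rewrite ltn_neqAle -ltnS ltn_ord andbT.
by have := ltn_ord j; lia.
Qed.

Lemma pihomog_msize (K : fieldType) k (p : {mpoly K[k]}) a :
  (msize p <= a)%N -> pihomog mdeg a p = 0.
Proof.
move=> pa; rewrite pihomogE big_seq_cond big1 // => m /andP[/msize_mdeg_lt mp /eqP ma].
by move: (leq_trans mp pa); rewrite ma ltnn.
Qed.

Lemma msize_mul_le (K : fieldType) k (p r : {mpoly K[k]}) a b :
  (msize p <= a.+1)%N -> (msize r <= b.+1)%N -> (msize (p * r) <= (a + b).+1)%N.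
Proof.
move=> pa rb; case: (eqVneq p 0) => [->|p0]; first by rewrite mul0r mmeasure0.
case: (eqVneq r 0) => [->|r0]; first by rewrite mulr0 mmeasure0.
rewrite msizeM // -subn1 leq_subLR add1n -addSn -addnS.
exact: leq_add.
Qed.

Definition hom_closed (K : fieldType) k (q : {pred {mpoly K[k]}}) : Prop :=
  forall p e, p \in q -> pihomog mdeg e p \in q.

Section HomogeneousPrime.
Variables (K : fieldType) (k : nat).
Local Notation A := {mpoly K[k]}.
Variables (q : {pred A}) (hq : prime_ideal q).
Hypothesis q_hom : hom_closed q.

(** Top components lying in [q] are removed one at a time; the process stops before reaching zero
    because [b] is not in [q]. *)
Lemma reduce_top b : b \notin q -> exists e b', [/\ b - b' \in q,
  (msize b' <= e.+1)%N & pihomog mdeg e b' \notin q].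
Proof.
have [n] : exists n, (msize b <= n)%N by exists (msize b).
elim: n b => [|n IHn] b bn bq.
  case/negP: bq; suff -> : b = 0 by exact: (prime_ideal0 hq).
  by apply/eqP; rewrite -msize_poly_eq0 -leqn0.
case: (boolP (pihomog mdeg n b \in q)) => bnq; last first.
  by exists n, b; rewrite subrr (prime_ideal0 hq).
have [||e [b' [h1 h2 h3]]] := IHn (b - pihomog mdeg n b).
- rewrite {1}[b](@pihomog_partitionE _ _ mdeg n.+1) // big_ord_recr /= addrK.
  elim/big_ind: _ => [|x y hx hy|i _]; first by rewrite mmeasure0.
    by apply: leq_trans (mmeasureD_le _ _ _) _; rewrite geq_max hx.
  rewrite msizeE; apply/bigmax_leqP_seq => m mi _.
  by rewrite (elimT (dhomogP _ _ _) (pihomogP mdeg i b) m mi).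
- apply: contra bq => h; have := prime_idealD hq h bnq.
  by rewrite subrK.
exists e, b'; split=> //; have := prime_idealD hq h1 bnq.
by rewrite addrAC subrK.
Qed.

(** Choose representatives of [a] and [b] modulo [q] whose top components, of degrees f and e,
    survive modulo [q]. Then a ^ 2 and h b ^ 2 have surviving tops in degrees 2 f and d + 2 e, which
    differ by parity; the higher one would be a component of an element of the homogeneous ideal
    [q]. *)
Lemma odd_degree_nonsquare (h : A) d a b : odd d -> h \is d.-homog -> h \notin q ->
  b \notin q -> a ^+ 2 - h * b ^+ 2 \notin q.
Proof.
move=> d_odd h_hom hnq bq; apply/negP => abq.
have projE := resring_proj_eq0 hq.
have aq : a \notin q.
  apply: contra bq => aq; have : h * b ^+ 2 \in q.
    rewrite -[h * _]opprK -[- (h * _)](addKr (a ^+ 2)).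
    rewrite opprD opprK; apply: (prime_idealB hq) => //.
    by rewrite expr2 (prime_idealM hq) aq.
  by rewrite !(prime_idealM hq) (negPf hnq) /= orbb.
have [e [b' [bb' b's b'q]]] := reduce_top bq.
have [f [a' [aa' a's a'q]]] := reduce_top aq.
have {}abq : a' ^+ 2 - h * b' ^+ 2 \in q.
  move: abq aa' bb'; rewrite -!projE !(rmorphB, rmorphM, rmorphXn) /=.
  by move=> abq /[!subr_eq0]/eqP <- /eqP <-; rewrite subr_eq0 in abq.
have hs : (msize h <= d.+1)%N.
  rewrite msizeE; apply/bigmax_leqP_seq => m mi _.
  by rewrite (elimT (dhomogP _ _ _) h_hom m mi).
have a2s := msize_mul_le a's a's; have a2t := pihomog_top_mul a's a's.
have b2s := msize_mul_le b's b's; have b2t := pihomog_top_mul b's b's.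
have hb2s := msize_mul_le hs b2s; have hb2t := pihomog_top_mul hs b2s.
rewrite b2t (pihomog_dE h_hom) in hb2t.
case: (ltngtP (f + f) (d + (e + e))) => fde.
- have := q_hom (d + (e + e)) abq; rewrite raddfB /= !expr2 hb2t.
  rewrite pihomog_msize ?sub0r; last exact: leq_trans fde.
  move=> h1; have := prime_idealB hq (prime_ideal0 hq) h1.
  by rewrite sub0r opprK !(prime_idealM hq) (negPf hnq) (negPf b'q).
- have := q_hom (f + f)%N abq; rewrite raddfB /= !expr2 a2t.
  rewrite [X in _ - X]pihomog_msize ?subr0; last exact: leq_trans fde.
  by rewrite (prime_idealM hq) (negPf a'q).
have := congr1 odd fde; rewrite !oddD !addbb d_odd.
by [].
Qed.

Lemma odd_degree_resfield (h : A) d : odd d -> h \is d.-homog -> h \notin q ->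
  forall x : resfield hq, x ^+ 2 != resfield_proj hq h.
Proof.
move=> d_odd h_hom hnq; apply: resfield_nonsquare => a b bq.
exact: (odd_degree_nonsquare a d_odd h_hom hnq bq).
Qed.

Definition quot_module : lmodType A :=
  restr (resring_proj hq : {rmorphism A -> resring hq}) (resring hq)^o.
Local Notation RB := quot_module.
Local Notation DB := (fun m =>
  (resring_proj hq @` [set p : A | p \is m.-homog])%classic : set RB).

Lemma quot_grading : @is_grading RB DB.
Proof.
split=> [m|x|n y Dy].
- split; first by exists 0; rewrite ?rmorph0 //=; exact: dhomog0.
  by move=> _ _ [p hp <-] [r hr <-]; exists (p - r); rewrite ?rmorphB //=; exact: rpredB.
- have [p ->] := resring_proj_surj x; exists (msize p).
  exists (fun m => resring_proj hq (pihomog mdeg m p)).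
    by move=> m; exists (pihomog mdeg m p) => //=; exact: pihomogP.
  by rewrite {1}[p](@pihomog_partitionE _ _ mdeg (msize p)) // rmorph_sum.
have ex m : exists p : A, p \is m.-homog /\ resring_proj hq p = y m.
  by have [p hp <-] := Dy m; exists p.
have [p hp] := choice ex => y0 m mn.
have : \sum_(i < n) p i \in q.
  rewrite -(resring_proj_eq0 hq) rmorph_sum -[X in _ == X]y0; apply/eqP.
  by apply: eq_bigr => i _; case: (hp i).
move=> /(q_hom m); rewrite raddf_sum (bigD1 (Ordinal mn)) //= big1 => [|i im].
  have [pm <-] := hp m; rewrite addr0 pihomog_dE // => pq.
  by apply/eqP; rewrite resring_proj_eq0.
by have [pi _] := hp i; apply: pihomog_ne0 pi.
Qed.

Lemma quot_scale_graded e m (p : A) (x : RB) : p \is e.-homog -> DB m x ->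
  DB (m + 1 * e)%N (p *: x).
Proof.
move=> hp [r hr <-]; exists (p * r); last by rewrite rmorphM.
by rewrite mul1n addnC; exact: dhomogM.
Qed.

Lemma quot_scale1 p : p *: ((1 : resring hq) : RB) = resring_proj hq p.
Proof. exact: mulr1. Qed.

Lemma quot_gen (y : RB) : exists p : A, y = p *: ((1 : resring hq) : RB).
Proof. by have [p ->] := resring_proj_surj y; exists p; rewrite quot_scale1. Qed.

Lemma quot_grading1 : DB 0 ((1 : resring hq) : RB).
Proof. by exists 1; rewrite ?rmorph1 //=; exact: dhomog1. Qed.

Definition prime_pred (p : A) : Prop := p \in q.

Lemma quot_hilb n : @has_dim K (restr (mpolyC_rmorph K k) RB)
  (partial_sum DB n) (hilb prime_pred n).
Proof.
have hq0 p : prime_pred p <-> p *: ((1 : resring hq) : RB) = 0.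
  by rewrite quot_scale1 /prime_pred -(resring_proj_eq0 hq); split=> /eqP.
have := @cyclic_hilb_dim K k RB DB quot_grading quot_scale_graded
  ((1 : resring hq) : RB) quot_grading1 quot_gen n prime_pred hq0.
exact.
Qed.

(** Multiplication by [a] is injective on A / q, so its image is a copy of A / q shifted by [e]; the
    two counts of A / q are compared. *)
Lemma hilb_principal a e n : a \is e.-homog -> a \notin q ->
  exists2 J : A -> Prop, (forall p, J p <-> exists r, p - r * a \in q) &
  hilb prime_pred n = (hilb J n + if e <= n then hilb prime_pred (n - e) else 0)%N.
Proof.
move=> a_hom aq; exists (fun p => exists r, p - r * a \in q) => //.
have scaleE r : (r *: (resring_proj hq a : RB) : RB) = resring_proj hq (r * a).
  by rewrite rmorphM.
apply: (has_dim_uniq (quot_hilb n)).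
apply: (@cyclic_hilb_dim2 K k RB DB quot_grading quot_scale_graded ((1 : resring hq) : RB)
  quot_grading1 quot_gen n e (resring_proj hq a)) => [|p|p].
- by exists a.
- rewrite scaleE /prime_pred -[p \in q]orbF -(negPf aq) -(prime_idealM hq).
  by rewrite -(resring_proj_eq0 hq); split=> /eqP.
split=> -[r h]; exists r.
  by apply/eqP; rewrite quot_scale1 scaleE -subr_eq0 -rmorphB resring_proj_eq0.
move: h; rewrite quot_scale1 scaleE => h.
by rewrite -(resring_proj_eq0 hq) rmorphB subr_eq0; apply/eqP; exact: h.
Qed.

Lemma hilb_prime_growth : exists d e, 0 < e /\
  poly_growth d e (fun n => (hilb prime_pred n)%:R).
Proof.
have [|D hD] := @hilb_poly K k prime_pred.
  by move=> p r; rewrite /prime_pred (prime_idealM hq) => ->; rewrite orbT.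
case: (poly_growth_lead hD) => [[n0 h0]|[d [e [_ e0 hde]]]].
  have := h0 n0 (leqnn _) => /eqP; rewrite pnatr_eq0 => /eqP h.
  suff : (0 < hilb prime_pred n0)%N by rewrite h.
  apply: hilb_gt0 => [p c|]; last by apply/negP; exact: (prime_ideal1 hq).
  by rewrite /prime_pred -mul_mpolyC (prime_idealM hq) => ->; rewrite orbT.
exists d, e; split=> //; rewrite lt_def e0 /=.
by apply: poly_growth_ge0 hde _ => n; rewrite ler0n.
Qed.

(** Being homogeneous, [I] contains a homogeneous [a] outside [q], of degree f say. By
    [hilb_principal] its Hilbert function is at most H(n) - H(n - f), with H that of [q], and this
    difference has no term of degree [d]. *)
Lemma hilb_larger_growth (I : A -> Prop) d e :
  (forall p r, I p -> I (r * p)) -> (forall p r, I p -> I r -> I (p + r)) ->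
  (forall p, p \in q -> I p) ->
  (forall p e, I p -> I (pihomog mdeg e p)) -> (exists2 p, I p & p \notin q) ->
  poly_growth d e (fun n => (hilb prime_pred n)%:R) ->
  poly_growth d 0 (fun n => (hilb I n)%:R).
Proof.
move=> I_M I_D qI I_hom [p Ip pq] hde.
have [f pf] : exists f, pihomog mdeg f p \notin q.
  apply: contrapT => h; case/negP: pq.
  rewrite [p](@pihomog_partitionE _ _ mdeg (msize p)) //.
  apply: (prime_ideal_sum hq) => i _; apply: contrapT => /negP ni.
  by apply: h; exists (val i).
set a := pihomog mdeg f p in pf; have a_hom : a \is f.-homog by exact: pihomogP.
have [D hD] := hilb_poly I_M.
apply: (@poly_growth_dominated d D _
  (fun n => (hilb prime_pred n)%:R - (hilb prime_pred (n - f)%N)%:R)).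
- by rewrite -(subrr e); apply/poly_growthB/(poly_growth_shift f hde).
- exact: hD.
- by move=> n; rewrite ler0n.
exists f => n fn; have [J JE ->] := hilb_principal n a_hom pf.
rewrite fn natrD addrK ler_nat; apply: hilb_sub => r /JE[t rt].
rewrite -[r](subrK (t * a)); apply: I_D; first exact: qI.
exact/I_M/I_hom.
Qed.
End HomogeneousPrime.

(** * Matrix systems for a possibly degenerate Gram matrix *)

(** Rows [f] spanning the row space give G = C (rows f of G). By symmetry the columns [f] also have
    full rank, and they equal [C] times the minor, which must then have full rank. *)
Lemma sym_principal_minor (F : fieldType) m (G : 'M[F]_m) : G^T = G ->
  exists f : 'I_(\rank G) -> 'I_m, mxsub f f G \in unitmx.
Proof.
move=> G_sym; exists (maxrankfun G); set f := maxrankfun G.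
have /submxP[C GC] : (G <= rowsub f G)%MS by rewrite eq_maxrowsub.
have colE : colsub f G = C *m mxsub f f G.
  transitivity (colsub f (C *m rowsub f G)); first by rewrite -GC.
  by rewrite -mulmx_colsub; congr (_ *m _); apply/matrixP => i j; rewrite !mxE.
have rk : \rank (colsub f G) = \rank G.
  rewrite -mxrank_tr; have -> : (colsub f G)^T = rowsub f G.
    by rewrite trmx_mxsub G_sym.
  by have := maxrowsub_free G => /eqP.
rewrite -row_full_unit -[row_full _]/(\rank _ == _) eqn_leq rank_leq_col /=.
by rewrite -[X in (X <= _)%N]rk colE mxrankM_maxr.
Qed.

Section GramSystem.
Variables (F : fieldType) (m : nat) (G : 'M[F]_m).
Hypothesis two_neq0 : (2%:R : F) != 0.
Hypothesis G_sym : G^T = G.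
Hypothesis G_nsq : odd (\rank G) -> forall (f : 'I_(\rank G) -> 'I_m) e x,
  mxsub f f G \in unitmx ->
  x ^+ 2 != (-1) ^+ e * 2%:R ^+ \rank G * \det (mxsub f f G).
Let l := ((\rank G + 1) %/ 2)%N.

Lemma gram_system_dim n (E : 'I_m -> 'M[F]_n) : (0 < n)%N ->
  (forall i j, E i *m E j + E j *m E i = (G i j)%:M) -> (2 ^ l <= n)%N.
Proof.
case: n E => // n E _ EE; have [f f_unit] := sym_principal_minor G_sym.
apply: (clifford_dim_bound two_neq0 (H := mxsub f f G) (E := fun i => E (f i))) => //.
- by rewrite trmx_mxsub G_sym.
- move=> i j; rewrite mxE; transitivity ((G (f i) (f j))%:M : 'M[F]_n.+1).
    exact: EE.
  by rewrite -scalemx1.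
by move=> r_odd e x; exact: G_nsq.
Qed.

Variables (n : nat) (E : 'I_m -> 'M[F]_n.+1).
Hypothesis E_gram : forall i j, E i *m E j + E j *m E i = (G i j)%:M.

(** The restrictions of the [E i] to the row space of [W], written in a basis, satisfy the same
    relations, so the bound on the size applies to them. *)
Lemma gram_stable_rank p (W : 'M[F]_(p, n.+1)) : W != 0 ->
  (forall i, (W *m E i <= W)%MS) -> (2 ^ l <= \rank W)%N.
Proof.
move=> W0 WE; set B := row_base W.
have BE i : B *m E i = (B *m E i *m pinvmx B) *m B.
  rewrite mulmxKpV //; apply: submx_trans (_ : W <= B)%MS; last by rewrite eq_row_base.
  by apply: submx_trans (WE i); apply: submxMr; rewrite eq_row_base.
apply: (@gram_system_dim _ (fun i => B *m E i *m pinvmx B)).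
  by rewrite lt0n mxrank_eq0.
move=> i j; apply: (row_free_inj (row_base_free W)); rewrite -/B /=.
have BEE i' j' : B *m E i' *m pinvmx B *m (B *m E j' *m pinvmx B) *m B = B *m (E i' *m E j').
  rewrite -[LHS]mulmxA -(BE j') [LHS]mulmxA -(BE i').
  exact: esym (mulmxA _ _ _).
by rewrite mulmxDl !BEE -mulmxDr E_gram mul_mx_scalar mul_scalar_mx.
Qed.

Definition row_lift (x : 'rV[F]_m) : 'M[F]_n.+1 := \sum_i x 0 i *: E i.

Lemma row_lift_linear : linear row_lift.
Proof.
move=> a x y; rewrite /row_lift scaler_sumr -big_split; apply: eq_bigr => i _.
by rewrite !mxE scalerDl scalerA.
Qed.

Lemma row_lift_delta i : row_lift (delta_mx 0 i) = E i.
Proof.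
rewrite /row_lift (bigD1 i) //= mxE !eqxx scale1r big1 ?addr0 // => j /negPf ji.
by rewrite mxE ji andbF scale0r.
Qed.

Lemma row_lift_gram x y : row_lift x *m row_lift y + row_lift y *m row_lift x
  = ((x *m G *m y^T) 0 0)%:M.
Proof.
transitivity (\sum_i \sum_j (x 0 i * y 0 j) *: (E i *m E j + E j *m E i)).
  rewrite /row_lift !mulmx_suml; under eq_bigr do rewrite mulmx_sumr.
  under [X in _ + X]eq_bigr do rewrite mulmx_sumr.
  rewrite [X in _ + X]exchange_big -big_split; apply: eq_bigr => i _ /=.
  rewrite -big_split; apply: eq_bigr => j _ /=.
  by rewrite -!scalemxAl -!scalemxAr !scalerA [y 0 j * _]mulrC -scalerDr.
rewrite exchange_big mxE raddf_sum; apply: eq_bigr => j _ /=.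
rewrite !mxE mulr_suml raddf_sum; apply: eq_bigr => i _ /=.
by rewrite E_gram -mul_scalar_mx -scalar_mxM mulrAC.
Qed.

Hypothesis n_min : n.+1 = (2 ^ l)%N.

Lemma gram_system_irr (W : 'M[F]_n.+1) : W != 0 ->
  (forall i, (W *m E i <= W)%MS) -> row_full W.
Proof.
move=> W0 WE; rewrite /row_full eqn_leq rank_leq_col.
by rewrite [X in (X <= _)%N]n_min gram_stable_rank.
Qed.

(** The matrix [X] of a radical vector squares to zero and anticommutes with each [E i]. Its kernel
    is therefore nonzero and stable, hence everything. *)
Lemma row_lift_radical x : (forall y : 'rV_m, (x *m G *m y^T) 0 0 = 0) ->
  row_lift x = 0.
Proof.
move=> x_rad; set X := row_lift x.
have XX : X *m X = 0.
  have := row_lift_gram x x; rewrite x_rad -mulr2n -scaler_nat raddf0 => /eqP.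
  by rewrite scaler_eq0 (negPf two_neq0) => /eqP.
apply/eqP; apply: contraT => X0.
have : row_full (kermx X).
  apply: gram_system_irr => [|i].
    apply: contra X0; rewrite kermx_eq0 => X_free; apply/eqP.
    by apply: (row_free_inj X_free); rewrite mul0mx XX.
  apply/sub_kermxP; have := row_lift_gram x (delta_mx 0 i).
  rewrite x_rad row_lift_delta -/X raddf0 addrC => /eqP; rewrite addr_eq0 => /eqP h.
  by rewrite -mulmxA h mulmxN mulmxA mulmx_ker mul0mx oppr0.
move=> ker_full; case/eqP: X0.
by rewrite -[X]mul1mx -(mulVpmx ker_full) -mulmxA mulmx_ker mulmx0.
Qed.
End GramSystem.

(** * Growth of a module in terms of its rank *)

Section TorsionFreeGrowth.
Variables (K : fieldType) (k : nat).
Local Notation A := {mpoly K[k]}.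
Variables (V : lmodType A) (D : nat -> set V) (q : {pred A}) (hq : prime_ideal q).
Hypothesis D_grading : is_grading D.
Hypothesis D_scale : forall e m (p : A) x,
  p \is e.-homog -> D m x -> D (m + 2 * e)%N (p *: x).
Hypothesis q_ann : forall p (x : V), p \in q -> p *: x = 0.

(** The annihilator of a homogeneous element is its conductor modulo the empty list, a homogeneous
    ideal; homogeneous elements generate. *)
Lemma ann_hom_closed : (forall p, (forall x : V, p *: x = 0) -> p \in q) ->
  hom_closed q.
Proof.
move=> annq p e pq; apply: annq => x.
have [c [cD _ _ _ c_sum]] := grading_comp D_grading.
have [n0 /(_ n0 (leqnn _)) ->] := c_sum x.
rewrite scaler_sumr big1 // => i _.
have : @conductor K k V [::] (c i x) p by rewrite /conductor /= q_ann.
exact: (conductor_pihomog (s := [::]) (ltn0Sn 1) D_grading D_scale e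
  (Logic.I : hom_gens D [::]) (cD _ _)).
Qed.

(** Each generator counted by [free_part] contributes the growth of A / q, and every other one a
    conductor larger than [q], with zero coefficient in degree [d]. *)
Lemma span_hilb_growth d e s : hom_closed q -> hom_gens D s ->
  poly_growth d e (fun n => (hilb (prime_pred q) n)%:R) ->
  poly_growth d ((size (free_part q s))%:R * e)
    (fun n => (span_hilb 2 s n.*2)%:R).
Proof.
move=> q_hom + hde; elim: s => [_|[d0 x] s IHs [Dx hs]].
  by rewrite mul0r; exact: poly_growth0.
pose I := conductor s x.
have hI : poly_growth d (if is_free q s x then e else 0) (fun n => (hilb I n)%:R).
  case: ifP => [/asboolP Iq|/asboolP nIq].
    apply: poly_growth_ext hde; exists 0%N => n _; congr _%:R.
    by apply: hilb_ext => p; split; [exact: ann_conductor|exact: Iq].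
  apply: (hilb_larger_growth hq q_hom _ _ _ _ _ hde) => [p t|p t|p|p f|].
  - exact: conductorM.
  - by move=> hp ht; rewrite /I /conductor scalerDl; exact: gen_spanD.
  - exact: ann_conductor.
  - exact: (conductor_pihomog (ltn0Sn 1) D_grading D_scale f hs Dx).
  apply: contrapT => h; apply: nIq => p Ip; apply: contrapT => /negP pq.
  by apply: h; exists p.
have -> : (size (free_part q ((d0, x) :: s)))%:R * e
    = (if is_free q s x then e else 0) + (size (free_part q s))%:R * e.
  by rewrite /=; case: ifP => _ /=; rewrite ?add0r // -natr1 mulrDl mul1r addrC.
(* With variables in degree 2, a generator of degree [d0] contributes in total degree 2 n the
   multipliers of degree at most (2 n - d0) %/ 2 = n - uphalf d0. *)
have := poly_growthD (poly_growth_shift (uphalf d0) hI) (IHs hs).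
apply: poly_growth_ext; exists (uphalf d0) => n dn.
rewrite /= natrD; congr (_%:R + _).
rewrite -leq_uphalf_double dn; congr (hilb _ _); rewrite divn2.
have e0 : n.*2 = (d0 + (odd d0 + (n - uphalf d0).*2))%N.
  have := odd_double_half d0; move: dn; rewrite uphalf_half -!addnn.
  by case: (odd d0); move: d0./2 => h /= hn <-; lia.
by rewrite e0 addKn half_bit_double.
Qed.
End TorsionFreeGrowth.

(** * The Clifford matrices attached to N *)

Section CliffordMatrices.
Variables (K : fieldType) (g : lieSuperalgebra K).
Local Notation g0 := (lie_part g false).
Local Notation g1 := (lie_part g true).
Variables (N : lmodType (gr_env g)).
Variable hq : prime_ideal (ann_sym N).
Hypothesis N_tf : torsion_free N.
Local Notation V := (sym_module N).
Local Notation F := (resfield hq).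

Hypothesis two_neq0 : (2%:R : K) != 0.

Lemma resfield_two_neq0 : (2%:R : F) != 0.
Proof.
have : resfield_proj hq (sym_scal g 2%:R^-1) * 2%:R = 1.
  rewrite -(rmorph_nat (resfield_proj hq)) -(rmorph_nat (sym_scal g)).
  by rewrite -!rmorphM mulVf // !rmorph1.
by apply: contra_eq_neq => ->; rewrite mulr0 eq_sym oner_eq0.
Qed.

Lemma gram_tr : (gram hq)^T = gram hq.
Proof.
apply/matrixP => i j; rewrite !mxE; congr (resfield_proj hq (sym_in _)).
by rewrite (lie_skew (mem_vbasis1 j) (mem_vbasis1 i)) /= expr1 scaleN1r opprK.
Qed.

Lemma ann_symP p : reflect (forall x : N, gr_sym g p *: x = 0) (p \in ann_sym N).
Proof. exact: asboolP. Qed.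

(** Odd generators commute with S(g_0), so they extend to matrices on F ^ r, and their
    anticommutators are brackets acting as scalars. The size is positive because [phi] is injective
    on a nonzero module. *)
Lemma odd_matrices (s : seq (nat * V)) : (forall y, gen_span s y) ->
  (exists x : N, x <> 0) ->
  exists E : 'I_(\dim g1) -> 'M[F]_(size (free_part (ann_sym N) s)),
    (0 < size (free_part (ann_sym N) s))%N /\
    forall i j, E i *m E j + E j *m E i = (gram hq i j)%:M.
Proof.
move=> s_gen [x0 x0_neq0].
have q_ann p (x : V) : p \in ann_sym N -> p *: x = 0 by move=> /ann_symP/(_ x).
have q_tf p (x : V) : p \notin ann_sym N -> p *: x = 0 -> x = 0 by exact: N_tf.
have [phi [b [phiD phiZ phi_inj phib phi_ex]]] :=
  @free_part_coord K (\dim g0) V (ann_sym N) hq q_ann q_tf s s_gen.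
pose u i : V -> V := fun x => odd_gen i *: (x : N).
have uD i : {morph u i : x y / x + y} by move=> x y; exact: (@scalerDr _ N (odd_gen i) x y).
have uZ i p (x : V) : u i (p *: x) = p *: u i x by exact: scale_symC.
have phiM i := free_part_mx phiD phiZ phib phi_ex (uD i) (uZ i).
exists (fun i => \matrix_l phi (u i (b l))); split.
  case: (posnP (size (free_part (ann_sym N) s))) => // r0; case: x0_neq0.
  apply: phi_inj; apply/rowP => l; case: (l) => l' hl.
  by exfalso; move: hl; rewrite r0.
move=> i j; apply/row_matrixP => l; rewrite !rowE mulmxDr !mulmxA -phib -!phiM.
(* Acting on rows reverses the order of composition, which exchanges the two summands. *)
rewrite -phiD addrC mul_mx_scalar mxE -phiZ; congr phi.
by rewrite /u odd_gen_anti subrK.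
Qed.

(** Brackets are linear forms, so a minor of size r lifts to a form of degree r, and the constant
    (-1) ^ e 2 ^ r does not change this degree. *)
Lemma gram_nonsquare : hom_closed (ann_sym N : {pred {mpoly K[\dim g0]}}) ->
  odd (\rank (gram hq)) ->
  forall (f : 'I_(\rank (gram hq)) -> 'I_(\dim g1)) e x,
  mxsub f f (gram hq) \in unitmx ->
  x ^+ 2 != (-1) ^+ e * 2%:R ^+ \rank (gram hq) * \det (mxsub f f (gram hq)).
Proof.
move=> q_hom; move: (\rank (gram hq)) => r r_odd f e x f_unit.
have sym_in_hom (y : g) : (sym_in y : {mpoly K[\dim g0]}) \is 1.-homog.
  apply: rpred_sum => i _; rewrite mul_mpolyC; apply: rpredZ.
  by rewrite dhomogX /= mdeg1.
pose M : 'M[{mpoly K[\dim g0]}]_r :=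
  \matrix_(i, j) sym_in (lie_br (vbasis g1)`_(f i) (vbasis g1)`_(f j)).
have ME : mxsub f f (gram hq) = map_mx (resfield_proj hq) M.
  by apply/matrixP => i j; rewrite !mxE.
have M_hom : \det M \is r.-homog.
  apply: rpred_sum => p _; rewrite -signr_odd.
  have h : \prod_i M i (p i) \is r.-homog.
    rewrite -[r in r.-homog]card_ord -sum1_card.
    apply: (big_ind2 (fun (a : {mpoly K[\dim g0]}) (d : nat) => a \is d.-homog)).
    - exact: dhomog1.
    - by move=> a d a' d'; exact: dhomogM.
    by move=> i _; rewrite mxE.
  by case: (odd _); rewrite ?expr1 ?expr0 ?mulN1r ?mul1r ?rpredN.
pose c : K := (-1) ^+ e * 2%:R ^+ r.
pose h := c *: \det M.
have h_hom : h \is r.-homog by exact: rpredZ.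
have hE : resfield_proj hq h = (-1) ^+ e * 2%:R ^+ r * \det (mxsub f f (gram hq)).
  rewrite ME det_map_mx /h -mul_mpolyC rmorphM; congr (_ * _).
  by rewrite /c !(rmorphM, rmorphXn, rmorphN1, rmorph_nat).
have hq0 : h \notin ann_sym N.
  rewrite -(resfield_proj_eq0 hq) hE; rewrite unitmxE unitfE in f_unit.
  move: f_unit; set X := \det _; move: X => X X0.
  rewrite !mulf_eq0 signr_eq0 expf_eq0 (negPf resfield_two_neq0) andbF.
  exact: X0.
rewrite -hE; exact: odd_degree_resfield q_hom _ _ r_odd h_hom hq0 x.
Qed.
End CliffordMatrices.

(** * Splitting in the case of equality, and the theorem *)

Section TorsionFreeModule.
Variables (K : fieldType) (g : lieSuperalgebra K).
Local Notation g0 := (lie_part g false).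
Local Notation g1 := (lie_part g true).
Hypothesis two_neq0 : (2%:R : K) != 0.
Variables (N : lmodType (gr_env g)) (D : nat -> set N).
Variable hq : prime_ideal (ann_sym N).
Local Notation V := (sym_module N).
Local Notation F := (resfield hq).

(** At the minimal size the radical acts by zero, so [row_lift] descends to the quotient by the
    radical and represents C_q; minimality also gives irreducibility. *)
Lemma clifford_at_split n (E : 'I_(\dim g1) -> 'M[F]_n) :
  hom_closed (ann_sym N : {pred {mpoly K[\dim g0]}}) ->
  (forall i j, E i *m E j + E j *m E i = (gram hq i j)%:M) ->
  n = (2 ^ ell hq)%N -> clifford_split hq.
Proof.
move=> q_hom EE nE; have n_gt0 : (0 < n)%N by rewrite nE expn_gt0.
case: n n_gt0 E EE nE => // n _ E EE nE.
have F2 := resfield_two_neq0 hq two_neq0.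
have G_tr := gram_tr hq.
have nsq := gram_nonsquare (hq := hq) two_neq0 q_hom.
have rad0 x : gram_rad hq x -> row_lift E x = 0.
  by move=> hx; exact: (row_lift_radical F2 G_tr nsq EE nE hx).
have lift_lin := row_lift_linear E.
have lift_eq x y : mquot_proj (gram_rad hq) x = mquot_proj (gram_rad hq) y ->
    row_lift E x = row_lift E y.
  move=> /mquot_eq/rad0; rewrite -[x - y]addrC -scaleN1r lift_lin scaleN1r.
  by rewrite addrC => /eqP; rewrite subr_eq0 => /eqP.
pose E' (x : mquot (gram_rad hq)) := row_lift E (mquot_repr x).
have E'_lin : linear E'.
  move=> c x y; rewrite /E' -lift_lin; apply: lift_eq.
  by rewrite mquot_reprK raddfD /= -mquot_projZ !mquot_reprK.
have [|W W0 WE|L [L_simple L_dim]] :=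
  @clifford_simple_module F _ (@induced_form _ _ _ hq) n E' E'_lin.
- by move=> x y; exact: (row_lift_gram EE).
- apply: (gram_system_irr F2 G_tr nsq EE nE W0) => i.
  have := WE (mquot_proj (gram_rad hq) (delta_mx 0 i)).
  have -> // : E' (mquot_proj (gram_rad hq) (delta_mx 0 i)) = E i.
  by rewrite -[RHS]row_lift_delta; apply: lift_eq; rewrite mquot_reprK.
by exists L; split=> //; rewrite -nE.
Qed.

Lemma quot_growthE d e : hom_closed (ann_sym N : {pred {mpoly K[\dim g0]}}) ->
  e != 0 -> poly_growth d e (fun n => (hilb (prime_pred (ann_sym N)) n)%:R) ->
  quot_growth hq = (d, e).
Proof.
move=> q_hom e0 hde; apply: growthE e0 hde _; exists 0%N => n _.
refine (has_dim_transport (f := fun x => x) _ _ _ _ (quot_hilb hq q_hom n)) => //.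
by move=> y; exists y.
Qed.

Lemma module_growthE d e (s : seq (nat * V)) : is_graded_module D ->
  hom_gens (D : nat -> set V) s -> (forall y, gen_span s y) ->
  e != 0 -> poly_growth d e (fun n => (span_hilb 2 s n.*2)%:R) ->
  module_growth D = (d, e).
Proof.
move=> N_graded s_hom s_gen e0 hde; apply: growthE e0 hde _; exists 0%N => n _.
refine (@has_dim_transport K (restr (mpolyC_rmorph K (\dim g0)) V)
  (restr (gr_scal g) N) (fun x => x) _ (partial_sum D n.*2) _ _ _ _ _
  (span_hilb_dim (ltn0Sn 1) (sym_module_grading N_graded)
     (sym_scale_graded N_graded) n.*2 s_hom)) => // [c x y|y|y].
- by rewrite [c *: (x : restr (gr_scal g) N)]restrE -gr_sym_scal.
- by split=> [[]|].
by exists y.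
Qed.
End TorsionFreeModule.

Theorem lemma5p1 (R : realType) (g : lieSuperalgebra R[i])
    (N : lmodType (gr_env g)) (D : nat -> set N)
    (N_neq0 : exists x : N, x <> 0) (N_fg : fin_gen N)
    (N_graded : is_graded_module D)
    (q_prime : prime_ideal (ann_sym N)) (N_tf : torsion_free N) :
  [/\ module_dim D = quot_dim q_prime,
      module_mult D >= 2 ^+ ell q_prime * quot_mult q_prime &
      module_mult D = 2 ^+ ell q_prime * quot_mult q_prime ->
        clifford_split q_prime].
Proof.
have two_neq0 : (2%:R : R[i]) != 0 by rewrite pnatr_eq0.
have D_grading := sym_module_grading N_graded.
have D_scale := sym_scale_graded N_graded.
have q_ann p (x : sym_module N) : p \in ann_sym N -> p *: x = 0.
  by move=> /ann_symP/(_ x).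
have q_hom : hom_closed (ann_sym N : {pred {mpoly R[i][\dim (lie_part g false)]}}).
  by apply: (ann_hom_closed D_grading D_scale q_ann) => p /ann_symP.
have [s [s_hom s_gen]] := fin_gen_hom N_graded two_neq0 N_fg.
have [E [r_gt0 EE]] := odd_matrices q_prime N_tf s_gen N_neq0.
have r_ge : (2 ^ ell q_prime <= size (free_part (ann_sym N) s))%N.
  exact: (gram_system_dim (resfield_two_neq0 q_prime two_neq0) (gram_tr q_prime)
    (gram_nonsquare two_neq0 q_hom) r_gt0 EE).
have [d [e [e_gt0 hde]]] := hilb_prime_growth q_prime.
have hN := span_hilb_growth q_prime D_grading D_scale q_ann q_hom s_hom hde.
set r := size _ in E EE r_gt0 r_ge hN *.
have qE : quot_growth q_prime = (d, e) by apply: quot_growthE; rewrite ?gt_eqF.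
(* Both growths now share the degree [d], and the remaining claims compare [r] with 2 ^ ell after
   cancelling [e > 0]. *)
have NE : module_growth D = (d, r%:R * e).
  apply: (module_growthE N_graded s_hom s_gen) => //.
  by rewrite mulf_neq0 ?pnatr_eq0 -?lt0n ?gt_eqF.
rewrite /module_dim /module_mult /quot_dim /quot_mult NE qE /= -natrX.
split=> //; first by rewrite ler_pM2r // ler_nat.
move=> /(mulIf (lt0r_neq0 e_gt0))/eqP; rewrite eqr_nat => /eqP rE.
exact: (clifford_at_split two_neq0 q_hom EE rE).
Qed.
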